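(* Let $n\ge 2$ be an integer, let $0<\mu<\mu_*:=\frac{n^2+n+2}{n+2}$, and let $p=p_S(n+\mu)$. Let $f,g\in C_0^\infty(\mathbb{R}^n)$ be nonnegative functions, not both identically zero, with compact support contained in $\{x\in\mathbb{R}^n: |x|<\frac12\}$. For $\varepsilon>0$ consider the Cauchy problem $$u_{tt}-\Delta u+\frac{\mu}{1+t}u_t=|u|^p \quad\text{on } \mathbb{R}^n\times[0,T),\qquad u(x,0)=\varepsilon f(x),\quad u_t(x,0)=\varepsilon g(x).$$ Then there exist $\varepsilon_0>0$ and a constant $C>0$, independent of $\varepsilon$, such that for every $0<\varepsilon\le\varepsilon_0$: if $u$ is a solution of this problem on $\mathbb{R}^n\times[0,T)$ satisfying $$\operatorname{supp} u\subset\{(x,t)\in\mathbb{R}^n\times[0,T): |x|\le t+\tfrac12\},$$ then $T<\infty$ and $T\le \exp\left(C\varepsilon^{-p(p-1)}\right)$. That is, the lifespan $T(\varepsilon)$ is finite and satisfies $T(\varepsilon)\le\exp\left(C\varepsilon^{-p(p-1)}\right)$.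
   Context: For real $m>1$, $p_S(m):=\frac{m+1+\sqrt{m^2+10m-7}}{2(m-1)}$ is the Strauss exponent, i.e. the positive root $p$ of $2+(m+1)p-(m-1)p^2=0$. A solution on $\mathbb{R}^n\times[0,T)$ (with $0<T\le\infty$) means an energy solution: $u\in C([0,T);H^1(\mathbb{R}^n))\cap C^1([0,T);L^2(\mathbb{R}^n))\cap L^p_{loc}(\mathbb{R}^n\times[0,T))$ with $u(\cdot,0)=\varepsilon f$, $u_t(\cdot,0)=\varepsilon g$, such that for every $\phi\in C_0^\infty(\mathbb{R}^n\times[0,T))$ and every $t\in[0,T)$, $$\int_{\mathbb{R}^n}u_t(x,t)\phi(x,t)\,dx-\varepsilon\int_{\mathbb{R}^n} g(x)\phi(x,0)\,dx+\int_0^t\!\!\int_{\mathbb{R}^n}\Big(-u_s\phi_s+\nabla u\cdot\nabla\phi+\frac{\mu}{1+s}u_s\phi\Big)dx\,ds=\int_0^t\!\!\int_{\mathbb{R}^n}|u|^p\phi\,dx\,ds.$$ The lifespan $T(\varepsilon)$ is the supremum of all $T$ for which such a solution, with the stated support property, exists on $\mathbb{R}^n\times[0,T)$. *)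

(* Defs.v *)
From HB Require Import structures.
From mathcomp Require Import all_boot all_order all_algebra.
From mathcomp Require Import all_classical all_reals all_analysis.

Set Implicit Arguments.
Unset Strict Implicit.
Unset Printing Implicit Defensive.

Import Order.TTheory GRing.Theory Num.Theory.
Import numFieldNormedType.Exports.

Local Open Scope classical_set_scope.
Local Open Scope ring_scope.

Definition rV_display : measure_display -> measure_display.
Proof. exact. Qed.

(* The product sigma-algebra on row vectors, generated by the coordinates (as
   for the library's tuples).  For T = R it is the Borel sigma-algebra. *)
Section measurable_rV.
Context d (T : sigmaRingType d) (n : nat).

Definition rV_coord (i : 'I_n) (x : 'rV[T]_n) : T := x ord0 i.

Let rV_set0 : g_sigma_preimage rV_coord set0.
Proof. exact: sigma_algebra0. Qed.

Let rV_setC A : g_sigma_preimage rV_coord A -> g_sigma_preimage rV_coord (~` A).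
Proof. exact: sigma_algebraC. Qed.

Let rV_bigcup (F : _^nat) : (forall i, g_sigma_preimage rV_coord (F i)) ->
  g_sigma_preimage rV_coord (\bigcup_i (F i)).
Proof. exact: sigma_algebra_bigcup. Qed.

HB.instance Definition _ := @isMeasurable.Build (rV_display d)
  'rV[T]_n (g_sigma_preimage rV_coord) rV_set0 rV_setC rV_bigcup.

End measurable_rV.

Section measurable_rV_theory.
Context d1 d2 (T1 : measurableType d1) (T2 : measurableType d2).

Lemma measurable_rV_coord n (i : 'I_n) :
  measurable_fun [set: 'rV[T2]_n] (rV_coord i).
Proof.
move=> _ Y mY; rewrite setTI; apply: sub_sigma_algebra => /=.
rewrite -bigcup_seq/=; exists i => /=; first by rewrite mem_index_enum.
by exists Y => //; rewrite setTI.
Qed.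

Lemma measurable_fun_rV n (f : T1 -> 'rV[T2]_n) :
  (forall i, measurable_fun [set: T1] (rV_coord i \o f)) ->
  measurable_fun [set: T1] f.
Proof.
move=> mf.
suff prefS : g_sigma_preimage (fun i => @rV_coord _ T2 n i \o f) `<=` measurable.
  move=> _ A mA; apply: prefS; rewrite g_sigma_preimage_comp.
  by exists A.
apply: smallest_sub; first exact: sigma_algebra_measurable.
case: n => [|n] in f mf *; first by rewrite big_ord0.
rewrite -bigcup_mkord_ord; apply: bigcup_sub => i Ii.
by move=> A [B mB <-]; exact: mf.
Qed.

End measurable_rV_theory.

Section lebesgue_rV.
Context (R : realType).

Definition rV_cons n (z : measurableTypeR R * 'rV[R]_n) : 'rV[R]_n.+1 :=
  row_mx (z.1)%:M z.2.

Lemma rV_cons0 n z : @rV_cons n z ord0 ord0 = z.1.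
Proof.
have -> : ord0 = lshift n (ord0 : 'I_1) by exact/val_inj.
by rewrite [LHS]row_mxEl mxE eqxx.
Qed.

Lemma rV_consS n z (i : 'I_n) : @rV_cons n z ord0 (lift ord0 i) = z.2 ord0 i.
Proof.
have -> : lift ord0 i = rshift 1 i by exact/val_inj.
by rewrite [LHS]row_mxEr.
Qed.

Lemma measurable_rV_cons n : measurable_fun setT (@rV_cons n).
Proof.
apply: measurable_fun_rV => i; case: (unliftP ord0 i) => [j ->|->].
  rewrite [X in measurable_fun _ X](_ : _ = rV_coord j \o snd); last first.
    by apply/funext => z /=; rewrite /rV_coord rV_consS.
  exact: measurableT_comp (measurable_rV_coord _) measurable_snd.
rewrite [X in measurable_fun _ X](_ : _ = fst); last first.
  by apply/funext => z /=; rewrite /rV_coord rV_cons0.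
exact: measurable_fst.
Qed.

HB.instance Definition _ n := isMeasurableFun.Build _ _ _ _
  (@rV_cons n) (@measurable_rV_cons n).

Section step.
Context n (m : {sigma_finite_measure set 'rV[R]_n -> \bar R}).

Definition lebesgue_rV_step : set 'rV[R]_n.+1 -> \bar R :=
  pushforward (@lebesgue_measure R \x m)%E (@rV_cons n).

Let step0 : lebesgue_rV_step set0 = 0%E. Proof. exact: measure0. Qed.

Let step_ge0 A : (0 <= lebesgue_rV_step A)%E. Proof. exact: measure_ge0. Qed.

Let step_sigma_additive : semi_sigma_additive lebesgue_rV_step.
Proof. exact: measure_semi_sigma_additive. Qed.

HB.instance Definition _ := isMeasure.Build _ _ _ lebesgue_rV_step
  step0 step_ge0 step_sigma_additive.

Definition rV_uncons (x : 'rV[R]_n.+1) : measurableTypeR R * 'rV[R]_n :=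
  (x ord0 ord0, \row_i x ord0 (lift ord0 i)).

Lemma rV_consK : cancel (@rV_cons n) rV_uncons.
Proof.
move=> [a x]; rewrite /rV_uncons rV_cons0; congr pair.
by apply/rowP => i; rewrite mxE rV_consS.
Qed.

Let measurable_rV_uncons : measurable_fun setT rV_uncons.
Proof.
apply/measurable_fun_pairP; split; first exact: (measurable_rV_coord ord0).
apply: measurable_fun_rV => i.
rewrite [X in measurable_fun _ X](_ : _ = rV_coord (lift ord0 i)).
  exact: measurable_rV_coord.
by apply/funext => x /=; rewrite /rV_coord mxE.
Qed.

Let step_sigma_finite : sigma_finite setT lebesgue_rV_step.
Proof.
have /sigma_finiteP[F [TF ndF Foo]] := sigma_finiteT (@lebesgue_measure R).
have /sigma_finiteP[G [TG ndG Goo]] := sigma_finiteT m.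
exists (fun k => rV_uncons @^-1` (F k `*` G k)).
  apply/esym; rewrite -subTset => x _ /=.
  have [k _ Fk] : (\bigcup_k F k) (rV_uncons x).1 by rewrite -TF.
  have [l _ Gl] : (\bigcup_k G k) (rV_uncons x).2 by rewrite -TG.
  exists (maxn k l) => //; split.
  - by move: Fk; exact/subsetPset/ndF/leq_maxl.
  - by move: Gl; exact/subsetPset/ndG/leq_maxr.
move=> k; have [mF Fk] := Foo k; have [mG Gk] := Goo k; split.
  rewrite -[X in measurable X]setTI.
  by apply: measurable_rV_uncons => //; exact: measurableX.
rewrite /lebesgue_rV_step /pushforward -comp_preimage.
rewrite (_ : rV_uncons \o _ = id); last first.
  by apply/funext => z /=; rewrite rV_consK.
rewrite preimage_id product_measure1E// lte_mul_pinfty//.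
by rewrite ge0_fin_numE.
Qed.

HB.instance Definition _ := Measure_isSigmaFinite.Build _ _ _ lebesgue_rV_step
  step_sigma_finite.

End step.

(* Lebesgue measure on R^n: Dirac mass on R^0, and the image of the product
   measure on R * R^n under the identification with R^(n+1). *)
Fixpoint lebesgue_rV n : {sigma_finite_measure set 'rV[R]_n -> \bar R} :=
  if n is k.+1 then lebesgue_rV_step (lebesgue_rV k)
  else \d_(0 : 'rV[R]_0).

Lemma lebesgue_rV_box n (A : 'I_n -> set (measurableTypeR R)) :
  (forall i, measurable (A i)) ->
  lebesgue_rV n [set x | forall i, A i (x ord0 i)] =
  (\prod_i lebesgue_measure (A i))%E.
Proof.
elim: n A => [|n IH] A mA /=.
  rewrite big_ord0 diracE mem_set// => -[].
  by [].
rewrite big_ord_recl -IH// /lebesgue_rV_step /pushforward.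
have mB : measurable [set x : 'rV[R]_n | forall i, A (lift ord0 i) (x ord0 i)].
  rewrite [X in measurable X](_ : _ = \bigcap_(i in [set: 'I_n])
      (rV_coord i @^-1` A (lift ord0 i))).
    apply: fin_bigcap_measurable => [|i _]; first exact: finite_finset.
    rewrite -[X in measurable X]setTI.
    exact: (measurable_rV_coord i measurableT (mA (lift ord0 i))).
  by apply/seteqP; split => [x Ax i _|x Ax i]; exact: Ax.
rewrite -product_measure1E//; congr (product_measure1 _ _ _).
apply/seteqP; split => -[a x] /= => [Ax|[Aa Ax] i].
  split=> [|i]; first by have := Ax ord0; rewrite rV_cons0.
  by have := Ax (lift ord0 i); rewrite rV_consS.
by case: (unliftP ord0 i) => [j ->|->]; rewrite ?rV_consS ?rV_cons0.
Qed.

End lebesgue_rV.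

Section smooth_functions.
Context (R : realType) (V : normedModType R).

(* On a finite-dimensional V this is the usual class C^k. *)
Fixpoint Ck (k : nat) (f : V -> R) : Prop :=
  if k is j.+1 then
    continuous f /\
    forall v : V, (forall x, derivable f x v) /\ Ck j (fun x => 'D_v f x)
  else continuous f.

Definition smooth (f : V -> R) : Prop := forall k, Ck k f.

(* C_0^oo(D), for D the whole space or a space-time slab R^n x [0, T).  In the
   latter case f need not vanish at time 0, and smoothness up to time 0 means
   that f is the restriction of a function that is smooth on the whole of V;
   only the values of f on D matter for the support condition. *)
Definition test_function (D : set V) (f : V -> R) : Prop :=
  let supp := closure [set x | D x /\ f x != 0] in
  [/\ smooth f, compact supp & supp `<=` D].

End smooth_functions.

Section euclidean_space.
Context (R : realType) (n : nat).
Implicit Types (x : 'rV[R]_n) (v : 'rV[R]_n -> R).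

Let mu := lebesgue_rV R n.

(* The library's norm on row vectors is the maximum norm. *)
Definition enorm x : R := Num.sqrt (\sum_i x ord0 i ^+ 2).

Definition partial (i : 'I_n) v x : R := 'D_(delta_mx ord0 i) v x.

Definition weak_gradient v (Dv : 'I_n -> 'rV[R]_n -> R) : Prop :=
  forall psi, test_function [set: 'rV[R]_n] psi -> forall i,
    \int[mu]_x (v x * partial i psi x) = - \int[mu]_x (Dv i x * psi x).

(* v belongs to H^1(R^n) and Dv is (a representative of) its gradient. *)
Definition in_H1 v (Dv : 'I_n -> 'rV[R]_n -> R) : Prop :=
  [/\ v \in Lfun mu 2%:E, (forall i, Dv i \in Lfun mu 2%:E)
    & weak_gradient v Dv].

Definition L2norm v : \bar R := 'N[mu]_2%:E[EFin \o v]%E.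

Definition H1norm v (Dv : 'I_n -> 'rV[R]_n -> R) : \bar R :=
  ((L2norm v `^ 2 + \sum_i L2norm (Dv i) `^ 2) `^ 2^-1)%E.

End euclidean_space.

Section damped_wave.
Context (R : realType) (n : nat).
Implicit Types (T : \bar R) (t : R) (f g : 'rV[R]_n -> R)
  (u ut : R -> 'rV[R]_n -> R).

Let mu := lebesgue_rV R n.

(* Space-time points are pairs (time, position). *)
Let spacetime_mu : {measure set (measurableTypeR R * 'rV[R]_n) -> \bar R} :=
  (@lebesgue_measure R \x mu)%E.

Definition time_interval T : set R := [set t | 0 <= t /\ (t%:E < T)%E].

Definition slab T : set (R * 'rV[R]_n) := [set z | time_interval T z.1].

Definition C_H1 T u (Du : R -> 'I_n -> 'rV[R]_n -> R) : Prop :=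
  (forall t, time_interval T t -> in_H1 (u t) (Du t)) /\
  forall t0, time_interval T t0 ->
    H1norm (u t \- u t0) (fun i => Du t i \- Du t0 i)
      @[t --> within (time_interval T) (nbhs t0)] --> 0%E.

(* u is in C^1([0, T); L^2) with time derivative ut; at t0 = 0 the derivative
   is one-sided. *)
Definition C1_L2 T u ut : Prop :=
  [/\ forall t, time_interval T t ->
        u t \in Lfun mu 2%:E /\ ut t \in Lfun mu 2%:E,
      forall t0, time_interval T t0 ->
        L2norm (fun x => (u t x - u t0 x) / (t - t0) - ut t0 x)
          @[t --> within (time_interval T) t0^'] --> 0%E
    & forall t0, time_interval T t0 ->
        L2norm (ut t \- ut t0)
          @[t --> within (time_interval T) (nbhs t0)] --> 0%E].

Definition Lp_loc T (p : R) u : Prop :=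
  measurable_fun (slab T : set (measurableTypeR R * 'rV[R]_n))
    (fun z => u z.1 z.2) /\
  forall K : set (R * 'rV[R]_n), compact K -> K `<=` slab T ->
    (\int[spacetime_mu]_(z in K) (`|u z.1 z.2| `^ p)%:E < +oo)%E.

Definition weak_form T (mu0 p eps : R) g u ut
    (Du : R -> 'I_n -> 'rV[R]_n -> R) : Prop :=
  forall phi : R * 'rV[R]_n -> R, test_function (slab T) phi ->
  forall t, time_interval T t ->
    \int[mu]_x (ut t x * phi (t, x)) - eps * \int[mu]_x (g x * phi (0, x))
    + \int[@lebesgue_measure R]_(s in `[0, t])
        \int[mu]_x (- ut s x * derive1 (fun r => phi (r, x)) s
                    + \sum_i Du s i x * partial i (fun y => phi (s, y)) x
                    + mu0 / (1 + s) * ut s x * phi (s, x))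
    = \int[@lebesgue_measure R]_(s in `[0, t])
        \int[mu]_x (`|u s x| `^ p * phi (s, x)).

Definition energy_solution (mu0 p eps : R) f g T u : Prop :=
  exists (ut : R -> 'rV[R]_n -> R) (Du : R -> 'I_n -> 'rV[R]_n -> R),
  [/\ C_H1 T u Du, C1_L2 T u ut, Lp_loc T p u,
      {ae mu, forall x, u 0 x = eps * f x} /\
      {ae mu, forall x, ut 0 x = eps * g x}
    & weak_form T mu0 p eps g u ut Du].

(* Support of the class of u modulo null sets, relative to R^n x [0, T): the
   complement of the largest relatively open set on which u = 0 a.e. *)
Definition ess_support T u : set (R * 'rV[R]_n) :=
  [set z | slab T z /\ forall U, nbhs z U ->
     ~ {ae spacetime_mu, forall w, U w -> slab T w -> u w.1 w.2 = 0}].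

Definition supported_solution (mu0 p eps : R) f g T u : Prop :=
  energy_solution mu0 p eps f g T u /\
  ess_support T u `<=` [set z | enorm z.2 <= z.1 + 2^-1].

Definition lifespan (mu0 p eps : R) f g : \bar R :=
  ereal_sup [set T | (0 < T)%E /\
                     exists u, supported_solution mu0 p eps f g T u].

End damped_wave.

Definition strauss_exponent (R : realType) (m : R) : R :=
  (m + 1 + Num.sqrt (m ^+ 2 + 10 * m - 7)) / (2 * (m - 1)).

(* Main.v *)
Require Import Defs.
From mathcomp Require Import all_boot all_order all_algebra.
From mathcomp Require Import all_classical all_reals all_analysis.
From mathcomp Require Import measurable_realfun ring lra.

(** The operator conjugate to the damped wave operator sends phi to
    phi_tt - Laplace phi - (mu phi / (1 + t))_t. It annihilates the self-similar
    functions
      (1 + t)^{-be} F((be + mu) / 2, (be + 1) / 2; n / 2; |x|^2 / (1 + t)^2),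
    F being the Gauss hypergeometric function. If be + mu and be + 1 are positive,
    then such a function is positive on the cone |x| <= t + 1/2, and its
    singularity at the light cone is governed by
    A = (be + mu) / 2 + (be + 1) / 2 - n / 2 + 1. The equation is tested with it,
    multiplied by a time cutoff E that varies between r/2 and r. On the linear side
    only terms with a derivative of E are left; they are bounded by
      (C / r) E^{1/p} (1 + t)^{-be-1+A} (1 + t - |x|)^{-A}   for r/2 <= t <= r.
    Hoelder's inequality with the weight (1 + t)^{-beta}, where
    beta = (n - 1 - mu) / 2 - 1/p, bounds the integral of |u|^p (1 + t)^{-be} E plus
    eps times a positive constant by
      C D^{1/p} L^{1/q},   1/p + 1/q = 1,
    with D the part of the integral of |u|^p (1 + t)^{-beta} E over the window
    r/2 <= t <= r and L the integral of y^{-Aq} over 1/2 <= y <= r + 1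
    (scale_estimate). No power of r appears: for be = beta and be = beta + 1 all of
    them cancel precisely when p is the Strauss exponent. The positivity of
    beta + 1 is the condition mu < (n^2 + n + 2) / (n + 2) (strauss_beta_gt).

    Let B_j be the integral of |u|^p (1 + t)^{-beta} E for r = 2^j; then
    D <= B_j - B_{j-1}. For be = beta one has Aq = 1, so that L is of order j; for
    be = beta + 1 one has Aq > 1, so that L is bounded. Hence (dyadic_estimate)
      B_j <= C (B_j - B_{j-1})^{1/p} j^{1 - 1/p}   and
      eps <= C (B_j - B_{j-1})^{1/p}.
    These are the discrete forms of B' >= c B^p j^{1-p} and B' >= c eps^p, and they
    are incompatible as soon as j exceeds a multiple of eps^{-p(p-1)}
    (discrete_blowup). Since the scale is r = 2^j, the solution cannot exist beyond
    an exponential of that quantity.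

    The hypergeometric function itself is never formed: its Taylor polynomials in
    |x|^2 give test functions that are finite sums of separated products, and their
    truncation errors telescope to a single term that vanishes in the limit
    (symbol_sum, remainder_vanish). The singularity is measured through the
    coefficients alone, by comparison with (1 - z)^{-A} (hyp_sum_bound). The
    weight is integrated over the cone in time before space
    (cone_weight_integral), which avoids polar coordinates. *)


Set Implicit Arguments.
Unset Strict Implicit.
Unset Printing Implicit Defensive.

Import Order.TTheory GRing.Theory Num.Theory.
Import numFieldNormedType.Exports.

Local Open Scope classical_set_scope.
Local Open Scope ring_scope.

(** * Calculus of functions of class C^k *)

Section Ck_calculus.
Context {R : realType}.
Implicit Types V W : normedModType R.

Lemma Ck_continuous V k (f : V -> R) : Ck k f -> continuous f.
Proof. by case: k => [|k] //= []. Qed.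

Lemma Ck_derive V j (f : V -> R) v : Ck j.+1 f -> Ck j ('D_v f).
Proof. by case=> _ /(_ v)[]. Qed.

Lemma Ck_is_derive V j (f : V -> R) v x : Ck j.+1 f -> is_derive x v f ('D_v f x).
Proof. by case=> _ /(_ v)[+ _] => /(_ x)/derivableP. Qed.

(** Exhibiting the derivatives is the practical way in, as the definition only
    mentions the values of the derivative operator. *)
Lemma Ck_intro V j (f : V -> R) (df : V -> V -> R) : continuous f ->
  (forall v x, is_derive x v f (df v x)) -> (forall v, Ck j (df v)) -> Ck j.+1 f.
Proof.
move=> cf dfP Cdf; split=> // v; split=> [x|]; first by have [] := dfP v x.
rewrite (_ : (fun x => _) = df v)//; apply/funext => x.
by have [_ ->] := dfP v x.
Qed.

Lemma CkW V k (f : V -> R) : Ck k.+1 f -> Ck k f.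
Proof.
elim: k f => [|k IH] f [cf df] //; split=> // v.
by have [dfv Cfv] := df v; split=> //; exact: IH.
Qed.

Lemma Ck_cst V k (a : R) : Ck k (fun _ : V => a).
Proof.
elim: k a => [|k IH] a; first by move=> ?; exact: cvg_cst.
apply: (@Ck_intro V k (fun=> a) (fun _ _ => 0)).
- by move=> ?; exact: cvg_cst.
- by move=> v; exact: IH.
Qed.

Lemma CkD V k (f g : V -> R) : Ck k f -> Ck k g -> Ck k (fun x => f x + g x).
Proof.
elim: k f g => [|k IH] f g Cf Cg.
  by move=> x; apply: cvgD; [exact: Cf|exact: Cg].
apply: (@Ck_intro _ _ _ (fun v x => 'D_v f x + 'D_v g x)).
- by move=> x; apply: cvgD; apply: Ck_continuous; eassumption.
- by move=> v x; exact: (is_deriveD (Ck_is_derive v x Cf) (Ck_is_derive v x Cg)).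
- by move=> v; apply: IH; exact: Ck_derive.
Qed.

Lemma CkM V k (f g : V -> R) : Ck k f -> Ck k g -> Ck k (fun x => f x * g x).
Proof.
elim: k f g => [|k IH] f g Cf Cg.
  by move=> x; apply: cvgM; [exact: Cf|exact: Cg].
apply: (@Ck_intro _ _ _ (fun v x => f x * 'D_v g x + g x * 'D_v f x)).
- by move=> x; apply: cvgM; apply: Ck_continuous; eassumption.
- by move=> v x; exact: (is_deriveM (Ck_is_derive v x Cf) (Ck_is_derive v x Cg)).
- move=> v; apply: CkD; apply: IH;
  [exact: CkW Cf|exact: Ck_derive Cg|exact: CkW Cg|exact: Ck_derive Cf].
Qed.

Lemma is_derive_comp1 V (h : R -> R) (q : V -> R) x v (dh dq : R) :
  is_derive (q x) 1 h dh -> is_derive x v q dq ->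
  is_derive x v (h \o q) (dh * dq).
Proof.
move=> hd [qd <-]; have qd' := qd; move/derivable1P in qd'.
have /derivableP d1 := qd'.
have hd' : is_derive ((fun t : R => q (t *: v + x)) 0) 1 h dh.
  by rewrite scale0r add0r.
have [dc Dc] := is_derive1_comp hd' d1.
have E (f : V -> R) : derivable f x v ->
  'D_v f x = 'D_1 (fun t : R => f (t *: v + x)) 0.
  move=> _; rewrite /derive; set g1 := fun t : R => t^-1 *: _; set g2 := fun t : R => t^-1 *: _.
  suff -> : g1 = g2 by [].
  by apply/funext => t; rewrite /g1 /g2 /= addr0 scale0r add0r [_%:A]mulr1.
have dhq : derivable (h \o q) x v by apply/derivable1P; exact: dc.
by split=> //; rewrite E // (E q)//.
Qed.

Lemma is_derive_dir (h : R -> R) (x v dh : R) :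
  is_derive x 1 h dh -> is_derive x v h (dh * v).
Proof.
move=> hd; have := @is_derive_comp1 R h id x v dh v hd (is_derive_id x v).
by [].
Qed.

Lemma is_derive_continuous (h : R -> R) (x dh : R) :
  is_derive x 1 h dh -> {for x, continuous h}.
Proof. by case=> /derivable1_diffP/differentiable_continuous. Qed.

Lemma Ck_intro1 j (h dh : R -> R) :
  (forall x : R, is_derive x 1 h (dh x)) -> Ck j dh -> Ck j.+1 h.
Proof.
move=> hd Cdh; apply: (@Ck_intro _ _ _ (fun v x => dh x * v)).
- by move=> x; exact: is_derive_continuous (hd x).
- by move=> v x; exact: is_derive_dir.
- by move=> v; apply: CkM => //; exact: Ck_cst.
Qed.

Lemma Ck_id k : Ck k (fun x : R => x).
Proof.
case: k => [|k]; first by move=> x.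
by apply: (@Ck_intro1 _ _ (fun=> 1)) (@Ck_cst R _ 1) => x; exact: is_derive_id.
Qed.

(** The chain rule gives a product of two functions that are of class C^k by
    induction, provided that the induction ranges over all h and q. *)
Lemma Ck_comp V k (h : R -> R) (q : V -> R) : Ck k h -> Ck k q -> Ck k (h \o q).
Proof.
elim: k h q => [|k IH] h q Ch Cq.
  by move=> x; apply: continuous_comp; [exact: Cq|exact: Ch].
apply: (@Ck_intro _ _ _ (fun v x => 'D_1 h (q x) * 'D_v q x)).
- move=> x; apply: continuous_comp; first exact: (Ck_continuous Cq).
  exact: (Ck_continuous Ch).
- by move=> v x; exact: (is_derive_comp1 (Ck_is_derive (1 : R) (q x) Ch) (Ck_is_derive v x Cq)).
- move=> v; apply: CkM; last exact: Ck_derive.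
  exact: (IH _ q (Ck_derive (1 : R) Ch) (CkW Cq)).
Qed.

Lemma CkX V k (f : V -> R) m : Ck k f -> Ck k (fun x => f x ^+ m).
Proof.
move=> Cf; elim: m => [|m IH].
  by rewrite (_ : (fun _ => _) = (fun=> 1)); [exact: Ck_cst|exact/funext].
rewrite (_ : (fun _ => _) = (fun x => f x * f x ^+ m)); first exact: CkM.
by apply/funext => x; rewrite exprS.
Qed.

Lemma Ck_sum V k (I : Type) (s : seq I) (F : I -> V -> R) :
  (forall i, Ck k (F i)) -> Ck k (fun x => \sum_(i <- s) F i x).
Proof.
move=> CF; elim: s => [|i s IH].
  by rewrite (_ : (fun _ => _) = fun=> 0); [exact: Ck_cst|
     apply/funext => x; rewrite big_nil].
rewrite (_ : (fun _ => _) = (fun x => F i x + \sum_(j <- s) F j x)).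
  exact: CkD.
by apply/funext => x; rewrite big_cons.
Qed.

Lemma is_derive_linear V W (L : {linear W -> V}) (f : V -> R) x w df :
  is_derive (L x) (L w) f df -> is_derive x w (f \o L) df.
Proof.
have E : (fun h : R => h^-1 *: ((f \o L) (h *: w + x) - (f \o L) x)) =
         (fun h : R => h^-1 *: (f (h *: L w + L x) - f (L x))).
  by apply/funext => h /=; rewrite linearP.
case=> fd <-; split.
  by rewrite /derivable; rewrite /= in E *; move: fd; rewrite /derivable -E.
by rewrite /derive; rewrite /= in E *; rewrite -E.
Qed.

(** Meant for the projections of space-time onto time and space, and for the
    coordinates. *)
Lemma Ck_linear V W k (L : {linear W -> V}) (f : V -> R) : continuous L ->
  Ck k f -> Ck k (f \o L).
Proof.
move=> cL; elim: k f => [|k IH] f Cf.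
  by move=> x; apply: continuous_comp; [exact: cL|exact: Cf].
apply: (@Ck_intro _ _ _ (fun v => 'D_(L v) f \o L)).
- by move=> x; apply: continuous_comp; [exact: cL|exact: (Ck_continuous Cf)].
- by move=> v x; exact: (is_derive_linear (Ck_is_derive (L v) (L x) Cf)).
- by move=> v; apply: IH; exact: Ck_derive.
Qed.

End Ck_calculus.

(** * A smooth cutoff function *)

Section cutoff.
Context {R : realType}.

(** The derivative of flat m is a combination of flat m.+1 and flat m.+2, so that
    smoothness of the whole family is one induction. *)
Definition flat (m : nat) (x : R) : R :=
  if 0 < x then x^-1 ^+ m * expR (- x^-1) else 0.

Lemma flat_le0 m x : x <= 0 -> flat m x = 0.
Proof. by rewrite /flat leNgt; case: ltP. Qed.

Lemma flat_gt0 m x : 0 < x -> 0 < flat m x.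
Proof. by rewrite /flat => x0; rewrite x0 mulr_gt0 ?expR_gt0 ?exprn_gt0 ?invr_gt0. Qed.

Lemma flat_ge0 m x : 0 <= flat m x.
Proof. by have [/flat_le0->|/flat_gt0/ltW] := leP x 0. Qed.

(** Quadratic decay at 0 is what the difference quotients there require; it is
    read off the exponential series at 1/x. *)
Lemma flat_le_sqr m x : flat m x <= (m.+2)`!%:R * x ^+ 2.
Proof.
rewrite /flat; case: ifPn => [x0|_]; last by rewrite mulr_ge0 ?sqr_ge0.
have y0 : 0 < x^-1 by rewrite invr_gt0.
have := @expR_ge1Dxn R x^-1 m.+1 (ltW y0).
move/(le_trans (ler_wpDl ler01 (lexx _))).
rewrite ler_pdivrMr ?ltr0n ?fact_gt0// => h.
rewrite expRN ler_pdivrMr ?expR_gt0//.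
have -> : x^-1 ^+ m = x^-1 ^+ m.+2 * x ^+ 2.
  by rewrite -addn2 exprD -mulrA -exprMn mulVf ?gt_eqF// expr1n mulr1.
by rewrite [leRHS]mulrAC ler_pM2r ?exprn_gt0// mulrC.
Qed.

Lemma is_derive_flat m (x : R) :
  is_derive x 1 (flat m) (flat m.+2 x - m%:R * flat m.+1 x).
Proof.
have [x0|x0|->] := ltgtP x 0.
- rewrite !flat_le0 ?ltW// mulr0 subr0.
  apply: (@near_eq_is_derive _ _ _ (fun=> 0)).
  by near=> y; rewrite flat_le0// ltW//; near: y; exact: lt_nbhsl.
- apply: (@near_eq_is_derive R R R (fun y : R => y^-1 ^+ m * expR (- y^-1))).
    by near=> y; rewrite /flat ifT//; near: y; exact: lt_nbhsr.
  have iv : is_derive x 1 (fun y : R => y^-1) (- x ^- 2).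
    have := @is_deriveV R id x 1 1 (lt0r_neq0 x0) (is_derive_id _ _).
    by move/is_derive_eq; apply; rewrite /= /GRing.scale /= mulr1.
  have iX : is_derive x 1 (fun y : R => y^-1 ^+ m) (m%:R * x^-1 ^+ m.-1 * (- x ^- 2)).
    have := @is_deriveX _ _ (fun y : R => y^-1) m x 1 _ iv.
    by rewrite exprfctE; move/is_derive_eq; apply.
  have iE : is_derive x 1 (fun y : R => expR (- y^-1)) (expR (- x^-1) * x ^- 2).
    apply: (@is_derive1_comp _ expR (fun y => - y^-1)).
    rewrite -[x ^- 2]opprK. exact: is_deriveN.
  have := is_deriveM iX iE; move/is_derive_eq; apply.
  rewrite /flat x0 /GRing.scale /=.
  case: m {iX} => [|m]; rewrite /= !exprS ?expr0; field; exact: lt0r_neq0.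
- rewrite !flat_le0// mulr0 subr0.
  have cv : (h^-1 *: ((flat m \o shift 0) (h *: 1) - flat m 0) : R) @[h --> (0:R)^'] --> (0:R).
    apply/cvgrPdist_le => e e0; near=> h.
    have h0 : h != 0 by near: h; exact: nbhs_dnbhs_neq.
    rewrite sub0r normrN /= addr0 [_%:A]mulr1 (flat_le0 m (lexx 0)) subr0.
    rewrite normrM normfV ler_pdivrMl ?normr_gt0//.
    rewrite ger0_norm ?flat_ge0//; apply: (le_trans (flat_le_sqr _ _)).
    rewrite -real_normK ?num_real// expr2 mulrA mulrC ler_pM2l ?normr_gt0//.
    rewrite mulrC -ler_pdivlMr ?ltr0n ?fact_gt0//.
    near: h; apply: dnbhs0_le; rewrite divr_gt0// ltr0n fact_gt0//.
  split; first by apply/cvg_ex; exists 0.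
  exact: cvg_lim cv.
Unshelve. all: by end_near. Qed.

Lemma Ck_flat k m : Ck k (flat m).
Proof.
elim: k m => [|k IH] m.
  by move=> x; exact: is_derive_continuous (is_derive_flat m x).
apply: (Ck_intro1 (is_derive_flat m)).
have -> : (fun x => flat m.+2 x - m%:R * flat m.+1 x) =
          (fun x => flat m.+2 x + (- m%:R) * flat m.+1 x).
  by apply/funext => x; rewrite mulNr.
by apply: CkD; [exact: IH|apply: CkM; [exact: Ck_cst|exact: IH]].
Qed.

Lemma flat0_incr x y : x <= y -> flat 0 x <= flat 0 y.
Proof.
have [x0 _|x0 xy] := leP x 0; first by rewrite (flat_le0 _ x0) flat_ge0.
rewrite /flat x0 (lt_le_trans x0 xy) !expr0 !mul1r ler_expR lerN2.
by rewrite lef_pV2// posrE// (lt_le_trans x0 xy).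
Qed.

(** Composing the flat function with itself gives a plateau without any
    division by a non-constant function. *)
Definition cutoff (x : R) : R :=
  flat 0 (flat 0 1 - flat 0 x) / flat 0 (flat 0 1).

Let c0 : 0 < flat 0 (flat 0 1).
Proof. by rewrite !flat_gt0. Qed.

Lemma cutoff_1 x : x <= 0 -> cutoff x = 1.
Proof. by move=> x0; rewrite /cutoff (flat_le0 _ x0) subr0 divff// gt_eqF. Qed.

Lemma cutoff_0 x : 1 <= x -> cutoff x = 0.
Proof.
by move=> x1; rewrite /cutoff flat_le0 ?mul0r// subr_le0 flat0_incr.
Qed.

Lemma cutoff_ge0 x : 0 <= cutoff x.
Proof. by rewrite divr_ge0 ?flat_ge0. Qed.

Lemma cutoff_decr x y : x <= y -> cutoff y <= cutoff x.
Proof.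
by move=> xy; rewrite ler_pM2r ?invr_gt0// flat0_incr// lerD2l lerN2 flat0_incr.
Qed.

Lemma cutoff_le1 x : cutoff x <= 1.
Proof.
by have [/cutoff_1->//|/ltW/cutoff_decr] := leP x 0; rewrite (cutoff_1 (lexx 0)).
Qed.

Lemma Ck_cutoff k : Ck k cutoff.
Proof.
rewrite (_ : cutoff = (fun x => (flat 0 \o (fun x => flat 0 1 + (-1) * flat 0 x)) x
   * (flat 0 (flat 0 1))^-1)); last by apply/funext => x; rewrite /= mulN1r.
apply: CkM; last exact: Ck_cst.
apply: Ck_comp; first exact: Ck_flat.
apply: CkD; first exact: Ck_cst.
by apply: CkM; [exact: Ck_cst|exact: Ck_flat].
Qed.

(** Meant for the derivatives of the cutoff, which vanish outside the unit
    interval. *)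
Lemma continuous_bounded_flat (h : R -> R) : continuous h ->
  (forall x, x < 0 -> h x = 0) -> (forall x, 1 < x -> h x = 0) ->
  exists M, 0 < M /\ forall x, `|h x| <= M.
Proof.
move=> ch h0 h1.
have c01 : {within `[0, 1], continuous (fun x : R => `|h x|)}.
  apply: continuous_subspaceT => x.
  by apply: continuous_comp; [exact: ch|exact: norm_continuous].
have [c _ cP] := EVT_max (@ler01 R) c01.
exists (`|h c| + 1); split; first by rewrite ltr_wpDl.
move=> x; have [x0|x0] := ltP x 0; first by rewrite h0// normr0 addr_ge0.
have [x1|x1] := ltP 1 x; first by rewrite h1// normr0 addr_ge0.
by rewrite (le_trans (cP x _)) ?lerDl// in_itv/= x0.
Qed.

End cutoff.

(** * Radial functions and test functions *)

Lemma closure_sub_closed (T : topologicalType) (A C : set T) :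
  closed C -> A `<=` C -> closure A `<=` C.
Proof. by rewrite closureEbigcap => cC AC x; apply. Qed.

Section test_functions.
Context {R : realType} {n : nat}.
Implicit Types x v : 'rV[R]_n.

(** Radial functions are written as functions of the squared Euclidean norm,
    which is smooth at the origin. *)
Definition sqn x : R := \sum_i x ord0 i ^+ 2.

Lemma sqn_ge0 x : 0 <= sqn x.
Proof. by apply: sumr_ge0 => i _; exact: sqr_ge0. Qed.

Lemma is_derive_coord (i : 'I_n) x v :
  is_derive x v (fun y : 'rV[R]_n => y ord0 i) (v ord0 i).
Proof.
have @f : {linear 'rV[R]_n -> R}.
  by exists (fun N : 'rV[R]_n => N ord0 i); do 2![eexists]; do ?[constructor];
     rewrite ?mxE// => ? *; rewrite ?mxE//; move=> ?; rewrite !mxE.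
exact: (@is_derive_linear R R _ f id x v _ (is_derive_id (f x) (f v))).
Qed.

Lemma Ck_coord k (i : 'I_n) : Ck k (fun y : 'rV[R]_n => y ord0 i).
Proof.
case: k => [|k]; first exact: coord_continuous.
apply: (@Ck_intro _ _ _ _ (fun v _ => v ord0 i)).
- exact: coord_continuous.
- by move=> v x; exact: is_derive_coord.
- by move=> v; exact: Ck_cst.
Qed.

Lemma Ck_sqn k : Ck k sqn.
Proof. by apply: Ck_sum => i; apply: CkX; exact: Ck_coord. Qed.

Lemma continuous_sqn : continuous sqn.
Proof. exact: (Ck_continuous (Ck_sqn 0)). Qed.

Lemma is_derive_sqn (i : 'I_n) x :
  is_derive x (delta_mx ord0 i) sqn (2 * x ord0 i).
Proof.
have h (j : 'I_n) : is_derive x (delta_mx ord0 i : 'rV[R]_n)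
  (fun y : 'rV[R]_n => y ord0 j ^+ 2) (2 * x ord0 j * (i == j)%:R).
  have := is_deriveX 2 (is_derive_coord j x (delta_mx ord0 i)).
  rewrite exprfctE expr1 mxE eqxx /= eq_sym => hX.
  by apply: is_derive_eq hX _.
have := is_derive_sum h.
rewrite (_ : \sum_(j < n) _ = 2 * x ord0 i); last first.
  rewrite (bigD1 i)//= eqxx mulr1 big1 ?addr0// => j ji.
  by rewrite eq_sym (negbTE ji) mulr0.
rewrite (_ : \sum_(j < n) _ = sqn)//.
by apply/funext => y; rewrite fct_sumE.
Qed.

Lemma partial_radial (h : R -> R) (dh : R) (i : 'I_n) x :
  is_derive (sqn x) 1 h dh ->
  is_derive x (delta_mx ord0 i) (h \o sqn) (dh * (2 * x ord0 i)).
Proof. by move=> hd; exact: is_derive_comp1 hd (is_derive_sqn i x). Qed.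

Lemma closed_sqn_le (Y : R) : closed [set x | sqn x <= Y].
Proof.
rewrite (_ : mkset _ = sqn @^-1` [set y | y <= Y])//.
by apply: closed_comp; [move=> x _; exact: continuous_sqn|exact: closed_le].
Qed.

Lemma coord_le_sqn (i : 'I_n) x : x ord0 i ^+ 2 <= sqn x.
Proof.
by rewrite /sqn (bigD1 i)//= lerDl sumr_ge0// => j _; rewrite sqr_ge0.
Qed.

Lemma compact_sqn_le (Y : R) : compact [set x | sqn x <= Y].
Proof.
have [Y0|Y0] := ltP Y 0.
  rewrite (_ : mkset _ = set0); first exact: compact0.
  apply/seteqP; split => // x /= xY; have := sqn_ge0 x; lra.
apply: (@subclosed_compact _ _ [set x : 'rV[R]_n | forall i : 'I_n,
    `[- Num.sqrt Y, Num.sqrt Y]%classic (x ord0 i)]).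
- exact: closed_sqn_le.
- apply: (@rV_compact R n (fun=> `[- Num.sqrt Y, Num.sqrt Y]%classic)) => i.
  exact: segment_compact.
- move=> x /= xY i; rewrite in_itv/= -ler_norml -sqrtr_sqr ler_wsqrtr//.
  exact: le_trans (coord_le_sqn i x) xY.
Qed.

Lemma test_function_rV (f : 'rV[R]_n -> R) (Y : R) : smooth f ->
  (forall x, Y < sqn x -> f x = 0) -> test_function [set: 'rV[R]_n] f.
Proof.
move=> sf f0; split => //.
apply: (@subclosed_compact _ _ [set x | sqn x <= Y]).
- exact: closed_closure.
- exact: compact_sqn_le.
- apply: closure_sub_closed => //; first exact: closed_sqn_le.
  by move=> x [_]; apply: contraNT; rewrite -ltNge => /f0->.
Qed.

(** The support is taken relative to the slab, so that a need not vanish near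
    time 0. *)
Lemma test_function_slab (T : \bar R) (a : R -> R) (b : 'rV[R]_n -> R) (t1 Y : R) :
  smooth a -> smooth b -> (t1%:E < T)%E ->
  (forall t, t1 < t -> a t = 0) -> (forall x, Y < sqn x -> b x = 0) ->
  test_function (slab T) (fun z : R * 'rV[R]_n => a z.1 * b z.2).
Proof.
move=> sa sb t1T a0 b0.
have cK : compact (`[0, t1]%classic `*` [set x : 'rV[R]_n | sqn x <= Y]).
  by apply: compact_setX; [exact: segment_compact|exact: compact_sqn_le].
have sub : closure [set z : R * 'rV[R]_n | slab T z /\ a z.1 * b z.2 != 0] `<=`
     `[0, t1]%classic `*` [set x : 'rV[R]_n | sqn x <= Y].
  apply: closure_sub_closed.
    by apply: compact_closed cK; exact: norm_hausdorff.
  move=> [t x] [[/= t0 _]]; rewrite mulf_eq0 negb_or => /andP[at0 bx0].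
  split => /=.
    by rewrite in_itv/= t0 leNgt; apply: contra at0 => /a0->.
  by rewrite leNgt; apply: contra bx0 => /b0->.
split.
- move=> k; apply: CkM.
    apply: (@Ck_linear _ _ _ k (fst : {linear (R * 'rV[R]_n)%type -> R}) a) => //.
    by move=> z; exact: cvg_fst.
  apply: (@Ck_linear _ _ _ k (snd : {linear (R * 'rV[R]_n)%type -> 'rV[R]_n}) b) => //.
  by move=> z; exact: cvg_snd.
- by apply: subclosed_compact cK sub; exact: closed_closure.
- move=> z /sub[/=]; rewrite in_itv/= => /andP[z0 z1] _; split => //.
  by apply: le_lt_trans t1T; rewrite lee_fin.
Qed.

End test_functions.

(** * A discrete blow-up inequality and hypergeometric coefficients *)

Section discrete.
Context {R : realType}.

Lemma powRD_gt0 (x r s : R) : 0 < x -> x `^ (r + s) = x `^ r * x `^ s.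
Proof. by move=> x0; apply: powRD; rewrite (gt_eqF x0) implybT. Qed.

Lemma powR_onem_le (p y : R) : 1 < p -> 0 < y ->
  1 + (p - 1) * (1 - y) <= y `^ (1 - p).
Proof.
move=> p1 y0; rewrite /powR gt_eqF//; apply: le_trans (expR_ge1Dx _).
have -> : (1 - p) * ln y = (p - 1) * (- ln y) by ring.
rewrite lerD2l ler_pM2l ?subr_gt0// lerNr opprB.
have -> : ln y = ln (1 + (y - 1)) by congr ln; ring.
by apply: le_ln1Dx; rewrite ltrBrDl subrr.
Qed.

(** Discrete form of integrating B' >= c B^p j^{1-p}. Since y^{1-p} is convex, one
    step lowers B^{1-p} by at least (p - 1) c j^{1-p}; over the steps from J to 2 J
    the loss is of order J^{2-p}. It cannot exceed B_J^{1-p}, which is at most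
    (kap J)^{1-p} by summation of the constant lower bound. Comparing the powers
    of J bounds J. *)
Lemma discrete_blowup (p c kap : R) (B : nat -> R) (J : nat) :
  1 < p -> 0 < c -> 0 < kap -> (0 < J)%N -> 0 <= B 0%N ->
  (forall j, (j < 2 * J)%N -> kap <= B j.+1 - B j) ->
  (forall j, (j < 2 * J)%N ->
     c * B j.+1 `^ p * j.+1%:R `^ (1 - p) <= B j.+1 - B j) ->
  J%:R <= 2 `^ (p - 1) / ((p - 1) * c) * kap `^ (1 - p).
Proof.
move=> p1 c0 k0 J0 B0 Bk Bp.
have J0' : 0 < J%:R :> R by rewrite ltr0n.
have Blow j : (j <= 2 * J)%N -> kap * j%:R <= B j.
  elim: j => [|j IH] jJ; first by rewrite mulr0.
  rewrite -natr1 mulrDr mulr1.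
  by have := IH (ltnW jJ); have := Bk j jJ; lra.
have Bpos j : (0 < j <= 2 * J)%N -> 0 < B j.
  move=> /andP[j0 jJ]; apply: lt_le_trans (Blow j jJ).
  by rewrite mulr_gt0// ltr0n.
pose d := (p - 1) * c * (2 * J%:R) `^ (1 - p).
have step j : (0 < j < 2 * J)%N -> B j.+1 `^ (1 - p) + d <= B j `^ (1 - p).
  move=> /andP[j0 jJ].
  have a0 : 0 < B j by apply: Bpos; rewrite j0 ltnW.
  have b0 : 0 < B j.+1 by apply: Bpos.
  have y0 : 0 < B j / B j.+1 by rewrite divr_gt0.
  have -> : B j `^ (1 - p) = B j.+1 `^ (1 - p) * (B j / B j.+1) `^ (1 - p).
    by rewrite -powRM ?ltW// mulrC divfK// gt_eqF.
  have := powR_onem_le p1 y0; rewrite -(ler_pM2l (powR_gt0 (1 - p) b0)).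
  apply: le_trans; rewrite mulrDr mulr1 lerD2l /d.
  have bp : B j.+1 `^ (1 - p) * (B j.+1 `^ p) = B j.+1.
    by rewrite -powRD_gt0// subrK powRr1// ltW.
  have := Bp j jJ; rewrite -(ler_pM2l (powR_gt0 (1 - p) b0)).
  have -> : B j.+1 `^ (1 - p) * (c * B j.+1 `^ p * j.+1%:R `^ (1 - p))
     = B j.+1 * (c * j.+1%:R `^ (1 - p)).
    by rewrite -[in RHS]bp; ring.
  have -> : B j.+1 `^ (1 - p) * (B j.+1 - B j) =
     B j.+1 * (B j.+1 `^ (1 - p) * (1 - B j / B j.+1)).
    by field; rewrite gt_eqF.
  rewrite ler_pM2l// => h.
  have h2 : c * (2 * J%:R) `^ (1 - p) <= c * j.+1%:R `^ (1 - p).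
    rewrite ler_pM2l// -[1 - p]opprB !powRN lef_pV2 ?posrE ?powR_gt0 ?mulr_gt0 ?ltr0n//.
    apply: ge0_ler_powR; rewrite ?nnegrE ?subr_ge0 ?(ltW p1)//.
    by rewrite -natrM ler_nat.
  rewrite -mulrA [leRHS]mulrCA ler_pM2l ?subr_gt0//.
  exact: le_trans h.
have tele i : (i <= J)%N -> B (J + i)%N `^ (1 - p) + d *+ i <= B J `^ (1 - p).
  elim: i => [|i IH] iJ; first by rewrite addn0 mulr0n addr0.
  apply: le_trans (IH (ltnW iJ)).
  have := step (J + i)%N; rewrite addn_gt0 J0/= mul2n -addnn ltn_add2l iJ.
  by move=> /(_ isT); rewrite addnS mulrS; lra.
have := tele J (leqnn J); move/(le_trans (ler_wpDl (powR_ge0 _ _) (lexx _))).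
have BJ : B J `^ (1 - p) <= kap `^ (1 - p) * J%:R `^ (1 - p).
  rewrite -powRM ?(ltW k0)// -[1 - p]opprB !powRN lef_pV2 ?posrE ?powR_gt0 ?mulr_gt0//.
    apply: ge0_ler_powR; rewrite ?nnegrE ?subr_ge0 ?(ltW p1)// ?mulr_ge0 ?(ltW k0)//.
      by apply/ltW/Bpos; rewrite J0/= leq_pmull.
    by apply: Blow; rewrite leq_pmull.
  by apply: Bpos; rewrite J0/= leq_pmull.
move/le_trans => /(_ _ BJ); rewrite /d powRM//.
rewrite -mulr_natr.
have -> : (p - 1) * c * (2 `^ (1 - p) * J%:R `^ (1 - p)) * J%:R =
  ((p - 1) * c * 2 `^ (1 - p) * J%:R) * J%:R `^ (1 - p) by ring.
rewrite ler_pM2r ?powR_gt0// -[1 - p]opprB [2 `^ _]powRN => h.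
have q0 : 0 < (p - 1) * c by rewrite mulr_gt0// subr_gt0.
have t0 : 0 < 2 `^ (p - 1) :> R by rewrite powR_gt0.
set q := (p - 1) * c in q0 h *; set t := 2 `^ (p - 1) in t0 h *.
rewrite [leLHS](_ : _ = t / q * (q * t^-1 * J%:R)); last by field; rewrite !gt_eqF.
by rewrite ler_pM2l// divr_gt0.
Qed.

(** The coefficients of (1 - z)^{-A} satisfy the recursion with equality. In
    general it gives (1 - z) P' <= A P for the partial sum P, so that (1 - z)^A P
    is nonincreasing. *)
Lemma binomial_bound (A : R) (D : nat -> R) K (z : R) : 0 < A -> 0 <= z < 1 ->
  (forall k, 0 <= D k) ->
  (forall k, k.+1%:R * D k.+1 <= (k%:R + A) * D k) ->
  \sum_(k < K.+1) D k * z ^+ k <= D 0%N * (1 - z) `^ (- A).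
Proof.
move=> A0 /andP[z0 z1] D0 Drec.
pose P := \poly_(k < K.+1) D k.
have PE x : P.[x] = \sum_(k < K.+1) D k * x ^+ k by rewrite horner_poly.
have dPE x : P^`().[x] = \sum_(k < K) (k.+1%:R * D k.+1) * x ^+ k.
  have sz : (size P^`() <= K)%N.
    apply: leq_trans (size_poly _ _) _.
    by have := size_poly K.+1 D; rewrite -/P; case: (size P).
  rewrite (horner_coef_wide _ sz); apply: eq_bigr => k _.
  by rewrite coef_deriv coef_poly ltnS ltn_ord mulr_natl.
have key (x : R) : 0 <= x -> (1 - x) * P^`().[x] <= A * P.[x].
  move=> x0; rewrite mulrBl mul1r lerBlDl.
  have xdP : x * P^`().[x] = \sum_(k < K.+1) (k%:R * D k) * x ^+ k.
    rewrite dPE mulr_sumr big_ord_recl/= mul0r mul0r add0r.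
    by apply: eq_bigr => k _; rewrite exprS mulrCA.
  rewrite xdP PE mulr_sumr -big_split/= big_ord_recr/= dPE -[leLHS]addr0.
  apply: lerD; last first.
    by rewrite addr_ge0 ?mulr_ge0 ?exprn_ge0// ltW.
  apply: ler_sum => k _; rewrite mulrA -mulrDl -mulrDl.
  by rewrite ler_wpM2r ?exprn_ge0// addrC.
pose G (x : R) := (1 - x) `^ A * P.[x].
have dG (x : R) : x < 1 -> is_derive x 1 G
   ((1 - x) `^ A * P^`().[x] + P.[x] * (A * (1 - x) `^ (A - 1) * (- 1))).
  move=> x1.
  have d1 : is_derive x 1 (fun y : R => 1 - y) (- 1).
    have := is_deriveB (is_derive_cst (1 : R) x 1) (is_derive_id x (1 : R)).
    by rewrite sub0r.
  have d2 : is_derive x 1 (fun y : R => (1 - y) `^ A) (A * (1 - x) `^ (A - 1) * (- 1)).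
    have y0 : 0 < 1 - x by rewrite subr_gt0.
    by have := is_derive1_comp
      (is_derive1_powR A y0 : is_derive ((fun y : R => 1 - y) x) 1 _ _) d1.
  exact: (is_deriveM d2 (is_derive_poly P x)).
have : G z <= G 0.
  apply: (@ler0_derive1_le_cc _ G 0 z).
  - by move=> x; rewrite in_itv/= => /andP[_ /lt_trans/(_ z1) x1]; have [] := dG x x1.
  - move=> x; rewrite in_itv/= => /andP[/ltW x0 /lt_trans/(_ z1) x1].
    rewrite derive1E; have [_ ->] := dG x x1.
    have y0 : 0 < 1 - x by rewrite subr_gt0.
    have -> : (1 - x) `^ A = (1 - x) `^ (A - 1) * (1 - x).
      by rewrite mulrC mulr_powRB1// ltW.
    have := key x x0; rewrite -subr_le0 => h.
    rewrite [leLHS](_ : _ = (1 - x) `^ (A - 1) * ((1 - x) * P^`().[x] - A * P.[x])).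
      by rewrite mulr_ge0_le0// powR_ge0.
    by ring.
  - apply: continuous_in_subspaceT => x; rewrite inE/= in_itv/= => /andP[_ xz].
    exact: is_derive_continuous (dG x (le_lt_trans xz z1)).
  - by rewrite in_itv/= ?lexx ?z0.
  - by rewrite in_itv/= ?z0 ?lexx.
  - exact: z0.
have P0 : P.[0] = D 0%N by rewrite horner_coef0 coef_poly.
rewrite /G subr0 powR1 mul1r P0 PE.
by move=> h; rewrite powRN ler_pdivlMr ?powR_gt0 ?subr_gt0// mulrC.
Qed.

End discrete.

Section hypergeometric.
Context {R : realType}.
Variables (a b c : R).
Hypotheses (a0 : 0 < a) (b0 : 0 < b) (c0 : 0 < c).

(** Taylor coefficients of the Gauss hypergeometric function F(a, b; c; z). *)
Fixpoint hyp (k : nat) : R :=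
  if k is j.+1 then hyp j * ((j%:R + a) * (j%:R + b) / (j.+1%:R * (j%:R + c)))
  else 1.

Lemma hyp_gt0 k : 0 < hyp k.
Proof.
elim: k => [|k IH] //=; rewrite mulr_gt0// divr_gt0 ?mulr_gt0 ?ltr0n//;
  by rewrite ltr_wpDl.
Qed.

Lemma hyp_rec k :
  hyp k.+1 * (k.+1%:R * (k%:R + c)) = hyp k * ((k%:R + a) * (k%:R + b)).
Proof.
rewrite /= -mulrA divfK// mulf_neq0 ?pnatr_eq0// gt_eqF// ltr_wpDl//.
Qed.

Let A := a + b - c + 1.

(** The coefficients k.+1 * hyp k satisfy the recursion of the coefficients of
    (1 - z)^{-A} up to factors 1 + O(k^{-2}), whose product converges. *)
Lemma hyp_sum_bound : 0 < A -> exists2 C, 0 < C &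
  forall K z, 0 <= z < 1 ->
  \sum_(k < K.+1) k.+1%:R * hyp k * z ^+ k <= C * (1 - z) `^ (- A).
Proof.
move=> A0.
pose m := Num.min (Num.min c 1) (Num.min A 1).
have m0 : 0 < m by rewrite !lt_min c0 A0 ltr01.
have [mc m1 mA] : [/\ m <= c, m <= 1 & m <= A].
  by split; rewrite !ge_min lexx ?orbT.
pose L := `|2 * a + 2 * b + a * b - c - A - c * A| + `|2 * a * b - c * A|.
have L0 : 0 <= L by rewrite addr_ge0.
pose M := L / (m * m).
have M0 : 0 <= M by rewrite divr_ge0// ltW// mulr_gt0.
have ratio k : k.+2%:R * ((k%:R + a) * (k%:R + b)) <=
   (1 + M / k.+1%:R ^+ 2) * (k.+1%:R * (k%:R + c) * (k%:R + A)).
  set x : R := k%:R.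
  have x0 : 0 <= x by rewrite ler0n.
  have -> : k.+1%:R = x + 1 :> R by rewrite natr1.
  have -> : k.+2%:R = x + 2 :> R by rewrite -addn2 natrD.
  have hc : m * (x + 1) <= x + c by nra.
  have hA : m * (x + 1) <= x + A by nra.
  have x1 : 0 < x + 1 by lra.
  have hM : L * (x + 1) <= M / (x + 1) ^+ 2 * ((x + 1) * (x + c) * (x + A)).
    have h : m * (x + 1) * (m * (x + 1)) <= (x + c) * (x + A).
      by apply: ler_pM => //; rewrite mulr_ge0// ltW.
    have -> : M / (x + 1) ^+ 2 * ((x + 1) * (x + c) * (x + A)) =
              L / (m * m * (x + 1)) * ((x + c) * (x + A)).
      by rewrite /M; field; rewrite !gt_eqF.
    have -> : L * (x + 1) = L / (m * m * (x + 1)) * (m * (x + 1) * (m * (x + 1))).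
      by field; rewrite !gt_eqF.
    by rewrite ler_wpM2l// divr_ge0// ltW// !mulr_gt0.
  rewrite [leRHS]mulrDl mul1r; apply: le_trans (lerD (lexx _) hM).
  rewrite -subr_ge0.
  rewrite [leRHS](_ : _ = (L - (2 * a + 2 * b + a * b - c - A - c * A)) * x
     + (L - (2 * a * b - c * A))); last by rewrite /A; ring.
  by rewrite addr_ge0// ?mulr_ge0// subr_ge0 /L;
     apply: (le_trans (ler_norm _)); rewrite ?lerDl ?lerDr.
(* the exponential absorbs the factors 1 + M / (k + 1)^2 *)
pose D k := k.+1%:R * hyp k * expR (2 * M * (k.+1%:R^-1 - 1)).
have D0 k : 0 < D k by rewrite !mulr_gt0 ?expR_gt0 ?hyp_gt0 ?ltr0n.
have Drec k : k.+1%:R * D k.+1 <= (k%:R + A) * D k.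
  have kA : 0 < k%:R + A by rewrite ltr_wpDl.
  have kc : 0 < k%:R + c by rewrite ltr_wpDl.
  have k1 : 0 < k.+1%:R :> R by rewrite ltr0n.
  have k2 : 0 < k.+2%:R :> R by rewrite ltr0n.
  rewrite /D [hyp k.+1]/=.
  have -> : k.+1%:R * (k.+2%:R * (hyp k *
     ((k%:R + a) * (k%:R + b) / (k.+1%:R * (k%:R + c)))) *
      expR (2 * M * (k.+2%:R^-1 - 1))) =
     hyp k / (k%:R + c) * ((k.+2%:R * ((k%:R + a) * (k%:R + b))) *
      expR (2 * M * (k.+2%:R^-1 - 1))).
    by field; rewrite ?gt_eqF//= addrC natr1 ?gt_eqF.
  have -> : (k%:R + A) * (k.+1%:R * hyp k * expR (2 * M * (k.+1%:R^-1 - 1))) =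
    hyp k / (k%:R + c) * ((k.+1%:R * (k%:R + c) * (k%:R + A)) *
       expR (2 * M * (k.+1%:R^-1 - 1))).
    by field; rewrite ?gt_eqF.
  rewrite ler_pM2l ?divr_gt0 ?hyp_gt0//.
  apply: le_trans (ler_wpM2r (expR_ge0 _) (ratio k)) _.
  rewrite [X in X * _ <= _]mulrC -[leLHS]mulrA ler_pM2l ?mulr_gt0//.
  apply: le_trans (ler_wpM2r (expR_ge0 _) (expR_ge1Dx _)) _.
  rewrite -expRD ler_expR -subr_ge0.
  rewrite [leRHS](_ : _ = M * (k%:R / (k.+1%:R ^+ 2 * k.+2%:R))).
    by rewrite mulr_ge0// divr_ge0// mulr_ge0.
  have -> : k.+1%:R = k%:R + 1 :> R by rewrite natr1.
  have -> : k.+2%:R = k%:R + 2 :> R by rewrite -addn2 natrD.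
  by field; rewrite !gt_eqF// ltr_wpDl.
have eM : 0 < expR (2 * M) by exact: expR_gt0.
exists (D 0%N * expR (2 * M)); first by rewrite mulr_gt0.
move=> K z z01; have := binomial_bound K A0 z01 (fun k => ltW (D0 k)) Drec.
rewrite -(ler_pM2r eM) [leRHS]mulrAC; apply: le_trans.
rewrite mulr_suml; apply: ler_sum => k _; case/andP: z01 => z0 _.
rewrite /D [leRHS]mulrAC ler_wpM2r ?exprn_ge0//.
rewrite -[leRHS]mulrA ler_peMr ?mulr_ge0 ?(ltW (hyp_gt0 _))//.
rewrite -expRD -[leLHS]expR0 ler_expR.
rewrite [leRHS](_ : _ = 2 * M / k.+1%:R); last by ring.
by rewrite divr_ge0// mulr_ge0.
Qed.

End hypergeometric.

(** * Measurability in R^n and the essential support *)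

Section rational_balls.
Context {R : realType} {n : nat}.

Definition rat_point (q : rat * 'rV[rat]_n) : R * 'rV[R]_n :=
  (ratr q.1, map_mx ratr q.2).

Lemma rat_approx (x e : R) : 0 < e -> exists q : rat, `|x - ratr q| < e.
Proof.
move=> e0; have : x - e < x + e by lra.
move=> /rat_in_itvoo[q]; rewrite in_itv/= => /andP[h1 h2].
by exists q; rewrite ltr_norml; apply/andP; split; lra.
Qed.

Lemma rV_rat_approx (x : 'rV[R]_n) (e : R) : 0 < e ->
  exists q : 'rV[rat]_n, `|x - map_mx ratr q| < e.
Proof.
move=> e0.
have /choice[q qP] := fun i : 'I_n => rat_approx (x ord0 i) e0.
exists (\row_i q i).
have -> : `|x - map_mx ratr (\row_i q i)| = mx_norm (x - map_mx ratr (\row_i q i)) by [].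
rewrite mx_normrE; apply: bigmax_lt => //= -[i j] _ /=.
by rewrite !mxE (ord1 i).
Qed.

(** Makes unions of balls over an open set countable. *)
Lemma rat_ball_basis (z : R * 'rV[R]_n) (U : set (R * 'rV[R]_n)) : nbhs z U ->
  exists q k, ball (rat_point q) k.+1%:R^-1 z /\ ball (rat_point q) k.+1%:R^-1 `<=` U.
Proof.
move=> /nbhs_ballP[e /= e0 eU].
have e20 : 0 < e / 2 by rewrite divr_gt0.
have [k ke] := ltr_add_invr e20; rewrite add0r in ke.
have k0 : 0 < k.+1%:R^-1 :> R by rewrite invr_gt0.
have [q1 q1P] := rat_approx z.1 k0.
have [q2 q2P] := rV_rat_approx z.2 k0.
have hz : ball (rat_point (q1, q2)) k.+1%:R^-1 z.
  split; first by apply: ball_sym; rewrite -ball_normE.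
  by apply: ball_sym; rewrite -ball_normE.
exists (q1, q2), k; split => // w hw; apply: eU.
rewrite (splitr e); apply: ball_triangle (le_ball (ltW ke) (ball_sym hz)) _.
exact: le_ball (ltW ke) _ hw.
Qed.

Lemma rV_ball_basis (x : 'rV[R]_n) (U : set 'rV[R]_n) : nbhs x U ->
  exists (q : 'rV[rat]_n) k, ball (map_mx ratr q : 'rV[R]_n) k.+1%:R^-1 x /\
     ball (map_mx ratr q : 'rV[R]_n) k.+1%:R^-1 `<=` U.
Proof.
move=> /nbhs_ballP[e /= e0 eU].
have e20 : 0 < e / 2 by rewrite divr_gt0.
have [k ke] := ltr_add_invr e20; rewrite add0r in ke.
have k0 : 0 < k.+1%:R^-1 :> R by rewrite invr_gt0.
have [q2 q2P] := rV_rat_approx x k0.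
have hz : ball (map_mx ratr q2 : 'rV[R]_n) k.+1%:R^-1 x.
  by apply: ball_sym; rewrite -ball_normE.
exists q2, k; split => // w hw; apply: eU.
rewrite (splitr e); apply: ball_triangle (le_ball (ltW ke) (ball_sym hz)) _.
exact: le_ball (ltW ke) _ hw.
Qed.

Lemma measurable_coord (i : 'I_n) :
  measurable_fun setT (fun x : 'rV[measurableTypeR R]_n => x ord0 i).
Proof. exact: measurable_rV_coord. Qed.

Lemma measurable_box (A : 'I_n -> set R) : (forall i, measurable (A i)) ->
  measurable [set x : 'rV[R]_n | forall i, A i (x ord0 i)].
Proof.
move=> mA; rewrite [X in measurable X](_ : _ = \bigcap_(i in [set: 'I_n])
      ((fun x : 'rV[R]_n => x ord0 i) @^-1` A i)).
  apply: fin_bigcap_measurable => [|i _]; first exact: finite_finset.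
  rewrite -[X in measurable X]setTI.
  exact: (measurable_coord i measurableT (mA i)).
by apply/seteqP; split => [x Ax i _|x Ax i]; exact: Ax.
Qed.

Lemma rV_ball_box (c : 'rV[R]_n) (e : R) : 0 < e ->
  ball c e = [set x | forall i, (ball (c ord0 i) e : set R) (x ord0 i)].
Proof.
move=> e0.
have ballE (x : 'rV[R]_n) : ball c e x = (`|c - x| < e) :> Prop.
  by rewrite -[in LHS]ball_normE.
apply/seteqP; split => x; rewrite ballE /=.
  move=> h i; rewrite -ball_normE/=; apply: le_lt_trans h.
  rewrite [leRHS]/Num.Def.normr/= mx_normrE.
  have := @le_bigmax _ _ _ 0 (fun ij : 'I_1 * 'I_n => `|(c - x) ij.1 ij.2|) (ord0, i).
  by rewrite !mxE.
move=> h; rewrite /Num.Def.normr/= mx_normrE; apply: bigmax_lt => //= -[i j] _ /=.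
by have := h j; rewrite -ball_normE/= !mxE (ord1 i).
Qed.

Lemma measurable_rV_ball (c : 'rV[R]_n) (e : R) : 0 < e ->
  measurable (ball c e : set 'rV[R]_n).
Proof.
move=> e0; rewrite rV_ball_box//.
by apply: (@measurable_box (fun i => ball (c ord0 i) e)) => i; exact: measurable_ball.
Qed.

(** The sigma-algebra is generated by the coordinates; openness enters through
    countable unions of boxes. *)
Lemma measurable_open_rV (U : set 'rV[R]_n) : open U -> measurable U.
Proof.
move=> oU.
pose G (i : 'rV[rat]_n * nat) : set 'rV[R]_n :=
  ball (map_mx ratr i.1 : 'rV[R]_n) i.2.+1%:R^-1.
pose F (k : nat) : set 'rV[R]_n := if unpickle k is Some i then
   (if `[< G i `<=` U >] then G i else set0) else set0.
rewrite (_ : U = \bigcup_k F k).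
  apply: bigcupT_measurable => k; rewrite /F; case: unpickle => // i.
  by case: ifP => // _; apply: measurable_rV_ball; rewrite invr_gt0.
apply/seteqP; split => [x Ux|x [k _]].
  have /rV_ball_basis[q [k [qx qU]]] : nbhs x U by exact: open_nbhs_nbhs.
  exists (pickle (q, k)) => //; rewrite /F pickleK ifT//.
  by apply/asboolP.
rewrite /F; case: unpickle => // i.
by case: ifP => // /asboolP GU Gx; exact: GU.
Qed.

Lemma continuous_measurable_rV (f : 'rV[R]_n -> R) : continuous f ->
  measurable_fun setT f.
Proof.
move=> cf; apply: (measurability _ (RGenOpens.measurableE R)) => //.
move=> _ [_ [a [b ->] <-]]; rewrite setTI; apply: measurable_open_rV.
by apply: open_comp => // x _; exact: cf.
Qed.

Lemma measurable_sqn : measurable_fun setT (@sqn R n).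
Proof. exact: (continuous_measurable_rV continuous_sqn). Qed.

(** The complement of the essential support is covered by countably many balls
    on which the function vanishes almost everywhere. *)
Lemma ess_support_negligible (T : \bar R) (u : R -> 'rV[R]_n -> R) :
  ((@lebesgue_measure R) \x (lebesgue_rV R n))%E.-negligible
  [set z | slab T z /\ ~ ess_support T u z /\ u z.1 z.2 != 0].
Proof.
set m := (_ \x _)%E.
pose G (i : (rat * 'rV[rat]_n) * nat) : set (measurableTypeR R * 'rV[R]_n) :=
  ball (rat_point i.1) i.2.+1%:R^-1.
pose P i := {ae m, forall w, G i w -> slab T w -> u w.1 w.2 = 0}.
pose F (k : nat) : set (measurableTypeR R * 'rV[R]_n) := if unpickle k is Some i then
   (if `[< P i >] then G i `&` slab T `&` [set w | u w.1 w.2 != 0] else set0) else set0.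
suff : m.-negligible (\bigcup_k F k); last first.
  apply: negligible_bigcup => k; rewrite /F; case: unpickle; last exact: negligible_set0.
  move=> i; case: ifP; last by move=> _; exact: negligible_set0.
  move=> /asboolP; apply: negligibleS => w /= [[Gw sw] /eqP uw] h.
  by apply: uw; exact: h.
apply: negligibleS => z /= [sz [nsz uz]].
have [U [zU uU]] : exists U, nbhs z U /\
   {ae m, forall w, U w -> slab T w -> u w.1 w.2 = 0}.
  apply: contrapT => h; apply: nsz; split => // U zU hU.
  by apply: h; exists U.
have [q [k [qz qU]]] := rat_ball_basis zU.
have Pqk : P (q, k) 
  by apply: negligibleS uU => w; apply: contra_not => h Gw; apply: h; exact: qU.
exists (pickle (q, k)); first exact: I.
rewrite /F pickleK; case: ifPn => [_|/asboolPn]; last by move/(_ Pqk).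
by split; [split|].
Qed.

End rational_balls.

(** * Square-integrable functions and their pairings *)

Section L2_pairing.
Context {R : realType} d (X : measurableType d) (m : {measure set X -> \bar R}).
Implicit Types v w : X -> R.

Lemma Lfun2_measurable v : v \in Lfun m 2%:E -> measurable_fun setT v.
Proof. by rewrite inE => /andP[]; rewrite inE. Qed.

Lemma Lfun2_fin_num v : v \in Lfun m 2%:E -> 'N[m]_2%:E[EFin \o v]%E \is a fin_num.
Proof.
by rewrite inE => /andP[_]; rewrite inE/= ge0_fin_numE// Lnorm_ge0.
Qed.

Lemma Lfun2_scale (c : R) v : v \in Lfun m 2%:E -> (fun x => c * v x) \in Lfun m 2%:E.
Proof.
move=> hv; have := @Lfun_scale _ _ _ m v c 2 (ler1n _ 2) hv.
rewrite (_ : _ \o* _ = (fun x => c * v x))//.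
by apply/funext => x /=; rewrite mulrC.
Qed.
Lemma Lfun2B v w : v \in Lfun m 2%:E -> w \in Lfun m 2%:E -> v - w \in Lfun m 2%:E.
Proof.
move=> hv hw; have [_ h] := @Lfun_submod_closed _ _ _ m 2%:E (lee1n 2).
have -> : v - w = (-1) *: w + v by rewrite scaleN1r addrC.
exact: h.
Qed.

Lemma dot_integrable v w : v \in Lfun m 2%:E -> w \in Lfun m 2%:E ->
  m.-integrable setT (EFin \o (fun x => v x * w x)).
Proof. by move=> hv hw; apply/Lfun1_integrable; exact: Lfun2_mul_Lfun1. Qed.

Lemma dot_CauchySchwarz v w : v \in Lfun m 2%:E -> w \in Lfun m 2%:E ->
  `|\int[m]_x (v x * w x)| <=
  fine ('N[m]_2%:E[EFin \o v])%E * fine ('N[m]_2%:E[EFin \o w])%E.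
Proof.
move=> hv hw; have iv := dot_integrable hv hw.
rewrite -lee_fin EFinM !fineK ?Lfun2_fin_num//.
rewrite EFin_normr_Rintegral//.
apply: (le_trans (le_abse_integral m measurableT _)).
  by case/integrableP: iv.
have := @hoelder _ _ _ m v w 2 2 (Lfun2_measurable hv) (Lfun2_measurable hw) (ltr0n _ 2) (ltr0n _ 2).
rewrite Lnorm1; apply.
by rewrite [RHS]splitr !div1r.
Qed.

Lemma dot_cvg0 (F : set_system R) {FF : Filter F} (w : R -> X -> R) v :
  v \in Lfun m 2%:E -> (\forall t \near F, w t \in Lfun m 2%:E) ->
  ('N[m]_2%:E[EFin \o w t] @[t --> F] --> 0)%E ->
  \int[m]_x (w t x * v x) @[t --> F] --> 0.
Proof.
move=> hv hw /fine_cvg cw; apply/norm_cvg0P.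
set C := fine ('N[m]_2%:E[EFin \o v])%E.
apply: (@squeeze_cvgr _ _ _ _ (fun=> 0) (fun t => fine ('N[m]_2%:E[EFin \o w t])%E * C)).
- near=> t; rewrite normr_ge0/=; apply: dot_CauchySchwarz => //.
  by near: t.
- exact: cvg_cst.
- by rewrite -(mul0r C); apply: cvgM => //; exact: cvg_cst.
Unshelve. all: by end_near. Qed.

End L2_pairing.

Section pairing_in_time.
Context {R : realType} {n : nat}.
Let mu := lebesgue_rV R n.

Lemma sqn_le_finite (Y : R) : (mu [set x | sqn x <= Y]%R < +oo)%E.
Proof.
apply: (@le_lt_trans _ _ (mu [set x : 'rV[R]_n | forall i : 'I_n,
    `[- Num.sqrt Y, Num.sqrt Y]%classic (x ord0 i)])).
  apply: le_measure; rewrite ?inE.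
  - rewrite -[X in measurable X]setTI.
    by apply: (measurable_sqn measurableT (measurable_itv `]-oo, Y])).
  - by apply: (@measurable_box R n (fun=> `[- Num.sqrt Y, Num.sqrt Y]%classic)).
  - move=> x /= xY i; rewrite in_itv/= -ler_norml -sqrtr_sqr ler_wsqrtr//.
    exact: le_trans (coord_le_sqn i x) xY.
rewrite (@lebesgue_rV_box R n (fun=> `[- Num.sqrt Y, Num.sqrt Y]%classic))//.
rewrite lebesgue_measure_itv/= ltey_eq; apply/orP; left.
elim/big_ind : _ => // [x y|i _]; first exact: fin_numM.
by case: ifP.
Qed.

Lemma Lfun2_bounded (v : 'rV[R]_n -> R) (M Y : R) : measurable_fun setT v ->
  (forall x, `|v x| <= M) -> (forall x, Y < sqn x -> v x = 0) ->
  v \in Lfun mu 2%:E.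
Proof.
move=> mv vM v0; rewrite inE; apply/andP; split; rewrite inE//=.
rewrite /finite_norm unlock; apply: poweR_lty.
have mY : measurable [set x : 'rV[R]_n | sqn x <= Y].
  rewrite -[X in measurable X]setTI.
  by apply: (measurable_sqn measurableT (measurable_itv `]-oo, Y])).
apply: (@le_lt_trans _ _ (\int[mu]_(x in [set x | (sqn x <= Y)%R]) (M `^ 2)%:E)%E).
  rewrite [leRHS]integral_mkcond; apply: ge0_le_integral => //.
  - by move=> x _; exact: poweR_ge0.
  - by apply: (measurableT_comp (measurable_poweR _)) => //; do 2 apply: measurableT_comp => //.
  - by apply/(measurable_restrictT _ mY); exact: measurable_cst.
  - move=> x _; rewrite patchE; case: ifPn => [_|].
      rewrite /= lee_fin; apply: ge0_ler_powR => //; rewrite nnegrE//.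
      exact: le_trans (vM x).
    rewrite notin_setE/= => /negP; rewrite -ltNge => /v0 ->.
    by rewrite /= normr0 powR0.
rewrite integral_cst//; apply: lte_mul_pinfty => //.
  by rewrite lee_fin powR_ge0.
exact: sqn_le_finite.
Qed.

Lemma Lfun2_compact_support (v : 'rV[R]_n -> R) (Y : R) : continuous v ->
  (forall x, Y < sqn x -> v x = 0) -> v \in Lfun mu 2%:E.
Proof.
move=> cv v0.
have [M hM] : exists M, forall x, `|v x| <= M.
  have [Y0|Y0] := ltP Y 0.
    exists 0 => x; rewrite v0 ?normr0//.
    exact: lt_le_trans Y0 (sqn_ge0 x).
  have n0 : [set x : 'rV[R]_n | sqn x <= Y] !=set0.
    by exists 0; rewrite /= /sqn big1// => i _; rewrite mxE expr0n.
  have cY : {within [set x : 'rV[R]_n | sqn x <= Y], continuous (fun x => `|v x|)}.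
    apply: continuous_subspaceT => x.
    by apply: continuous_comp; [exact: cv|exact: norm_continuous].
  have [c _ cP] := compact_EVT_max n0 (@compact_sqn_le R n Y) cY.
  exists `|v c| => x; have [xY|xY] := leP (sqn x) Y; first by apply: cP; rewrite inE.
  by rewrite v0// normr0.
apply: (Lfun2_bounded (M := M) (Y := Y)) => //.
exact: continuous_measurable_rV.
Qed.

End pairing_in_time.

(** * Pairings as functions of time *)

Section pairing.
Context {R : realType} {n : nat}.
Let mu := lebesgue_rV R n.
Variables (T : \bar R) (u ut : R -> 'rV[R]_n -> R) (v : 'rV[R]_n -> R) (t1 : R).
Hypotheses (hC1 : C1_L2 T u ut) (hv : v \in Lfun mu 2%:E).
Hypotheses (t1_gt0 : 0 < t1) (t1T : (t1%:E < T)%E).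

Let U s := \int[mu]_x (u s x * v x).
Let V s := \int[mu]_x (ut s x * v x).
Let D := time_interval T.

Lemma time_intervalP t : 0 <= t -> t <= t1 -> time_interval T t.
Proof. by move=> t0 tt1; split => //; apply: le_lt_trans t1T; rewrite lee_fin. Qed.

Lemma cvg_within_finer (F G : set_system R) (A : set R) (k : R -> R) (l : R) :
  Filter F -> k x @[x --> within A G] --> l -> F --> G -> F A ->
  k x @[x --> F] --> l.
Proof.
move=> FF kl FG FA; apply: cvg_trans kl => B /= hB.
have /FG : G (fun x => A x -> B (k x)) by exact: hB.
by move=> hF; apply: filterS2 FA hF => x Ax; apply.
Qed.

Lemma near_time_interval t0 : 0 < t0 -> t0 <= t1 -> \forall t \near t0, D t.
Proof.
move=> t00 t01.
have [t2 t12 t2T] : exists2 t2, t1 < t2 & (t2%:E < T)%E.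
  move: t1T; case: T => [r|_|//]; last by exists (t1 + 1); rewrite ?ltry// ltrDl.
  rewrite lte_fin => h; exists ((t1 + r) / 2); rewrite ?lte_fin; lra.
near=> t; split.
  by apply: ltW; near: t; exact: lt_nbhsr.
apply: le_lt_trans t2T; rewrite lee_fin ltW//; near: t.
by apply: lt_nbhsl; exact: le_lt_trans t12.
Unshelve. all: by end_near. Qed.

Lemma near_right_time_interval : \forall t \near 0^'+, D t.
Proof.
near=> t; apply: time_intervalP; first by near: t; exact: nbhs_right_ge.
by near: t; exact: nbhs_right_le.
Unshelve. all: by end_near. Qed.

(** Regularity in time with values in L^2 passes to the pairing with a fixed
    function by the Cauchy-Schwarz inequality. *)
Lemma pairing_quotient t0 : D t0 ->
  (U t - U t0) / (t - t0) - V t0 @[t --> within D t0^'] --> 0.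
Proof.
case: hC1 => hL hq _ Dt0.
apply: cvg_trans (@dot_cvg0 _ _ _ mu _ _ _ v hv _ (hq _ Dt0)).
  apply: near_eq_cvg.
  apply: filterS (withinT D (dnbhs_filter _)) => t Dt.
  have [hut _] := hL _ Dt; have [hut0 hutt0] := hL _ Dt0.
  have i1 := dot_integrable hut hv; have i2 := dot_integrable hut0 hv.
  have i3 := dot_integrable hutt0 hv.
  transitivity (\int[mu]_x ((t - t0)^-1 * (u t x * v x - u t0 x * v x) - ut t0 x * v x)).
    by apply: eq_Rintegral => x _; ring.
  have i4 : mu.-integrable setT (EFin \o (fun x => u t x * v x - u t0 x * v x)).
    by have := integrableB measurableT i1 i2; apply: eq_integrable.
  have i5 : mu.-integrable setT (EFin \o (fun x => (t - t0)^-1 * (u t x * v x - u t0 x * v x))).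
    by have := integrableZl measurableT (t - t0)^-1 i4; apply: eq_integrable.
  rewrite RintegralB//; congr (_ - _).
  by rewrite RintegralZl// RintegralB// mulrC.
apply: filterS (withinT D (dnbhs_filter _)) => t Dt.
have [hut _] := hL _ Dt; have [hut0 hutt0] := hL _ Dt0.
rewrite (_ : (fun x => _) = (fun x => (t - t0)^-1 * (u t - u t0) x) - ut t0); last first.
  by apply/funext => x; rewrite !fctE mulrC.
by apply: Lfun2B => //; apply: Lfun2_scale; apply: Lfun2B.
Qed.

Lemma pairing_V_cvg t0 : D t0 -> V t @[t --> within D (nbhs t0)] --> V t0.
Proof.
case: hC1 => hL _ hc Dt0.
have : \int[mu]_x ((ut t \- ut t0) x * v x) @[t --> within D (nbhs t0)] --> 0.
  apply: dot_cvg0 (hc _ Dt0) => //.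
  apply: filterS (withinT D (nbhs_filter _)) => t Dt.
  by have [_ h1] := hL _ Dt; have [_ h2] := hL _ Dt0; exact: Lfun2B.
move=> h; apply/subr_cvg0; apply: cvg_trans h; apply: near_eq_cvg.
apply: filterS (withinT D (nbhs_filter _)) => t Dt.
have [_ h1] := hL _ Dt; have [_ h2] := hL _ Dt0.
have i1 := dot_integrable h1 hv; have i2 := dot_integrable h2 hv.
rewrite /= -RintegralB//.
by apply: eq_Rintegral => x _; rewrite mulrBl.
Qed.

Lemma pairing_U_cvg t0 : D t0 -> U t @[t --> within D t0^'] --> U t0.
Proof.
move=> Dt0; have hq := pairing_quotient Dt0.
have hid : t - t0 @[t --> within D t0^'] --> (0 : R).
  rewrite -(subrr t0); apply: cvgB; last exact: cvg_cst.
  move=> A hA; have hA' : t0^' A := nbhs_dnbhs hA.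
  by change (t0^' (fun x => D x -> A x)); apply: filterS hA' => x.
have h : (t - t0) * ((U t - U t0) / (t - t0) - V t0 + V t0)
    @[t --> within D t0^'] --> 0.
  rewrite -(mul0r (0 + V t0)); apply: cvgM => //; apply: cvgD => //; exact: cvg_cst.
apply/subr_cvg0; apply: cvg_trans h; apply: near_eq_cvg.
have hne : within D t0^' (fun t => t != t0).
  change (t0^' (fun t => D t -> t != t0)).
  by apply: filterS (nbhs_dnbhs_neq t0).
apply: filterS hne => t tt0.
by rewrite subrK mulrC divfK// subr_eq0.
Qed.

Lemma is_derive_pairing t0 : 0 < t0 -> t0 <= t1 -> is_derive t0 1 U (V t0).
Proof.
move=> t00 t01; have Dt0 : D t0 by apply: time_intervalP => //; exact: ltW.
have h : (U t - U t0) / (t - t0) - V t0 @[t --> t0^'] --> 0.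
  apply: cvg_within_finer (pairing_quotient Dt0) _ _ => //.
  exact: nbhs_dnbhs (near_time_interval t00 t01).
have h2 : (U t - U t0) / (t - t0) @[t --> t0^'] --> V t0 by exact/subr_cvg0.
have h3 : s^-1 *: ((U \o shift t0) (s *: (1:R)) - U t0) @[s --> (0:R)^'] --> V t0.
  apply/cvgrPdist_le => e e0; move/cvgrPdist_le : h2 => /(_ e e0).
  rewrite !near_withinE => h2.
  have h2' : \forall t \near t0, t != t0 -> `|V t0 - (U t - U t0) / (t - t0)| <= e.
    exact: h2.
  move: h2'; rewrite (near_shift 0 t0)/= subr0.
  apply: filterS => s hs s0.
  have : s + t0 != t0 by rewrite -subr_eq0 addrK.
  move/hs; rewrite addrK /= [_%:A]mulr1 /GRing.scale /= [s^-1 * _]mulrC.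
  by [].
split; first by apply/cvg_ex; exists (V t0).
exact: cvg_lim h3.
Qed.

Lemma pairing_right0 : U t @[t --> 0^'+] --> U 0.
Proof.
apply: cvg_within_finer (pairing_U_cvg (time_intervalP _ _)) _ _ => //.
- exact: ltW.
- move=> A hA; have hA' : nbhs (0 : R) (fun t => t != 0 -> A t) by exact: hA.
  change (nbhs (0 : R) (fun t => 0 < t -> A t)).
  by apply: filterS hA' => t h t0; apply: h; rewrite gt_eqF.
- exact: near_right_time_interval.
Qed.

Lemma pairing_left1 : U t @[t --> t1^'-] --> U t1.
Proof.
have /is_derive_continuous c := is_derive_pairing t1_gt0 (lexx t1).
exact: cvg_at_left_filter.
Qed.

Lemma pairing_U_within : {within `[0, t1], continuous U}.
Proof.
apply/continuous_within_itvP => //; split.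
- move=> t; rewrite in_itv/= => /andP[t0 /ltW tt1].
  exact: is_derive_continuous (is_derive_pairing t0 tt1).
- exact: pairing_right0.
- exact: pairing_left1.
Qed.

Lemma pairing_V_within : {within `[0, t1], continuous V}.
Proof.
have cV t : 0 < t -> t <= t1 -> V x @[x --> t] --> V t.
  move=> t0 tt1; apply: cvg_within_finer (pairing_V_cvg (time_intervalP (ltW t0) tt1)) _ _ => //.
  exact: near_time_interval.
apply/continuous_within_itvP => //; split.
- by move=> t; rewrite in_itv/= => /andP[t0 /ltW tt1]; exact: cV.
- apply: cvg_within_finer (pairing_V_cvg (time_intervalP (lexx 0) (ltW t1_gt0))) _ _ => //.
    exact: cvg_within.
  exact: near_right_time_interval.
- by apply: cvg_at_left_filter; apply: cV.
Qed.

End pairing.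

(** * The weak formulation for separated test functions *)

Lemma Rintegral_sum {R : realType} d (X : measurableType d)
    (m : {measure set X -> \bar R}) (D : set X) (I : Type) (s : seq I) (F : I -> X -> R) :
  measurable D -> (forall i, m.-integrable D (EFin \o F i)) ->
  m.-integrable D (EFin \o (fun x => \sum_(i <- s) F i x)) /\
  \int[m]_(x in D) (\sum_(i <- s) F i x) = \sum_(i <- s) \int[m]_(x in D) F i x.
Proof.
move=> mD iF; elim: s => [|i s [IH1 IH2]].
  rewrite big_nil; have E : (fun x => \sum_(i <- [::]) F i x) = fun=> 0.
    by apply/funext => x; rewrite big_nil.
  rewrite E; split; first exact: integrable0.
  by rewrite /Rintegral integral0.
have E : (fun x => \sum_(j <- i :: s) F j x) = (fun x => F i x + \sum_(j <- s) F j x).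
  by apply/funext => x; rewrite big_cons.
rewrite E big_cons; split.
  by have := integrableD mD (iF i) IH1; apply: eq_integrable.
by rewrite RintegralD// IH2.
Qed.

Section weak_identity.
Context {R : realType} {n : nat}.
Let mu := lebesgue_rV R n.
Variables (T : \bar R) (u ut : R -> 'rV[R]_n -> R)
  (Du : R -> 'I_n -> 'rV[R]_n -> R) (mu0 p eps : R) (f g : 'rV[R]_n -> R).
Hypotheses (hH : forall t, time_interval T t -> in_H1 (u t) (Du t))
  (hC : C1_L2 T u ut) (hu0 : {ae mu, forall x, u 0 x = eps * f x})
  (hw : weak_form T mu0 p eps g u ut Du)
  (hf : f \in Lfun mu 2%:E) (hg : g \in Lfun mu 2%:E).
Variables (a a1 a2 h h1 h2 : R -> R) (t1 Y : R).
Hypotheses (sa : smooth a) (sh : smooth h)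
  (da : forall x : R, is_derive x 1 a (a1 x)) (da1 : forall x : R, is_derive x 1 a1 (a2 x))
  (ca2 : continuous a2)
  (dh : forall x : R, is_derive x 1 h (h1 x)) (dh1 : forall x : R, is_derive x 1 h1 (h2 x))
  (ch2 : continuous h2)
  (a0 : forall t, t1 <= t -> a t = 0) (h0 : forall y, Y < y -> h y = 0)
  (t1_gt0 : 0 < t1) (t1T : (t1%:E < T)%E).

Let b (x : 'rV[R]_n) := h (sqn x).
Let pb i (x : 'rV[R]_n) := h1 (sqn x) * (2 * x ord0 i).
Let ppb i (x : 'rV[R]_n) := h2 (sqn x) * (2 * x ord0 i) * (2 * x ord0 i) + h1 (sqn x) * 2.
Let lap (x : 'rV[R]_n) := 4 * sqn x * h2 (sqn x) + 2 * n%:R * h1 (sqn x).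

Let ca : continuous a. Proof. by move=> x; exact: is_derive_continuous (da x). Qed.
Let ca1 : continuous a1. Proof. by move=> x; exact: is_derive_continuous (da1 x). Qed.

Lemma derive_vanish (k dk : R -> R) : (forall x : R, is_derive x 1 k (dk x)) ->
  (forall y, Y < y -> k y = 0) -> forall y, Y < y -> dk y = 0.
Proof.
move=> kd k0 y Yy; have [_ <-] := kd y.
rewrite (@near_eq_derive _ _ _ k (fun=> 0)) ?derive_cst//.
near=> z; apply: k0; near: z; exact: lt_nbhsr.
Unshelve. all: by end_near. Qed.

Let h10 : forall y, Y < y -> h1 y = 0. Proof. exact: derive_vanish dh h0. Qed.
Let h20 : forall y, Y < y -> h2 y = 0. Proof. exact: derive_vanish dh1 h10. Qed.

Let partial_b i : partial i b = pb i.
Proof. by apply/funext => x; have [_ E] := partial_radial i (dh (sqn x)); exact: E. Qed.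

Let partial_pb i : partial i (pb i) = ppb i.
Proof.
apply/funext => x; rewrite /partial /pb.
have d1 := partial_radial i (dh1 (sqn x)).
have d2 := is_deriveM (is_derive_cst (2 : R) x (delta_mx ord0 i)) (is_derive_coord i x (delta_mx ord0 i)).
have [_ E] := is_deriveM d1 d2; rewrite [LHS]E.
by rewrite /ppb /= !fctE /GRing.scale/= mxE !eqxx /= mulr0 addr0; ring.
Qed.

Let sum_ppb x : \sum_(i < n) ppb i x = lap x.
Proof.
rewrite /ppb big_split/= sumr_const card_ord /lap.
have -> : \sum_(i < n) h2 (sqn x) * (2 * x ord0 i) * (2 * x ord0 i) =
   4 * sqn x * h2 (sqn x).
  rewrite /sqn -/(sqn x) mulr_sumr mulr_suml; apply: eq_bigr => i _; ring.
by rewrite -mulr_natr; ring.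
Qed.

Let smooth_b : smooth b.
Proof. by move=> k; apply: Ck_comp; [exact: sh|exact: Ck_sqn]. Qed.

Let smooth_pb i : smooth (pb i).
Proof. by move=> k; rewrite -partial_b; exact: Ck_derive (smooth_b k.+1). Qed.

Let smooth_ppb i : smooth (ppb i).
Proof. by move=> k; rewrite -partial_pb; exact: Ck_derive (smooth_pb i k.+1). Qed.

Let Lb : b \in Lfun mu 2%:E.
Proof. by apply: (@Lfun2_compact_support R n b Y (smooth_b 0)) => x; exact: h0. Qed.

Let Lpb i : pb i \in Lfun mu 2%:E.
Proof.
apply: (@Lfun2_compact_support R n (pb i) Y (smooth_pb i 0)) => x Yx.
by rewrite /pb h10// mul0r.
Qed.

Let Lppb i : ppb i \in Lfun mu 2%:E.
Proof.
apply: (@Lfun2_compact_support R n (ppb i) Y (smooth_ppb i 0)) => x Yx.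
by rewrite /ppb h10// h20// !mul0r addr0.
Qed.

Let Llap : lap \in Lfun mu 2%:E.
Proof.
apply: (@Lfun2_compact_support R n lap Y) => [|x Yx].
  rewrite -(funext sum_ppb); have : Ck 0 (fun x => \sum_(i < n) ppb i x).
    by apply: Ck_sum => i; exact: smooth_ppb.
  by [].
by rewrite /lap h10// h20// !mulr0 addr0.
Qed.

Let U s := \int[mu]_x (u s x * b x).
Let V s := \int[mu]_x (ut s x * b x).
Let W s := \int[mu]_x (u s x * lap x).
Let A s := mu0 / (1 + s) * a s - a1 s.
Let A1 s := mu0 * (a1 s / (1 + s) - a s / (1 + s) ^+ 2) - a2 s.

Let inD s : `[0, t1]%classic s -> time_interval T s.
Proof. by rewrite /= in_itv/= => /andP[? ?]; exact: (time_intervalP t1T). Qed.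

Let Lu s : `[0, t1]%classic s -> u s \in Lfun mu 2%:E.
Proof. by move=> /inD; case: hC => hL _ _ /hL[]. Qed.

Let Lut s : `[0, t1]%classic s -> ut s \in Lfun mu 2%:E.
Proof. by move=> /inD; case: hC => hL _ _ /hL[]. Qed.

(** At a fixed time, the weak gradient tested with the partial derivatives of b
    turns the gradient term into a pairing with the Laplacian of b. *)
Let inner s : `[0, t1]%classic s ->
  \int[mu]_x (- ut s x * (a1 s * b x) + \sum_i Du s i x * (a s * pb i x)
       + mu0 / (1 + s) * ut s x * (a s * b x)) = A s * V s - a s * W s.
Proof.
move=> s01; have [_ hD hwg] := hH (inD s01).
have iut := dot_integrable (Lut s01) Lb.
have iD i := dot_integrable (hD i) (Lpb i).
have iu i := dot_integrable (Lu s01) (Lppb i).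
have [iS eS] := Rintegral_sum (index_enum 'I_n) measurableT iD.
have [iS2 eS2] := Rintegral_sum (index_enum 'I_n) measurableT iu.
transitivity (\int[mu]_x (A s * (ut s x * b x) + a s * \sum_i Du s i x * pb i x)).
  apply: eq_Rintegral => x _; rewrite /A mulr_sumr.
  under [in RHS]eq_bigr do rewrite mulrCA.
  ring.
have i1 : mu.-integrable setT (EFin \o (fun x => A s * (ut s x * b x))).
  by have := integrableZl measurableT (A s) iut; apply: eq_integrable.
have i2 : mu.-integrable setT (EFin \o (fun x => a s * \sum_i Du s i x * pb i x)).
  by have := integrableZl measurableT (a s) iS; apply: eq_integrable.
rewrite RintegralD// !RintegralZl//.
congr (_ + _); rewrite -mulrN; congr (_ * _); rewrite eS.
transitivity (\sum_i - \int[mu]_x (u s x * ppb i x)).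
  apply: eq_bigr => i _; apply/eqP; rewrite -eqr_oppLR; apply/eqP.
  rewrite -partial_pb (hwg (pb i))//.
  apply: (@test_function_rV R n (pb i) Y) => // x Yx.
  by rewrite /pb h10// mul0r.
rewrite sumrN; congr (- _); rewrite -eS2; apply: eq_Rintegral => x _.
by rewrite -mulr_sumr sum_ppb.
Qed.

Let one_plus s : `[0, t1]%classic s -> 0 < 1 + s.
Proof. by rewrite /= in_itv/= => /andP[s0 _]; rewrite ltr_pwDl. Qed.

Let is_derive_A (s : R) : 0 < 1 + s -> is_derive s 1 A (A1 s).
Proof.
move=> s0.
have d1 : is_derive s 1 (fun y : R => 1 + y) 1.
  have := is_deriveD (is_derive_cst (1 : R) s 1) (is_derive_id s (1 : R)).
  by rewrite add0r.
have d2 : is_derive s 1 (fun y : R => (1 + y)^-1) (- (1 + s) ^- 2).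
  have := @is_deriveV R (fun y : R => 1 + y) s 1 1 (lt0r_neq0 s0) d1.
  by move/is_derive_eq; apply; rewrite /= /GRing.scale /= mulr1.
have d3 := is_deriveM (is_deriveM (is_derive_cst mu0 s 1) d2) (da s).
have := is_deriveB d3 (da1 s); move/is_derive_eq; apply.
by rewrite /A1 /= !fctE /GRing.scale/=; ring.
Qed.

Let cA1 s : `[0, t1]%classic s -> {for s, continuous A1}.
Proof.
move=> /one_plus s0.
have c1 : (1 + y)^-1 @[y --> s] --> (1 + s)^-1.
  apply: cvgV; first exact: lt0r_neq0.
  by apply: cvgD; [exact: cvg_cst|exact: cvg_id].
apply: cvgB; last exact: ca2.
apply: cvgM; first exact: cvg_cst.
apply: cvgB; first by apply: cvgM; [exact: ca1|exact: c1].
apply: cvgM; first exact: ca.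
have e (y : R) : ((1 + y) ^+ 2)^-1 = (1 + y)^-1 * (1 + y)^-1.
  by rewrite -expr2 exprVn.
rewrite e; under eq_fun do rewrite e.
exact: cvgM.
Qed.

Let cA s : `[0, t1]%classic s -> {for s, continuous A}.
Proof. by move=> /one_plus/is_derive_A/is_derive_continuous. Qed.

Let cU : {within `[0, t1], continuous U}.
Proof. exact: (pairing_U_within hC Lb t1_gt0 t1T). Qed.
Let cV : {within `[0, t1], continuous V}.
Proof. exact: (pairing_V_within hC Lb t1_gt0 t1T). Qed.
Let cW : {within `[0, t1], continuous W}.
Proof. exact: (pairing_U_within hC Llap t1_gt0 t1T). Qed.

Let within_cont (k : R -> R) : (forall s, `[0, t1]%classic s -> {for s, continuous k}) ->
  {within `[0, t1], continuous k}.
Proof. by move=> kc; apply: continuous_in_subspaceT => s; rewrite inE => /kc. Qed.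

Let withinM (k l : R -> R) : {within `[0, t1], continuous k} ->
  {within `[0, t1], continuous l} -> {within `[0, t1], continuous (fun s => k s * l s)}.
Proof. by move=> kc lc x; apply: cvgM; [exact: kc|exact: lc]. Qed.

Let withinD (k l : R -> R) : {within `[0, t1], continuous k} ->
  {within `[0, t1], continuous l} -> {within `[0, t1], continuous (fun s => k s + l s)}.
Proof. by move=> kc lc x; apply: cvgD; [exact: kc|exact: lc]. Qed.

Let integ (k : R -> R) : {within `[0, t1], continuous k} ->
  (@lebesgue_measure R).-integrable `[0, t1] (EFin \o k).
Proof. by apply: continuous_compact_integrable; exact: segment_compact. Qed.

Let a1t1 : a1 t1 = 0.
Proof.
have z t : t1 < t -> a1 t = 0.
  move=> tt; have [_ <-] := da t.
  rewrite (@near_eq_derive _ _ _ a (fun=> 0)) ?derive_cst//.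
  by near=> z; apply: a0; apply: ltW; near: z; exact: lt_nbhsr.
(* a is known to vanish on the right of t1 only *)
have c : a1 t @[t --> t1^'+] --> a1 t1 by apply: cvg_at_right_filter; exact: ca1.
apply: (cvg_unique _ c) => //.
apply: cvg_trans (@cvg_cst _ _ _ (t1^'+) _).
apply: near_eq_cvg; near=> t; rewrite z//.
Unshelve. all: by end_near. Qed.

Let FTC : \int[lebesgue_measure]_(s in `[0, t1]) (A1 s * U s + A s * V s) = - (A 0 * U 0).
Proof.
have cAt : {within `[0, t1], continuous A} by apply: within_cont => s /cA.
have cA1t : {within `[0, t1], continuous A1} by apply: within_cont => s /cA1.
have dG s : 0 < s -> s <= t1 -> is_derive s 1 (fun s => A s * U s) (A1 s * U s + A s * V s).
  move=> s0 st1; have dA : is_derive s 1 A (A1 s) by apply: is_derive_A; rewrite addr_gt0.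
  have dU := is_derive_pairing hC Lb t1T s0 st1.
  have := is_deriveM dA dU; move/is_derive_eq; apply.
  by rewrite /GRing.scale/= addrC [U s * _]mulrC.
have cG : {within `[0, t1], continuous (fun s => A s * U s)} by exact: withinM.
have [_ cGr cGl] := (continuous_within_itvP _ t1_gt0).1 cG.
rewrite /Rintegral (@continuous_FTC2 _ _ (fun s => A s * U s) 0 t1)//.
- have -> : A t1 = 0 by rewrite /A a1t1 a0// mulr0 subr0.
  by rewrite mul0r sub0e.
- by apply: withinD; exact: withinM.
- split => // s; rewrite in_itv/= => /andP[s0 /ltW st1].
  by have [] := dG s s0 st1.
- move=> s; rewrite in_itv/= => /andP[s0 /ltW st1].
  by rewrite derive1E; have [_ ->] := dG s s0 st1.
Qed.

(** The test function is a(t) h(|x|^2), and all derivatives are moved onto it: in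
    space by the weak gradient, in time by the fundamental theorem of calculus for
    the product of A = mu0 a / (1 + s) - a' with the pairing of u and b. Neither
    the time derivative nor the gradient of u survives. *)
Lemma weak_identity :
  \int[lebesgue_measure]_(s in `[0, t1]) \int[mu]_x (`|u s x| `^ p * (a s * h (sqn x)))
  + eps * a 0 * \int[mu]_x (g x * h (sqn x))
  + eps * (mu0 * a 0 - a1 0) * \int[mu]_x (f x * h (sqn x))
  = \int[lebesgue_measure]_(s in `[0, t1]) \int[mu]_x (u s x *
     ((a2 s - mu0 * (a1 s / (1 + s) - a s / (1 + s) ^+ 2)) * h (sqn x)
      - a s * (4 * sqn x * h2 (sqn x) + 2 * n%:R * h1 (sqn x)))).
Proof.
have tf : test_function (slab T) (fun z : R * 'rV[R]_n => a z.1 * b z.2).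
  apply: (@test_function_slab R n T a b t1 Y) => // [t /ltW/a0//|x /h0//].
have D1 : time_interval T t1 by apply: inD; rewrite /= in_itv/= lexx ltW.
have cAt : {within `[0, t1], continuous A} by apply: within_cont => s /cA.
have cA1t : {within `[0, t1], continuous A1} by apply: within_cont => s /cA1.
have cat : {within `[0, t1], continuous a} by apply: within_cont => s _; exact: ca.
have := hw tf D1; rewrite /=.
have -> : \int[mu]_x (ut t1 x * (a t1 * b x)) = 0.
  rewrite (_ : (fun x => _) = fun=> 0); first by rewrite /Rintegral integral0.
  by apply/funext => x; rewrite a0// mul0r mulr0.
have -> : \int[mu]_x (g x * (a 0 * b x)) = a 0 * \int[mu]_x (g x * b x).
  rewrite -RintegralZl//; last exact: dot_integrable.
  by apply: eq_Rintegral => x _; rewrite mulrCA.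
rewrite (_ : \int[lebesgue_measure]_(s in `[0, t1]) \int[mu]_x _ =
   \int[lebesgue_measure]_(s in `[0, t1]) (A s * V s - a s * W s)); last first.
  apply: eq_Rintegral => s; rewrite inE => s01; rewrite -inner//.
  apply: eq_Rintegral => x _; congr (_ + _ + _).
    congr (_ * _); rewrite derive1E.
    have [_ ->] := is_deriveM (da s) (is_derive_cst (b x) s (1 : R)).
    by rewrite scaler0 add0r /GRing.scale/= mulrC.
  apply: eq_bigr => i _; congr (_ * _).
  rewrite -partial_b /partial.
  have [+ _] := partial_radial i (dh (sqn x)) => db.
  by rewrite -[LHS]/('D_(delta_mx ord0 i) (a s \*: b) x) deriveZ.
have iAV := integ (withinM cAt cV).
have iA1U := integ (withinM cA1t cU).
have iaW := integ (withinM cat cW).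
have := FTC; rewrite RintegralD// RintegralB//.
have -> : U 0 = eps * \int[mu]_x (f x * b x).
  rewrite -RintegralZl//; last exact: dot_integrable.
  congr fine; apply: ae_eq_integral => //.
  - apply/measurable_EFinP; apply: measurable_funM.
      by apply: (@Lfun2_measurable _ _ _ mu); apply: Lu; rewrite /= in_itv/= lexx ltW.
    exact: Lfun2_measurable Lb.
  - apply/measurable_EFinP; apply: measurable_funM => //.
    by apply: measurable_funM; [exact: Lfun2_measurable hf|exact: Lfun2_measurable Lb].
  - by move: hu0; apply: filterS => x ux _; rewrite ux mulrA.
have -> : \int[lebesgue_measure]_(s in `[0, t1]) \int[mu]_x (u s x *
     ((a2 s - mu0 * (a1 s / (1 + s) - a s / (1 + s) ^+ 2)) * h (sqn x)
      - a s * (4 * sqn x * h2 (sqn x) + 2 * n%:R * h1 (sqn x))))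
  = \int[lebesgue_measure]_(s in `[0, t1]) (- 1 * (A1 s * U s) - a s * W s).
  apply: eq_Rintegral => s; rewrite inE => s01.
  have i1 := dot_integrable (Lu s01) Lb.
  have i2 := dot_integrable (Lu s01) Llap.
  transitivity (\int[mu]_x ((- A1 s) * (u s x * b x) - a s * (u s x * lap x))).
    by apply: eq_Rintegral => x _; rewrite /A1 /b /lap; ring.
  have i3 : mu.-integrable setT (EFin \o (fun x => - A1 s * (u s x * b x))).
    by have := integrableZl measurableT (- A1 s) i1; apply: eq_integrable.
  have i4 : mu.-integrable setT (EFin \o (fun x => a s * (u s x * lap x))).
    by have := integrableZl measurableT (a s) i2; apply: eq_integrable.
  by rewrite RintegralB// !RintegralZl// mulN1r mulNr.
rewrite RintegralB//; last first.
  apply: integ; apply: withinM; last exact: withinM.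
  by apply: within_cont => s _; exact: cvg_cst.
rewrite RintegralZl//.
have -> : A 0 = mu0 * a 0 - a1 0 by rewrite /A addr0 divr1.
rewrite -/b; move=> e1 e2.
rewrite -[X in X + _ + _]e2.
rewrite /b; lra.
Qed.

End weak_identity.

(** * Integration over the space-time cone *)

Section spacetime.
Context {R : realType} {n : nat}.
Let mu := lebesgue_rV R n.

Definition spacetime := ((@lebesgue_measure R) \x (lebesgue_rV R n))%E.
Local Notation X := (measurableTypeR R * 'rV[R]_n)%type.

Lemma Rintegral_Fubini (f : X -> R) : spacetime.-integrable setT (EFin \o f) ->
  \int[lebesgue_measure]_s \int[mu]_x f (s, x) = \int[spacetime]_z f z.
Proof.
move=> fi; rewrite [RHS]/Rintegral.
rewrite -(integral12_prod_meas1 fi); rewrite [LHS]/Rintegral; congr fine.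
have iF := integrable_fubini_F fi.
apply: ae_eq_integral => //.
- apply/measurable_EFinP; apply: (@measurableT_comp _ _ _ _ _ _ fine) => //.
  exact: measurable_int iF.
- exact: measurable_int iF.
- have := ae_integrable1 fi; apply: filterS => s hs _.
  by rewrite /Rintegral fineK//; exact: integrable_fin_num.
Qed.

Lemma Rintegral_Fubini_slice (r : R) (F : R -> 'rV[R]_n -> R) :
  let f := fun z : X => (0 <= z.1 <= r)%R%:R * F z.1 z.2 in
  spacetime.-integrable setT (EFin \o f) ->
  \int[lebesgue_measure]_(s in `[0, r]) \int[mu]_x F s x = \int[spacetime]_z f z.
Proof.
move=> f fi; rewrite -Rintegral_Fubini// Rintegral_mkcond.
apply: eq_Rintegral => s _; rewrite patchE /f /=.
have -> : (s \in `[0, r]%classic) = (0 <= s <= r).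
  by apply/idP/idP; rewrite inE /= in_itv.
case: ifP => _; last first.
  by rewrite (_ : (fun x => _) = fun=> 0) ?/Rintegral ?integral0//; apply/funext => x; rewrite mul0r.
by apply: eq_Rintegral => x _; rewrite mul1r.
Qed.

Lemma continuous_enorm : continuous (@enorm R n).
Proof.
move=> x; apply: (@continuous_comp _ _ _ (@sqn R n) (@Num.sqrt R)).
  exact: continuous_sqn.
exact: sqrt_continuous.
Qed.

Lemma measurable_enorm : measurable_fun setT (@enorm R n).
Proof. exact: (continuous_measurable_rV continuous_enorm). Qed.

Lemma enorm_ge0 (x : 'rV[R]_n) : 0 <= enorm x.
Proof. exact: sqrtr_ge0. Qed.

Lemma enorm_sqr (x : 'rV[R]_n) : enorm x ^+ 2 = sqn x.
Proof. by rewrite sqr_sqrtr// sqn_ge0. Qed.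

Lemma coord_le_enorm (x : 'rV[R]_n) i : `|x ord0 i| <= enorm x.
Proof. by rewrite -sqrtr_sqr ler_wsqrtr// coord_le_sqn. Qed.

(** The support condition confines the solution up to time r to this set. *)
Definition cone (r : R) : set X := [set z | 0 <= z.1 <= r /\ enorm z.2 <= z.1 + 2^-1].

Lemma measurable_cone r : measurable (cone r).
Proof.
have mfst : measurable_fun setT (fst : X -> measurableTypeR R) by exact: measurable_fst.
have ->: cone r = (fst @^-1` `[0, r]%classic) `&` ((fun z : X => enorm z.2 - z.1) @^-1` `]-oo, 2^-1]).
  apply/seteqP; split => z /=; rewrite !in_itv/=.
    by move=> [h1 h2]; split; [exact: h1|rewrite lerBlDl].
  by move=> [h1 h2]; split; [exact: h1|rewrite -lerBlDl].
apply: measurableI; rewrite -[X in measurable X]setTI; first exact: mfst.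
have mg : measurable_fun setT (fun z : X => enorm z.2 - z.1).
  apply: measurable_funB => //.
  by apply: measurableT_comp; [exact: measurable_enorm|exact: measurable_snd].
exact: mg.
Qed.

Lemma lebesgue_rV_cube (l : R) : 0 <= l ->
  mu [set x | forall i : 'I_n, `[- l, l]%classic (x ord0 i)] = ((2 * l) ^+ n)%:E.
Proof.
move=> l0; rewrite (@lebesgue_rV_box R n (fun=> `[- l, l]%classic))//.
rewrite big_const_ord lebesgue_measure_itv/= lte_fin.
have -> : (if (- l < l)%R then l%:E - (- l)%:E else 0)%E = (2 * l)%:E.
  case: ifP => h; first by rewrite -EFinB; congr EFin; ring.
  have -> : l = 0 by lra.
  by rewrite mulr0.
by elim: (n) => [|k IH]//=; rewrite IH -EFinM exprS.
Qed.

(** Integrating in time first, along the vertical line through x, reduces the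
    weight singular on the light cone to a one-dimensional integral; no polar
    coordinates are needed. *)
Lemma cone_weight_integral (B r : R) (Phi : R -> R) : 0 < r ->
  (forall y : R, 0 < y -> is_derive y 1 Phi (y `^ (- B))) ->
  (\int[spacetime]_z (\1_(cone r) z * (1 + z.1 - enorm z.2) `^ (- B))%:E
   <= ((2 * r + 1) ^+ n * (Phi (r + 1) - Phi 2^-1))%:E)%E.
Proof.
move=> r0 dPhi.
pose F (z : X) := \1_(cone r) z * (1 + z.1 - enorm z.2) `^ (- B).
have mF : measurable_fun setT F.
  apply: measurable_funM.
    by apply: measurable_indic; exact: measurable_cone.
  apply: (@measurableT_comp _ _ _ _ _ _ (fun y : R => y `^ (- B))).
    exact: measurable_powR.
  apply: measurable_funB; first by apply: measurable_funD.
  by apply: measurableT_comp; [exact: measurable_enorm|exact: measurable_snd].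
have F0 z : 0 <= F z by rewrite mulr_ge0// powR_ge0.
have cPhi (y : R) : 0 < y -> {for y, continuous Phi}.
  by move=> y0; exact: is_derive_continuous (dPhi y y0).
have Phi_incr (y1 y2 : R) : 0 < y1 -> y1 <= y2 -> Phi y1 <= Phi y2.
  move=> y10 y12; apply: (@ger0_derive1_le_cc _ Phi y1 y2).
  - move=> x; rewrite in_itv/= => /andP[h _].
    by have [] := dPhi x (lt_trans y10 h).
  - move=> x; rewrite in_itv/= => /andP[h _]; rewrite derive1E.
    by have [_ ->] := dPhi x (lt_trans y10 h); exact: powR_ge0.
  - apply: continuous_in_subspaceT => x; rewrite inE/= in_itv/= => /andP[h _].
    exact: cPhi (lt_le_trans y10 h).
  - by rewrite in_itv/= lexx.
  - by rewrite in_itv/= lexx y12.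
  - exact: y12.
have L0 : 0 <= Phi (r + 1) - Phi 2^-1.
  by rewrite subr_ge0; apply: Phi_incr; lra.
set L := Phi (r + 1) - Phi 2^-1 in L0 *.
pose Q := [set x : 'rV[R]_n | forall i : 'I_n, `[- (r + 2^-1), r + 2^-1]%classic (x ord0 i)].
have mQ : measurable Q.
  by apply: (@measurable_box R n (fun=> `[- (r + 2^-1), r + 2^-1]%classic)).
have line x : (\int[lebesgue_measure]_s (F (s, x))%:E <= (\1_Q x * L)%:E)%E.
  have [rx|rx] := ltP (r + 2^-1) (enorm x).
    rewrite (_ : (fun s => _) = fun=> 0%E).
      by rewrite integral0 lee_fin mulr_ge0.
    apply/funext => s; rewrite /F indicE memNset ?mul0r// => -[/= /andP[_ sr] h].
    by have := lt_le_trans rx h; rewrite ltrD2r ltNge sr.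
  have Qx : Q x.
    by move=> i; rewrite /= in_itv/= -ler_norml; apply: le_trans (coord_le_enorm x i) rx.
  rewrite indicE mem_set// mul1r.
  (* the line through x meets the cone in the interval [s0, r] *)
  pose s0 := Num.max 0 (enorm x - 2^-1).
  have s00 : 0 <= s0 by rewrite le_max lexx.
  have s0x : enorm x - 2^-1 <= s0 by rewrite le_max lexx orbT.
  have x0 := enorm_ge0 x.
  have s0r : s0 <= r by rewrite ge_max (ltW r0)/=; lra.
  have E : (fun s => (F (s, x))%:E) =
     ((fun s => ((1 + s - enorm x) `^ (- B))%:E) \_ `[s0, r]).
    apply/funext => s; rewrite patchE /F indicE.
    have -> : ((s, x) \in cone r) = (s \in `[s0, r]%classic).
      apply/idP/idP; rewrite !inE/= in_itv/= /cone/= /s0.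
        by move=> [/andP[h1 h3] h2]; rewrite ge_max h1 h3/= andbT lerBlDr.
      by rewrite ge_max => /andP[/andP[h1 h] h3]; split; [rewrite h1 h3|rewrite -lerBlDr].
    by case: ifP => _; rewrite ?mul1r ?mul0r.
  rewrite E -integral_mkcond.
  move: s0r; rewrite le_eqVlt => /orP[/eqP ->|s0r].
    by rewrite set_itv1 integral_set1 lee_fin.
  have pos s : s0 <= s -> 2^-1 <= 1 + s - enorm x by move=> h; lra.
  have pos' s : s0 <= s -> 0 < 1 + s - enorm x by move=> /pos; lra.
  have dG (s : R) : s0 <= s -> is_derive s 1 (fun s => Phi (1 + s - enorm x))
     ((1 + s - enorm x) `^ (- B)).
    move=> h; have d1 : is_derive s 1 (fun s : R => 1 + s - enorm x) 1.
      have := is_deriveB (is_deriveD (is_derive_cst (1 : R) s 1) (is_derive_id s (1 : R)))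
        (is_derive_cst (enorm x) s (1 : R)).
      by rewrite add0r subr0.
    have := @is_derive_comp1 R R Phi (fun s : R => 1 + s - enorm x) s 1 _ _
      (dPhi _ (pos' _ h)) d1.
    by rewrite mulr1.
  have cG : {within `[s0, r], continuous (fun s => Phi (1 + s - enorm x))}.
    apply: continuous_in_subspaceT => s; rewrite inE/= in_itv/= => /andP[h _].
    exact: is_derive_continuous (dG s h).
  have [_ cGr cGl] := (continuous_within_itvP _ s0r).1 cG.
  rewrite (@continuous_FTC2 _ _ (fun s => Phi (1 + s - enorm x)) s0 r)//.
  - rewrite -EFinB lee_fin /L lerB//; apply: Phi_incr; first by apply: pos'; exact: ltW.
      by lra.
    by lra.
    by apply: pos.
  - apply: continuous_in_subspaceT => s; rewrite inE/= in_itv/= => /andP[h _].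
    apply: (@continuous_comp _ _ _ (fun s : R => 1 + s - enorm x) (fun y : R => y `^ (- B))).
      by apply: cvgB; [apply: cvgD; [exact: cvg_cst|exact: cvg_id]|exact: cvg_cst].
    exact: is_derive_continuous (is_derive1_powR (- B) (pos' _ h)).
  - split => // s; rewrite in_itv/= => /andP[/ltW h _].
    by have [] := dG s h.
  - move=> s; rewrite in_itv/= => /andP[/ltW h _].
    by rewrite derive1E; have [_ ->] := dG s h.
rewrite fubini_tonelli2//; last exact/measurable_EFinP.
apply: (@le_trans _ _ (\int[mu]_x (\1_Q x * L)%:E)%E).
  apply: ge0_le_integral => //.
  - by move=> x _; apply: integral_ge0 => s _; rewrite lee_fin; exact: F0.
  - by apply: measurable_fun_fubini_tonelli_G => //; exact/measurable_EFinP.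
  - by apply/measurable_EFinP; apply: measurable_funM => //; exact: measurable_indic.
  - by move=> x _; exact: line.
under eq_integral do rewrite mulrC EFinM.
rewrite ge0_integralZl//; last first.
- by apply/measurable_EFinP; exact: measurable_indic.
have l0 : 0 <= r + 2^-1 by lra.
have volQ : mu Q = ((2 * (r + 2^-1)) ^+ n)%:E := lebesgue_rV_cube l0.
rewrite integral_indic// setIT [X in (_ * X)%E]volQ.
rewrite -EFinM lee_fin mulrC (_ : 2 * (r + 2^-1) = 2 * r + 1)//.
by rewrite mulrDr mulfV.
Qed.

End spacetime.

(** * Time cutoffs and shifted powers *)

Section profiles.
Context {R : realType}.

Definition dcutoff : R -> R := 'D_1 (@cutoff R).
Definition ddcutoff : R -> R := 'D_1 dcutoff.

Lemma is_derive_cutoff (x : R) : is_derive x 1 (@cutoff R) (dcutoff x).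
Proof. exact: (Ck_is_derive (1 : R) x (Ck_cutoff 1)). Qed.

Lemma is_derive_dcutoff (x : R) : is_derive x 1 dcutoff (ddcutoff x).
Proof. exact: (Ck_is_derive (1 : R) x (Ck_derive (1 : R) (Ck_cutoff 2))). Qed.

Lemma continuous_dcutoff : continuous dcutoff.
Proof. by move=> x; exact: is_derive_continuous (is_derive_dcutoff x). Qed.

Lemma continuous_ddcutoff : continuous ddcutoff.
Proof. exact: (Ck_continuous (Ck_derive (1 : R) (Ck_derive (1 : R) (Ck_cutoff 2)))). Qed.

Lemma derive_near_cst (k : R -> R) (c : R) (x : R) :
  (\forall y \near x, k y = c) -> 'D_1 k x = 0.
Proof. by move=> kc; rewrite (@near_eq_derive _ _ _ k (fun=> c))// derive_cst. Qed.

Lemma dcutoff_lt0 x : x < 0 -> dcutoff x = 0.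
Proof.
move=> x0; apply: (@derive_near_cst _ 1); near=> y; apply: cutoff_1.
by apply: ltW; near: y; exact: lt_nbhsl.
Unshelve. all: by end_near. Qed.

Lemma dcutoff_gt1 x : 1 < x -> dcutoff x = 0.
Proof.
move=> x0; apply: (@derive_near_cst _ 0); near=> y; apply: cutoff_0.
by apply: ltW; near: y; exact: lt_nbhsr.
Unshelve. all: by end_near. Qed.

Lemma ddcutoff_lt0 x : x < 0 -> ddcutoff x = 0.
Proof.
move=> x0; apply: (@derive_near_cst _ 0); near=> y; apply: dcutoff_lt0.
by near: y; exact: lt_nbhsl.
Unshelve. all: by end_near. Qed.

Lemma ddcutoff_gt1 x : 1 < x -> ddcutoff x = 0.
Proof.
move=> x0; apply: (@derive_near_cst _ 0); near=> y; apply: dcutoff_gt1.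
by near: y; exact: lt_nbhsr.
Unshelve. all: by end_near. Qed.

(** Time cutoff at scale r, varying between r/2 and r. The power m.+2 makes its
    first two derivatives dominated by a fractional power of the cutoff itself. *)
Definition tcut (m : nat) (r t : R) : R := cutoff (2 / r * t - 1) ^+ m.+2.
Definition tcut1 (m : nat) (r t : R) : R :=
  2 / r * (m.+2%:R * cutoff (2 / r * t - 1) ^+ m.+1 * dcutoff (2 / r * t - 1)).
Definition tcut2 (m : nat) (r t : R) : R :=
  (2 / r) ^+ 2 * (m.+2%:R * m.+1%:R * cutoff (2 / r * t - 1) ^+ m * dcutoff (2 / r * t - 1) ^+ 2
   + m.+2%:R * cutoff (2 / r * t - 1) ^+ m.+1 * ddcutoff (2 / r * t - 1)).

Let is_derive_affine (r t : R) : is_derive t 1 (fun t : R => 2 / r * t - 1) (2 / r).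
Proof.
have := is_deriveB (is_deriveM (is_derive_cst (2 / r) t 1) (is_derive_id t (1 : R)))
   (is_derive_cst (1 : R) t 1).
move/is_derive_eq; apply; rewrite /GRing.scale/=; ring.
Qed.

Let is_derive_cutoffX (m : nat) (r t : R) : is_derive t 1
  (fun t => cutoff (2 / r * t - 1) ^+ m.+1)
  (2 / r * (m.+1%:R * cutoff (2 / r * t - 1) ^+ m * dcutoff (2 / r * t - 1))).
Proof.
have d1 := @is_derive_comp1 R R cutoff (fun t : R => 2 / r * t - 1) t 1 _ _
    (is_derive_cutoff _) (is_derive_affine r t).
have := is_deriveX m.+1 d1; rewrite exprfctE; move/is_derive_eq; apply.
by rewrite /GRing.scale/=; ring.
Qed.

Lemma is_derive_tcut m r (t : R) : is_derive t 1 (tcut m r) (tcut1 m r t).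
Proof. exact: is_derive_cutoffX. Qed.

Lemma is_derive_tcut1 m r (t : R) : is_derive t 1 (tcut1 m r) (tcut2 m r t).
Proof.
have d1 := @is_derive_comp1 R R dcutoff (fun t : R => 2 / r * t - 1) t 1 _ _
    (is_derive_dcutoff _) (is_derive_affine r t).
have d2 := is_deriveM (is_deriveM (is_derive_cst (m.+2%:R : R) t 1) (is_derive_cutoffX m r t)) d1.
have := is_deriveM (is_derive_cst (2 / r) t 1) d2; move/is_derive_eq; apply.
by rewrite /tcut2 /GRing.scale/= !fctE; ring.
Qed.

Lemma Ck_tcut k m r : Ck k (tcut m r).
Proof.
apply: CkX; apply: (@Ck_comp _ _ _ _ (fun t => 2 / r * t - 1)); first exact: Ck_cutoff.
by apply: CkD; [apply: CkM; [exact: Ck_cst|exact: Ck_id]|exact: Ck_cst].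
Qed.

Lemma tcut_1 m r t : 0 < r -> t <= r / 2 -> tcut m r t = 1.
Proof.
move=> r0 tr; rewrite /tcut cutoff_1 ?expr1n// subr_le0.
by rewrite mulrAC ler_pdivrMr// mul1r; lra.
Qed.

Lemma tcut_0 m r t : 0 < r -> r <= t -> tcut m r t = 0.
Proof.
move=> r0 tr; rewrite /tcut cutoff_0 ?expr0n// lerBrDl.
by rewrite mulrAC ler_pdivlMr//; lra.
Qed.

Lemma tcut_ge0 m r t : 0 <= tcut m r t.
Proof. by rewrite exprn_ge0// cutoff_ge0. Qed.

Lemma tcut_le1 m r t : tcut m r t <= 1.
Proof. by rewrite exprn_ile1// ?cutoff_ge0 ?cutoff_le1. Qed.

(** Two derivatives leave the power m out of m + 2 of the basic cutoff; the
    condition on m says that this is at most the power 1/p of tcut, as the basic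
    cutoff is at most 1. *)
Lemma tcut_derivative_bound m (p : R) : 1 < p -> m.+2%:R / p <= m%:R ->
  exists2 C, 0 < C & forall r t, 0 < r ->
    `|tcut1 m r t| <= C / r * (tcut m r t) `^ p^-1 * (r / 2 <= t)%R%:R /\
    `|tcut2 m r t| <= C / r ^+ 2 * (tcut m r t) `^ p^-1 * (r / 2 <= t)%R%:R.
Proof.
move=> p1 mp; have p0 : 0 < p by rewrite (lt_trans ltr01).
have [M1 [M10 M1P]] := continuous_bounded_flat continuous_dcutoff dcutoff_lt0 dcutoff_gt1.
have [M2 [M20 M2P]] := continuous_bounded_flat continuous_ddcutoff ddcutoff_lt0 ddcutoff_gt1.
pose m2 : R := m.+2%:R; pose m1 : R := m.+1%:R.
have m20 : 0 < m2 by rewrite ltr0n.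
have m10 : 0 < m1 by rewrite ltr0n.
exists (2 * m2 * M1 + 4 * (m2 * m1 * M1 ^+ 2 + m2 * M2)).
  by rewrite addr_gt0 ?mulr_gt0 ?addr_gt0 ?mulr_gt0 ?exprn_gt0.
move=> r t r0; set y := 2 / r * t - 1.
have [tr|tr] := leP (r / 2) t; last first.
  have y0 : y < 0 by rewrite subr_lt0 mulrAC ltr_pdivrMr// mul1r; lra.
  rewrite /tcut1 /tcut2 -/y dcutoff_lt0// ddcutoff_lt0// expr0n/= !mulr0.
  by rewrite addr0 mulr0 normr0.
rewrite !mulr1 /tcut1 /tcut2 /tcut -/y.
have c0 := cutoff_ge0 y; have c1 := cutoff_le1 y; set c := cutoff y in c0 c1 *.
have cm : c ^+ m <= (c ^+ m.+2) `^ p^-1.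
  have [->|cn0] := eqVneq c 0.
    case: m mp {m2 m1 m20 m10} => [|m] mp; last by rewrite expr0n/= powR_ge0.
    by exfalso; move: mp; rewrite leNgt divr_gt0.
  rewrite -powR_mulrn// -powR_mulrn// -powRrM.
  by apply: ger_powR => //; rewrite lt_neqAle eq_sym cn0 c0.
have cm1 : c ^+ m.+1 <= (c ^+ m.+2) `^ p^-1.
  by apply: le_trans cm; rewrite exprS ler_piMl// exprn_ge0.
have e0 : 0 <= (c ^+ m.+2) `^ p^-1 by exact: powR_ge0.
set e := (c ^+ m.+2) `^ p^-1 in cm cm1 e0 *.
have ir : 0 < r^-1 by rewrite invr_gt0.
have d1 := M1P y; have d2 := M2P y.
have X0 : 0 <= c ^+ m.+1 by rewrite exprn_ge0.
have Y0 : 0 <= c ^+ m by rewrite exprn_ge0.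
have B1 : `|m2 * c ^+ m.+1 * dcutoff y| <= m2 * M1 * e.
  rewrite !normrM (ger0_norm X0) (gtr0_norm m20) -!mulrA ler_pM2l// mulrC.
  by apply: ler_pM.
have B2 : `|m2 * m1 * c ^+ m * dcutoff y ^+ 2| <= m2 * m1 * M1 ^+ 2 * e.
  rewrite !normrM (ger0_norm Y0) (gtr0_norm m20) (gtr0_norm m10) -[`|_| * `|_|]expr2.
  rewrite -[leLHS]mulrA -[leRHS]mulrA ler_pM2l ?mulr_gt0// mulrC.
  apply: ler_pM => //.
  by rewrite lerXn2r ?nnegrE ?(ltW M10).
have B3 : `|m2 * c ^+ m.+1 * ddcutoff y| <= m2 * M2 * e.
  rewrite !normrM (ger0_norm X0) (gtr0_norm m20) -!mulrA ler_pM2l// mulrC.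
  by apply: ler_pM.
have S0 : 0 <= m2 * m1 * M1 ^+ 2 + m2 * M2.
  by rewrite addr_ge0 ?mulr_ge0 ?exprn_ge0 ?ltW.
have S1 : 0 <= m2 * M1 by rewrite mulr_ge0 ?ltW.
split.
  rewrite normrM (ger0_norm (_ : 0 <= 2 / r)); last by rewrite divr_ge0// ltW.
  apply: (@le_trans _ _ (2 / r * (m2 * M1 * e))).
    by rewrite ler_pM2l// divr_gt0.
  rewrite -subr_ge0 (_ : _ - _ = 4 * (m2 * m1 * M1 ^+ 2 + m2 * M2) * r^-1 * e); last by ring.
  by rewrite !mulr_ge0// ltW.
rewrite normrM (ger0_norm (_ : 0 <= (2 / r) ^+ 2)); last by rewrite exprn_ge0// divr_ge0// ltW.
apply: (@le_trans _ _ ((2 / r) ^+ 2 * (m2 * m1 * M1 ^+ 2 * e + m2 * M2 * e))).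
  rewrite ler_pM2l ?exprn_gt0 ?divr_gt0//.
  by apply: le_trans (ler_normD _ _) _; apply: lerD.
rewrite -subr_ge0 (_ : _ - _ = 2 * m2 * M1 * (r ^+ 2)^-1 * e); last first.
  by field; rewrite gt_eqF.
by rewrite !mulr_ge0 ?invr_ge0 ?exprn_ge0// ltW.
Qed.

(** Powers of 1 + t become smooth on the whole line once they are multiplied by
    a smooth function that vanishes before the singular time t = -1. *)
Section shifted_power.
Variables (psi dpsi : R -> R).
Hypotheses (psid : forall x : R, is_derive x 1 psi (dpsi x))
  (psi0 : forall t, t <= - 2^-1 -> psi t = 0).

Lemma dpsi0 t : t < - 2^-1 -> dpsi t = 0.
Proof.
move=> th; have [_ <-] := psid t; apply: (@derive_near_cst _ 0).
by near=> y; apply: psi0; apply: ltW; near: y; exact: lt_nbhsl.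
Unshelve. all: by end_near. Qed.

Lemma is_derive_shifted_power (nu x : R) :
  is_derive x 1 (fun t => psi t * (1 + t) `^ nu)
    (dpsi x * (1 + x) `^ nu + nu * (psi x * (1 + x) `^ (nu - 1))).
Proof.
have [xh|xh] := ltP x (- 2^-1).
  rewrite dpsi0// psi0 ?ltW// !mul0r mulr0 addr0.
  apply: (@near_eq_is_derive R R R (fun=> 0)).
  by near=> y; rewrite psi0 ?mul0r// ltW//; near: y; exact: lt_nbhsl.
have x1 : 0 < 1 + x by lra.
have d1 : is_derive x 1 (fun y : R => 1 + y) 1.
  have := is_deriveD (is_derive_cst (1 : R) x 1) (is_derive_id x (1 : R)).
  by rewrite add0r.
have d2 := @is_derive_comp1 R R (fun y : R => y `^ nu) (fun y : R => 1 + y) x 1 _ _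
    (is_derive1_powR nu x1) d1.
have := is_deriveM (psid x) d2; move/is_derive_eq; apply.
by rewrite /GRing.scale/=; ring.
Unshelve. all: by end_near. Qed.

End shifted_power.

Lemma Ck_shifted_power k (psi : R -> R) (nu : R) : smooth psi ->
  (forall t, t <= - 2^-1 -> psi t = 0) -> Ck k (fun t => psi t * (1 + t) `^ nu).
Proof.
elim: k psi nu => [|k IH] psi nu spsi psi0.
  have d x := Ck_is_derive (1 : R) x (spsi 1%N).
  by move=> x; exact: is_derive_continuous (is_derive_shifted_power d psi0 nu x).
have d x := Ck_is_derive (1 : R) x (spsi 1%N).
apply: (Ck_intro1 (is_derive_shifted_power d psi0 nu)).
apply: CkD.
  have sd : smooth ('D_1 psi) by move=> j; exact: (Ck_derive (1 : R) (spsi j.+1)).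
  apply: (IH _ nu sd) => t; rewrite le_eqVlt => /orP[/eqP ->|]; last exact: dpsi0 d psi0 _.
  have cd : continuous ('D_1 psi) := Ck_continuous (sd 0%N).
  have cl : 'D_1 psi t @[t --> (- 2^-1)^'-] --> 'D_1 psi (- 2^-1 : R).
    by apply: cvg_at_left_filter; exact: cd.
  apply: (cvg_unique _ cl) => //.
  apply: cvg_trans (@cvg_cst _ _ _ ((- 2^-1)^'-) _).
  apply: near_eq_cvg; near=> s; rewrite (dpsi0 d psi0)//.
by apply: CkM; [exact: Ck_cst|exact: IH].
Unshelve. all: by end_near. Qed.

End profiles.

(** * The modes of a self-similar solution *)

Section radial_profile.
Context {R : realType}.

(** The power |x|^{2k} as a function of y = |x|^2, cut off beyond Y. *)
Definition radpow (k : nat) (Y y : R) : R := y ^+ k * cutoff (y - Y).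
Definition radpow1 k Y : R -> R := 'D_1 (radpow k Y).
Definition radpow2 k Y : R -> R := 'D_1 (radpow1 k Y).

Lemma smooth_rad k Y : smooth (radpow k Y).
Proof.
move=> j; apply: CkM; first by apply: CkX; exact: Ck_id.
apply: (@Ck_comp R R j cutoff (fun y : R => y - Y)); first exact: Ck_cutoff.
by apply: CkD; [exact: Ck_id|exact: Ck_cst].
Qed.

Lemma is_derive_rad k Y (y : R) : is_derive y 1 (radpow k Y) (radpow1 k Y y).
Proof. exact: (Ck_is_derive (1 : R) y (smooth_rad k Y 1)). Qed.

Lemma is_derive_rad1 k Y (y : R) : is_derive y 1 (radpow1 k Y) (radpow2 k Y y).
Proof. exact: (Ck_is_derive (1 : R) y (Ck_derive (1 : R) (smooth_rad k Y 2))). Qed.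

Lemma continuous_rad k Y : continuous (radpow k Y).
Proof. exact: (Ck_continuous (smooth_rad k Y 0)). Qed.

Lemma continuous_rad1 k Y : continuous (radpow1 k Y).
Proof. by move=> y; exact: is_derive_continuous (is_derive_rad1 k Y y). Qed.

Lemma continuous_rad2 k Y : continuous (radpow2 k Y).
Proof. exact: (Ck_continuous (Ck_derive (1 : R) (Ck_derive (1 : R) (smooth_rad k Y 2)))). Qed.

Lemma rad_ge0 k Y y : 0 <= y -> 0 <= radpow k Y y.
Proof. by move=> y0; rewrite mulr_ge0 ?exprn_ge0 ?cutoff_ge0. Qed.

Lemma radE k Y y : y <= Y -> radpow k Y y = y ^+ k.
Proof. by move=> yY; rewrite /radpow cutoff_1 ?mulr1// subr_le0. Qed.

Lemma rad_0 k Y y : Y + 1 < y -> radpow k Y y = 0.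
Proof. by move=> yY; rewrite /radpow cutoff_0 ?mulr0// lerBrDl ltW. Qed.

Lemma derive_monomial (k : nat) (c y : R) :
  is_derive y 1 (fun y : R => c * y ^+ k) (c * (k%:R * y ^+ k.-1)).
Proof.
have := is_deriveX k (is_derive_id y (1 : R)); rewrite exprfctE => dX.
have := is_deriveM (is_derive_cst c y (1 : R)) dX; move/is_derive_eq; apply.
by rewrite /GRing.scale/= mulr1 mulr0 addr0.
Qed.

Lemma rad1E k Y y : y < Y -> radpow1 k Y y = k%:R * y ^+ k.-1.
Proof.
move=> yY; rewrite /radpow1 (@near_eq_derive R R R _ (fun y => 1 * y ^+ k)).
  by have [_ ->] := derive_monomial k 1 y; rewrite mul1r.
near=> z; rewrite mul1r radE// ltW//; near: z; exact: lt_nbhsl.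
Unshelve. all: by end_near. Qed.

Lemma rad2E k Y y : y < Y -> radpow2 k Y y = k%:R * (k.-1%:R * y ^+ k.-2).
Proof.
move=> yY; rewrite /radpow2 (@near_eq_derive R R R _ (fun y => k%:R * y ^+ k.-1)).
  by have [_ ->] := derive_monomial k.-1 k%:R y.
near=> z; rewrite rad1E//; near: z; exact: lt_nbhsl.
Unshelve. all: by end_near. Qed.

(** The left-hand side is the Laplacian of h(|x|^2), which equals
    4 y h'' + 2 n h' at y = |x|^2. *)
Lemma laplace_rad n k Y y : y < Y ->
  4 * y * radpow2 k Y y + 2 * n%:R * radpow1 k Y y = 2 * k%:R * (2 * k.-1%:R + n%:R) * y ^+ k.-1.
Proof.
move=> yY; rewrite rad1E// rad2E//; case: k => [|[|k]] /=; rewrite ?exprS; ring.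
Qed.

End radial_profile.

Section time_profile.
Context {R : realType}.
Variables (m : nat) (r : R).
Hypothesis r0 : 0 < r.

(** The second cutoff is inactive for t >= -1/4 and removes the neighbourhood of
    t = -1, where the powers of 1 + t are singular. *)
Definition tprof (t : R) : R := cutoff (- 4 * t - 1) * tcut m r t.

Lemma smooth_tprof : smooth tprof.
Proof.
move=> k; apply: CkM; last exact: Ck_tcut.
apply: (@Ck_comp R R k cutoff (fun t : R => - 4 * t - 1)); first exact: Ck_cutoff.
by apply: CkD; [apply: CkM; [exact: Ck_cst|exact: Ck_id]|exact: Ck_cst].
Qed.

Lemma tprof_0 t : t <= - 2^-1 -> tprof t = 0.
Proof. by move=> th; rewrite /tprof cutoff_0 ?mul0r//; lra. Qed.

Lemma tprofE t : - 4^-1 <= t -> tprof t = tcut m r t.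
Proof. by move=> th; rewrite /tprof cutoff_1 ?mul1r//; lra. Qed.

Lemma derive_tprof t : - 4^-1 < t -> 'D_1 tprof t = tcut1 m r t.
Proof.
move=> th; rewrite (@near_eq_derive R R R _ (tcut m r)).
  by have [_ ->] := is_derive_tcut m r t.
near=> z; apply: tprofE; apply: ltW; near: z; exact: lt_nbhsr.
Unshelve. all: by end_near. Qed.

End time_profile.

Section mode_identity.
Context {R : realType} {n : nat}.
Let mu := lebesgue_rV R n.
Variables (T : \bar R) (u ut : R -> 'rV[R]_n -> R)
  (Du : R -> 'I_n -> 'rV[R]_n -> R) (mu0 p eps : R) (f g : 'rV[R]_n -> R).
Hypotheses (hH : forall t, time_interval T t -> in_H1 (u t) (Du t))
  (hC : C1_L2 T u ut) (hu0 : {ae mu, forall x, u 0 x = eps * f x})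
  (hw : weak_form T mu0 p eps g u ut Du)
  (hf : f \in Lfun mu 2%:E) (hg : g \in Lfun mu 2%:E).
Variables (m : nat) (r Y nu : R) (k : nat).
Hypotheses (r0 : 0 < r) (rT : (r%:E < T)%E).

(** With a(s) = E(s) (1 + s)^{-nu} and E the time cutoff, this is
    a'' - (mu0 a / (1 + s))', the time part of the conjugate operator. *)
Definition conj_coef (s : R) : R :=
  tcut2 m r s * (1 + s) `^ (- nu)
  - (2 * nu + mu0) * tcut1 m r s * (1 + s) `^ (- nu - 1)
  + (nu + 1) * (nu + mu0) * tcut m r s * (1 + s) `^ (- nu - 2).

(** At time 0 the cutoff E is locally constant, so that the data enter with the
    factors a(0) = 1 and mu0 a(0) - a'(0) = mu0 + nu. *)
Lemma mode_identity :
  \int[lebesgue_measure]_(s in `[0, r]) \int[mu]_x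
     (`|u s x| `^ p * (tcut m r s * (1 + s) `^ (- nu) * radpow k Y (sqn x)))
  + eps * \int[mu]_x (g x * radpow k Y (sqn x))
  + eps * (mu0 + nu) * \int[mu]_x (f x * radpow k Y (sqn x))
  = \int[lebesgue_measure]_(s in `[0, r]) \int[mu]_x (u s x *
     (conj_coef s * radpow k Y (sqn x)
      - tcut m r s * (1 + s) `^ (- nu) *
          (4 * sqn x * radpow2 k Y (sqn x) + 2 * n%:R * radpow1 k Y (sqn x)))).
Proof.
pose psi := tprof m r.
have spsi : smooth psi := smooth_tprof m r.
have spsi1 : smooth ('D_1 psi) by move=> j; exact: (Ck_derive (1 : R) (spsi j.+1)).
have d1 x := Ck_is_derive (1 : R) x (spsi 1%N).
have d2 x := Ck_is_derive (1 : R) x (spsi1 1%N).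
have psi0 : forall t, t <= - 2^-1 -> psi t = 0 := @tprof_0 R m r.
pose a t := psi t * (1 + t) `^ (- nu).
have sa : smooth a by move=> j; exact: Ck_shifted_power.
have da (x : R) := Ck_is_derive (1 : R) x (sa 1%N).
have da1 (x : R) := Ck_is_derive (1 : R) x (Ck_derive (1 : R) (sa 2%N)).
have ca2 := Ck_continuous (Ck_derive (1 : R) (Ck_derive (1 : R) (sa 2%N))).
have q4 (s : R) : 0 <= s -> - 4^-1 < s by move=> s0; lra.
have aE (s : R) : 0 <= s -> a s = tcut m r s * (1 + s) `^ (- nu).
  by move=> s0; rewrite /a /psi tprofE// ltW// q4.
have a1' (x : R) : 'D_1 a x = 'D_1 psi x * (1 + x) `^ (- nu) + (- nu) * (psi x * (1 + x) `^ (- nu - 1)).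
  by have [_ ->] := is_derive_shifted_power d1 psi0 (- nu) x.
have a1E (s : R) : 0 <= s -> 'D_1 a s = tcut1 m r s * (1 + s) `^ (- nu)
     - nu * (tcut m r s * (1 + s) `^ (- nu - 1)).
  move=> s0; rewrite a1' derive_tprof ?q4// /psi tprofE ?mulNr//.
  exact: ltW (q4 _ s0).
have a2E (s : R) : 0 <= s -> 'D_1 ('D_1 a) s = tcut2 m r s * (1 + s) `^ (- nu)
     - 2 * nu * (tcut1 m r s * (1 + s) `^ (- nu - 1))
     + nu * (nu + 1) * (tcut m r s * (1 + s) `^ (- nu - 2)).
  move=> s0; have s1 : - 4^-1 < s := q4 _ s0.
  rewrite (@near_eq_derive R R R _ (fun t : R => tcut1 m r t * (1 + t) `^ (- nu)
      + (- nu) * (tcut m r t * (1 + t) `^ (- nu - 1)))); last first.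
    near=> z; have z4 : - 4^-1 < z by near: z; exact: lt_nbhsr.
    by rewrite a1' derive_tprof// /psi tprofE// ltW.
  have sp : 0 < 1 + s by lra.
  have e1 : is_derive s 1 (fun y : R => 1 + y) 1.
    have := is_deriveD (is_derive_cst (1 : R) s 1) (is_derive_id s (1 : R)).
    by rewrite add0r.
  have eP nu' : is_derive s 1 (fun y : R => (1 + y) `^ nu') (nu' * (1 + s) `^ (nu' - 1) * 1).
    exact: (@is_derive_comp1 R R (fun y : R => y `^ nu') (fun y : R => 1 + y) s 1 _ _
      (is_derive1_powR nu' sp) e1).
  have f1 := is_deriveM (is_derive_tcut1 m r s) (eP (- nu)).
  have f2 := is_deriveM (is_derive_tcut m r s) (eP (- nu - 1)).
  have [_ E] := is_deriveD f1 (is_deriveM (is_derive_cst (- nu) s (1 : R)) f2).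
  rewrite [LHS]E /GRing.scale/= !fctE.
  have -> : - nu - 1 - 1 = - nu - 2 by ring.
  by ring.
have pw (s nu' : R) : 0 <= s -> (1 + s) `^ nu' / (1 + s) = (1 + s) `^ (nu' - 1).
  move=> s0; have sp : 0 < 1 + s by lra.
  by rewrite powRD_gt0// powRN powRr1// ltW.
have := @weak_identity R n T u ut Du mu0 p eps f g hH hC hu0 hw hf hg
  a ('D_1 a) ('D_1 ('D_1 a)) (radpow k Y) (radpow1 k Y) (radpow2 k Y) r (Y + 1)
  sa (smooth_rad k Y) da da1 ca2 (is_derive_rad k Y) (is_derive_rad1 k Y).
have a00 : forall t : R, r <= t -> a t = 0.
  by move=> t rt; rewrite /a /psi /tprof tcut_0// mulr0 mul0r.
move=> /(_ a00 (@rad_0 R k Y) r0 rT).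
have i0 : tcut m r 0 = 1 by rewrite tcut_1// divr_ge0// ltW.
have i1 : tcut1 m r 0 = 0.
  rewrite /tcut1 mulr0 add0r dcutoff_lt0 ?mulr0//; lra.
have -> : a 0 = 1 by rewrite aE// i0 addr0 powR1 mulr1.
have -> : 'D_1 a 0 = - nu.
  by rewrite a1E// i0 i1 addr0 !powR1 mul0r !mulr1 sub0r.
rewrite !mulr1 opprK => E.
have El : \int[lebesgue_measure]_(s in `[0, r]) \int[mu]_x
     (`|u s x| `^ p * (tcut m r s * (1 + s) `^ (- nu) * radpow k Y (sqn x))) =
   \int[lebesgue_measure]_(s in `[0, r]) \int[mu]_x
     (`|u s x| `^ p * (a s * radpow k Y (sqn x))).
  apply: eq_Rintegral => s; rewrite inE/= in_itv/= => /andP[s0 _].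
  by apply: eq_Rintegral => x _; rewrite aE.
rewrite El E {El E}.
apply: eq_Rintegral => s; rewrite inE/= in_itv/= => /andP[s0 _].
apply: eq_Rintegral => x _; congr (_ * (_ * _ - _)); last by rewrite aE.
have pw2 : (1 + s) `^ (- nu) / (1 + s) ^+ 2 = (1 + s) `^ (- nu - 2).
  have -> : - nu - 2 = - nu - 1 - 1 by ring.
  by rewrite -!pw// expr2 invfM mulrA.
have -> : 'D_1 a s / (1 + s) = tcut1 m r s * (1 + s) `^ (- nu - 1)
     - nu * (tcut m r s * (1 + s) `^ (- nu - 2)).
  rewrite a1E// mulrBl -mulrA pw// -!mulrA pw//.
  by have -> : - nu - 1 - 1 = - nu - 2 by ring.
rewrite a2E// aE// -[tcut m r s * _ / _]mulrA pw2 /conj_coef; ring.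
Unshelve. all: by end_near. Qed.

End mode_identity.

(** * The truncated self-similar solution *)

Section symbol.
Context {R : realType}.
Variables (n : nat) (mu0 be : R) (m : nat).
Hypotheses (n0 : (0 < n)%N) (mu0_ge0 : 0 <= mu0) (bem : 0 < be + mu0) (be1 : 0 < be + 1).

(** With these coefficients the series of wcoef k |x|^{2k} (1 + t)^{-be-2k} solves
    the conjugate equation. *)
Definition wcoef (k : nat) : R := hyp ((be + mu0) / 2) ((be + 1) / 2) (n%:R / 2) k.

Let a0 : 0 < (be + mu0) / 2. Proof. by rewrite divr_gt0. Qed.
Let b0 : 0 < (be + 1) / 2. Proof. by rewrite divr_gt0. Qed.
Let c0 : 0 < n%:R / 2 :> R. Proof. by rewrite divr_gt0// ltr0n. Qed.

Lemma wcoef_gt0 k : 0 < wcoef k. Proof. exact: hyp_gt0. Qed.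

Lemma wcoef_rec k : wcoef k.+1 * (2 * k.+1%:R * (2 * k%:R + n%:R)) =
  wcoef k * ((be + 2 * k%:R + 1) * (be + 2 * k%:R + mu0)).
Proof.
have := hyp_rec ((be + mu0) / 2) ((be + 1) / 2) c0 k; rewrite -!/(wcoef _) => h.
rewrite (_ : _ * (2 * _ * _) = 4 * (wcoef k.+1 * (k.+1%:R * (k%:R + n%:R / 2)))); last by field.
by rewrite h; field.
Qed.

(** The conjugate operator applied to the mode k, with q = |x|^2. *)
Definition symbol (r : R) (k : nat) (s q : R) : R :=
  conj_coef mu0 m r (be + 2 * k%:R) s * q ^+ k
  - tcut m r s * (1 + s) `^ (- (be + 2 * k%:R)) *
      (2 * k%:R * (2 * k.-1%:R + n%:R) * q ^+ k.-1).

(** The recursion for the coefficients makes the terms without derivatives of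
    the time cutoff telescope; the Laplacian of the mode K + 1 is left over. *)
Lemma symbol_sum r K s q :
  \sum_(k < K.+1) wcoef k * symbol r k s q =
  \sum_(k < K.+1) wcoef k * q ^+ k *
     (tcut2 m r s * (1 + s) `^ (- (be + 2 * k%:R))
      - (2 * (be + 2 * k%:R) + mu0) * tcut1 m r s * (1 + s) `^ (- (be + 2 * k%:R) - 1))
  + tcut m r s * (wcoef K.+1 * (2 * K.+1%:R * (2 * K%:R + n%:R)))
     * q ^+ K * (1 + s) `^ (- (be + 2 * K%:R) - 2).
Proof.
elim: K => [|K IH].
  rewrite !big_ord_recl !big_ord0 wcoef_rec /symbol /conj_coef /= !expr0.
  by ring.
rewrite big_ord_recr/= IH [in RHS]big_ord_recr/= -!addrA; congr (_ + _).
rewrite /symbol /conj_coef (wcoef_rec K.+1) /=.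
have -> : - (be + 2 * K.+1%:R) = - (be + 2 * K%:R) - 2 by rewrite -natr1; ring.
by ring.
Qed.

Let A := (be + mu0) / 2 + (be + 1) / 2 - n%:R / 2 + 1.
Hypothesis A0 : 0 < A.

Lemma wcoef_sum_bound : exists2 C, 0 < C & forall K z, 0 <= z < 1 ->
  \sum_(k < K.+1) k.+1%:R * wcoef k * z ^+ k <= C * (1 - z) `^ (- A).
Proof. exact: hyp_sum_bound. Qed.

Lemma natr_exp_bound (x : R) K : 0 <= x < 1 -> K%:R * x ^+ K <= (1 - x)^-1.
Proof.
move=> /andP[x0 x1]; have y0 : 0 < 1 - x by rewrite subr_gt0.
rewrite -[leRHS]mul1r ler_pdivlMr//.
have h : \sum_(i < K) x ^+ K <= \sum_(i < K) x ^+ i.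
  apply: ler_sum => i _; apply: ler_wiXn2l => //; first exact: ltW.
  exact: ltnW.
rewrite sumr_const card_ord -mulr_natl in h.
apply: (le_trans (ler_wpM2r (ltW y0) h)).
have := subrX1 x K; rewrite -(opprB 1 x) mulNr => h2.
have -> : (\sum_(i < K) x ^+ i) * (1 - x) = 1 - x ^+ K by rewrite mulrC; lra.
by rewrite lerBlDr lerDl exprn_ge0.
Qed.

(** The self-similar variable q / (1 + s)^2 stays inside the disc of convergence,
    by a margin comparable with the relative distance to the light cone. *)
Lemma ratio_le (r s q : R) : 0 <= s -> s <= r -> 0 <= q -> Num.sqrt q <= s + 2^-1 ->
  [/\ 0 <= q / (1 + s) ^+ 2, q / (1 + s) ^+ 2 <= 1 - (2 * (1 + r))^-1,
   q / (1 + s) ^+ 2 < 1 & (1 + s - Num.sqrt q) / (1 + s) <= 1 - q / (1 + s) ^+ 2].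
Proof.
move=> s0 sr q0 qs; set x := Num.sqrt q in qs *.
have x0 : 0 <= x by exact: sqrtr_ge0.
have qE : q = x ^+ 2 by rewrite sqr_sqrtr.
have t0 : 0 < 1 + s by lra.
have t20 : 0 < (1 + s) ^+ 2 by rewrite exprn_gt0.
have h4 : (1 + s - x) / (1 + s) <= 1 - q / (1 + s) ^+ 2.
  rewrite -subr_ge0 qE (_ : _ - _ = x * (1 + s - x) / (1 + s) ^+ 2); last first.
    by field; rewrite gt_eqF.
  by rewrite divr_ge0 ?(ltW t20)// mulr_ge0//; lra.
have h5 : (2 * (1 + r))^-1 <= (1 + s - x) / (1 + s).
  rewrite ler_pdivlMr// ler_pdivrMl; last by rewrite mulr_gt0//; lra.
  nra.
have h6 : 0 < (2 * (1 + r))^-1 by rewrite invr_gt0 mulr_gt0//; lra.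
split => //; [by rewrite divr_ge0// ltW|lra|lra].
Qed.

(** The remainder left by the telescoping is exponentially small in the
    truncation order, uniformly over the truncated cone. *)
Lemma remainder_vanish (r : R) : 0 < r -> exists2 C, 0 <= C & forall K s q,
  0 <= s -> s <= r -> 0 <= q -> Num.sqrt q <= s + 2^-1 ->
  `|tcut m r s * (wcoef K.+1 * (2 * K.+1%:R * (2 * K%:R + n%:R)))
     * q ^+ K * (1 + s) `^ (- (be + 2 * K%:R) - 2)| <= C / K.+1%:R.
Proof.
move=> r0.
pose z0 : R := 1 - (2 * (1 + r))^-1.
have i0 : 0 < (2 * (1 + r))^-1 by rewrite invr_gt0 mulr_gt0//; lra.
have i1 : (2 * (1 + r))^-1 <= 2^-1.
  by rewrite lef_pV2 ?posrE ?mulr_gt0//; lra.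
have z00 : 0 < z0 by rewrite /z0; lra.
have z01 : z0 < 1 by rewrite /z0; lra.
(* of the four factors x^K in z0^K, one controls wcoef and two control the
   powers of K *)
pose x : R := Num.sqrt (Num.sqrt z0).
have x0 : 0 < x by rewrite !sqrtr_gt0.
have x4 : x ^+ 4 = z0.
  by rewrite -[4%N]/(2 * 2)%N exprM !sqr_sqrtr ?ltW// sqrtr_gt0.
have x1 : x < 1.
  by rewrite ltNge; apply/negP => /(exprn_ege1 4); rewrite x4; lra.
have x01 : 0 <= x < 1 by rewrite ltW.
have [C1 C10 C1P] := wcoef_sum_bound.
have P0 : 0 < C1 * (1 - x) `^ (- A) by rewrite mulr_gt0 ?powR_gt0// subr_gt0.
set D1 := C1 * (1 - x) `^ (- A) in P0.
have hw K : K.+2%:R * wcoef K.+1 * x ^+ K.+1 <= D1.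
  apply: le_trans (C1P K.+1 x x01); rewrite big_ord_recr/= lerDr.
  apply: sumr_ge0 => k _; rewrite !mulr_ge0// ?exprn_ge0 ?(ltW x0)//.
  exact: ltW (wcoef_gt0 _).
set D2 := (1 - x)^-1.
have D20 : 0 < D2 by rewrite invr_gt0 subr_gt0.
have hk K : K.+1%:R * x ^+ K.+1 <= D2 by exact: natr_exp_bound.
exists (2 * (n%:R + 2) * D1 * D2 ^+ 2 / x ^+ 3).
  rewrite divr_ge0 ?exprn_ge0 ?(ltW x0)// mulr_ge0 ?exprn_ge0 ?(ltW D20)//.
  by rewrite mulr_ge0 ?(ltW P0)// mulr_ge0// addr_ge0.
move=> K s q s0 sr q0 qs.
have [z1 z2 z3 _] := ratio_le s0 sr q0 qs.
have t1 : 1 <= 1 + s by lra.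
have t0 : 0 < 1 + s by lra.
have -> : (1 + s) `^ (- (be + 2 * K%:R) - 2) = (1 + s) `^ (- be - 2) / (1 + s) ^+ (2 * K).
  have -> : - (be + 2 * K%:R) - 2 = (- be - 2) + - (2 * K)%:R by rewrite natrM; ring.
  by rewrite powRD_gt0// powRN powR_mulrn// ltW.
have p1 : (1 + s) `^ (- be - 2) <= 1.
  by rewrite -[leRHS](powRr0 (1 + s)); apply: ler_powR => //; rewrite -opprD oppr_le0 (le_trans (ltW be1))// lerD2l ler1n.
have p0 : 0 <= (1 + s) `^ (- be - 2) by exact: powR_ge0.
have Kw : 0 <= wcoef K.+1 * (2 * K.+1%:R * (2 * K%:R + n%:R)).
  by rewrite mulr_ge0 ?(ltW (wcoef_gt0 _))// mulr_ge0 ?mulr_ge0// addr_ge0 ?mulr_ge0.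
rewrite (_ : _ * _ = tcut m r s * (1 + s) `^ (- be - 2) *
    ((wcoef K.+1 * (2 * K.+1%:R * (2 * K%:R + n%:R))) * (q / (1 + s) ^+ 2) ^+ K)); last first.
  rewrite exprM expr_div_n; ring.
have zK : 0 <= (q / (1 + s) ^+ 2) ^+ K by rewrite exprn_ge0.
have e0 := tcut_ge0 m r s; have e1 := tcut_le1 m r s.
have EP0 : 0 <= tcut m r s * (1 + s) `^ (- be - 2) by exact: mulr_ge0.
have KZ0 := mulr_ge0 Kw zK.
rewrite ger0_norm; last exact: mulr_ge0.
apply: (@le_trans _ _ (wcoef K.+1 * (2 * K.+1%:R * (2 * K%:R + n%:R)) * z0 ^+ K)).
  rewrite -[leRHS]mul1r; apply: ler_pM => //; first exact: mulr_ile1.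
  by rewrite ler_wpM2l// lerXn2r ?nnegrE// ltW.
have K1 : 0 < K.+1%:R :> R by rewrite ltr0n.
rewrite ler_pdivlMr//.
have zx : z0 ^+ K <= (x ^+ K.+1 * x ^+ K.+1 * x ^+ K.+1) / x ^+ 3.
  rewrite ler_pdivlMr ?exprn_gt0// -x4 -exprM -!exprD.
  apply: ler_wiXn2l; [exact: ltW|exact: ltW|].
  have -> : (4 * K + 3 = K.+1 + K.+1 + K.+1 + K)%N by ring.
  exact: leq_addr.
have xx : 0 <= x ^+ K.+1 by rewrite exprn_ge0// ltW.
have w0 := ltW (wcoef_gt0 K.+1).
have nK : 2 * K%:R + n%:R <= (n%:R + 2) * K.+1%:R :> R.
  have -> : K.+1%:R = K%:R + 1 :> R by rewrite natr1.
  have : 0 <= n%:R * K%:R :> R by exact: mulr_ge0.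
  by have : 0 <= K%:R :> R by []; lra.
have K12 : K.+1%:R <= K.+2%:R :> R by rewrite ler_nat.
apply: (@le_trans _ _ (2 * (n%:R + 2) * ((K.+2%:R * wcoef K.+1 * x ^+ K.+1) *
   (K.+1%:R * x ^+ K.+1) ^+ 2) / x ^+ 3)).
  apply: (@le_trans _ _ (wcoef K.+1 * (2 * K.+2%:R * ((n%:R + 2) * K.+1%:R)) *
     ((x ^+ K.+1 * x ^+ K.+1 * x ^+ K.+1) / x ^+ 3) * K.+1%:R)).
    rewrite ler_pM2r//; apply: ler_pM => //; first by rewrite exprn_ge0// ltW.
    rewrite ler_wpM2l//.
    have b1 : 0 <= 2 * K.+1%:R :> R by exact: mulr_ge0.
    have b2 : 0 <= 2 * K%:R + n%:R :> R by rewrite addr_ge0// mulr_ge0.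
    have b3 : 2 * K.+1%:R <= 2 * K.+2%:R :> R by rewrite ler_pM2l.
    exact: (ler_pM b1 b2 b3 nK).
  by rewrite le_eqVlt; apply/orP; left; apply/eqP; field; rewrite gt_eqF.
rewrite ler_pM2r ?invr_gt0 ?exprn_gt0// -[leRHS]mulrA ler_pM2l; last by rewrite mulr_gt0// ltr_pwDr.
apply: ler_pM; [|by rewrite exprn_ge0// mulr_ge0|exact: hw|].
  by apply: mulr_ge0 => //; apply: mulr_ge0.
by rewrite lerXn2r ?nnegrE ?mulr_ge0 ?(ltW D20).
Qed.

(** After telescoping every term carries a derivative of the time cutoff, hence
    a factor 1/r and the restriction to s >= r/2. What remains is a sum of
    k.+1 * wcoef k * z^k, which is singular at z = 1, that is on the light cone,
    like the power - A of 1 - z. *)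
Lemma symbol_bound (p : R) : 1 < p -> m.+2%:R / p <= m%:R ->
  exists2 C, 0 < C & forall r, 1 <= r -> exists2 C', 0 <= C' & forall K s q,
  0 <= s -> s <= r -> 0 <= q -> Num.sqrt q <= s + 2^-1 ->
  `|\sum_(k < K.+1) wcoef k * symbol r k s q| <=
   C / r * (tcut m r s) `^ p^-1 * (r / 2 <= s)%R%:R *
     (1 + s) `^ (- be - 1 + A) * (1 + s - Num.sqrt q) `^ (- A) + C' / K.+1%:R.
Proof.
move=> p1 mp.
have [Cs Cs0 CsP] := wcoef_sum_bound.
have [Ct Ct0 CtP] := tcut_derivative_bound p1 mp.
pose L := 2 * `|be| + 4 + mu0.
have L0 : 0 < L by rewrite ltr_wpDr// addr_gt0// ltr_wpDl// mulr_ge0.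
have Lk (k : nat) : `|2 * (be + 2 * k%:R) + mu0| <= L * k.+1%:R.
  rewrite ler_norml; apply/andP.
  have hk : 0 <= k%:R :> R by [].
  have := ler_norm be; have := ler_norm (- be); rewrite normrN => h1 h2.
  have h3 : 0 <= `|be| * k%:R by rewrite mulr_ge0.
  have h4 : 0 <= mu0 * k%:R by rewrite mulr_ge0.
  have -> : k.+1%:R = k%:R + 1 :> R by rewrite natr1.
  have h5 := mu0_ge0.
  by rewrite /L; split; lra.
exists (Ct * (2 + L) * Cs); first by rewrite !mulr_gt0// addr_gt0.
move=> r r1; have r0 : 0 < r by lra.
have [C' C'0 C'P] := remainder_vanish r0.
exists C' => // K s q s0 sr q0 qs.
rewrite symbol_sum; apply: le_trans (ler_normD _ _) _; apply: lerD; last exact: C'P.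
have [z1 _ z3 z4] := ratio_le s0 sr q0 qs.
set z := q / (1 + s) ^+ 2 in z1 z3 z4.
have t0 : 0 < 1 + s by lra.
have [T1 T2] := CtP r s r0.
set e := tcut m r s `^ p^-1 in T1 T2 *.
set I := (r / 2 <= s)%R%:R in T1 T2 *.
have e0 : 0 <= e by exact: powR_ge0.
have I0 : 0 <= I :> R by [].
have ir : 0 < r^-1 by rewrite invr_gt0.
set X := Ct / r * e * I in T1 T2.
have X0 : 0 <= X by rewrite !mulr_ge0// ltW.
have T2' : `|tcut2 m r s| * (1 + s) <= 2 * X.
  apply: (@le_trans _ _ (X / r * (2 * r))); last first.
    by rewrite le_eqVlt; apply/orP; left; apply/eqP; field; rewrite gt_eqF.
  apply: ler_pM => //; first exact: ltW.
    apply: le_trans T2 _; rewrite le_eqVlt; apply/orP; left; apply/eqP; rewrite /X.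
    by field; rewrite gt_eqF.
  by lra.
have pw (k : nat) : (1 + s) `^ (- (be + 2 * k%:R)) = (1 + s) `^ (- be - 1) * (1 + s) / (1 + s) ^+ (2 * k).
  have -> : - (be + 2 * k%:R) = (- be - 1) + 1 + - (2 * k)%:R by rewrite natrM; ring.
  rewrite (powRD_gt0 _ (- (2 * k)%:R) t0) (powRD_gt0 (- be - 1) 1 t0).
  by rewrite (powRN _ (2 * k)%:R) powR_mulrn ?powRr1// ltW.
have pw1 (k : nat) : (1 + s) `^ (- (be + 2 * k%:R) - 1) = (1 + s) `^ (- be - 1) / (1 + s) ^+ (2 * k).
  have -> : - (be + 2 * k%:R) - 1 = (- be - 1) + - (2 * k)%:R by rewrite natrM; ring.
  rewrite (powRD_gt0 (- be - 1) (- (2 * k)%:R) t0).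
  by rewrite (powRN _ (2 * k)%:R) powR_mulrn// ltW.
have P0 : 0 <= (1 + s) `^ (- be - 1) by exact: powR_ge0.
apply: (@le_trans _ _ (\sum_(k < K.+1) (2 + L) * X * (1 + s) `^ (- be - 1) *
     (k.+1%:R * wcoef k * z ^+ k))).
  apply: le_trans (ler_norm_sum _ _ _) _; apply: ler_sum => k _.
  have -> : wcoef k * q ^+ k * (tcut2 m r s * (1 + s) `^ (- (be + 2 * k%:R))
      - (2 * (be + 2 * k%:R) + mu0) * tcut1 m r s * (1 + s) `^ (- (be + 2 * k%:R) - 1))
    = (wcoef k * z ^+ k * (1 + s) `^ (- be - 1)) *
       (tcut2 m r s * (1 + s) - (2 * (be + 2 * k%:R) + mu0) * tcut1 m r s).
    by rewrite pw pw1 /z expr_div_n -exprM; ring.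
  have wz : 0 <= wcoef k * z ^+ k * (1 + s) `^ (- be - 1).
    by rewrite !mulr_ge0 ?exprn_ge0// ltW// wcoef_gt0.
  rewrite normrM (ger0_norm wz).
  have -> : (2 + L) * X * (1 + s) `^ (- be - 1) * (k.+1%:R * wcoef k * z ^+ k) =
    (wcoef k * z ^+ k * (1 + s) `^ (- be - 1)) * ((2 + L) * X * k.+1%:R) by ring.
  apply: ler_wpM2l => //; apply: le_trans (ler_normB _ _) _.
  have -> : `|tcut2 m r s * (1 + s)| = `|tcut2 m r s| * (1 + s).
    by rewrite normrM (gtr0_norm t0).
  rewrite [X in _ + X <= _]normrM.
  have h1 : `|2 * (be + 2 * k%:R) + mu0| * `|tcut1 m r s| <= L * k.+1%:R * X.
    by apply: ler_pM.
  have h2 : 2 * X <= 2 * X * k.+1%:R.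
    have k11 : 1 <= k.+1%:R :> R by rewrite ler1n.
    have X2 : 0 <= 2 * X by exact: mulr_ge0.
    by rewrite ler_peMr.
  have -> : (2 + L) * X * k.+1%:R = 2 * X * k.+1%:R + L * k.+1%:R * X by ring.
  exact: (lerD (le_trans T2' h2) h1).
rewrite -mulr_sumr.
have z01 : 0 <= z < 1 by rewrite z1.
have c2X : 0 <= (2 + L) * X * (1 + s) `^ (- be - 1).
  have L2 : 0 <= 2 + L by rewrite addr_ge0// ltW.
  by apply: mulr_ge0 => //; exact: mulr_ge0.
apply: le_trans (ler_wpM2l c2X (CsP K z z01)) _.
have y0 : 0 < 1 + s - Num.sqrt q by lra.
have hA : (1 - z) `^ (- A) <= (1 + s) `^ A * (1 + s - Num.sqrt q) `^ (- A).
  have -> : (1 + s) `^ A * (1 + s - Num.sqrt q) `^ (- A) = ((1 + s - Num.sqrt q) / (1 + s)) `^ (- A).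
    rewrite powRM ?(ltW y0) ?invr_ge0 ?(ltW t0)// mulrC; congr (_ * _).
    by rewrite -[(1 + s)^-1]powR_inv1 ?ltW// -powRrM mulrNN mul1r.
  have ys : 0 < (1 + s - Num.sqrt q) / (1 + s) by rewrite divr_gt0.
  rewrite !powRN lef_pV2 ?posrE ?powR_gt0// ?subr_gt0//.
  by apply: ge0_ler_powR; rewrite ?nnegrE ?(ltW A0) ?(ltW ys)// subr_ge0 ltW.
have -> : Ct * (2 + L) * Cs / r * e * I * (1 + s) `^ (- be - 1 + A) * (1 + s - Num.sqrt q) `^ (- A)
  = (2 + L) * X * (1 + s) `^ (- be - 1) * (Cs * ((1 + s) `^ A * (1 + s - Num.sqrt q) `^ (- A))).
  by rewrite powRD_gt0// /X; ring.
by apply: ler_wpM2l => //; rewrite ler_pM2l.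
Qed.

End symbol.

(** * Restriction of the solution to the cone *)

Section cone_restriction.
Context {R : realType} {n : nat}.
Local Notation X := (measurableTypeR R * 'rV[R]_n)%type.
Local Notation m := (@spacetime R n).

Lemma measurable_slab (T : \bar R) : measurable (slab T : set X).
Proof.
have mI : measurable (time_interval T : set (measurableTypeR R)).
  rewrite /time_interval; case: T => [t||].
  - rewrite (_ : [set _ | _] = `[0, t[%classic); first exact: measurable_itv.
    apply/seteqP; split => s /=; rewrite in_itv/= lte_fin.
      by move=> [-> ->].
    by move=> /andP[].
  - rewrite (_ : [set _ | _] = `[0, +oo[%classic); first exact: measurable_itv.
    apply/seteqP; split => s /=; rewrite in_itv/= ?andbT.
      by move=> [->].
    by move=> ->; rewrite ltry.
  - rewrite (_ : [set _ | _] = set0); first exact: measurable0.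
    by apply/seteqP; split => s //= [].
have mfst : measurable_fun setT (fst : X -> measurableTypeR R) by exact: measurable_fst.
by rewrite -[X in measurable X]setTI; exact: mfst.
Qed.

Lemma measurable_slice (r : R) : measurable ([set z | 0 <= z.1 <= r] : set X).
Proof.
have mfst : measurable_fun setT (fst : X -> measurableTypeR R) by exact: measurable_fst.
rewrite (_ : [set _ | _] = fst @^-1` `[0, r]%classic); last first.
  by apply/seteqP; split => z /=; rewrite in_itv.
by rewrite -[X in measurable X]setTI; exact: mfst.
Qed.

Lemma measurable_fun_cut (A S : set X) (h : X -> R) : measurable A -> measurable S ->
  A `<=` S -> measurable_fun S h -> measurable_fun setT (fun z => \1_A z * h z).
Proof.
move=> mA mS AS mh.
rewrite (_ : (fun z => _) = h \_ A).
  by apply/(measurable_restrictT _ mA); exact: measurable_funS mh.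
apply/funext => z; rewrite patchE indicE; case: ifP; rewrite ?mul1r ?mul0r//.
Qed.

Lemma measurable_time (k : R -> R) : measurable_fun setT k ->
  measurable_fun setT (fun z : X => k z.1).
Proof. by move=> mk; exact: measurableT_comp mk measurable_fst. Qed.

Lemma measurable_space (k : 'rV[R]_n -> R) : measurable_fun setT k ->
  measurable_fun setT (fun z : X => k z.2).
Proof. by move=> mk; exact: measurableT_comp mk measurable_snd. Qed.

Lemma measurable_tpow (nu : R) : measurable_fun setT (fun z : X => (1 + z.1) `^ nu).
Proof.
apply: (@measurable_time (fun s => (1 + s) `^ nu)).
apply: (@measurableT_comp _ _ _ _ _ _ (fun y : R => y `^ nu)).
  exact: measurable_powR.
exact: measurable_funD.
Qed.

Lemma measurable_tcut k (r : R) : measurable_fun setT (fun z : X => tcut k r z.1).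
Proof.
apply: measurable_time; apply: continuous_measurable_fun.
by move=> s; exact: is_derive_continuous (is_derive_tcut k r s).
Qed.

Lemma measurable_tcut1 k (r : R) : measurable_fun setT (fun z : X => tcut1 k r z.1).
Proof.
apply: measurable_time; apply: continuous_measurable_fun.
by move=> s; exact: is_derive_continuous (is_derive_tcut1 k r s).
Qed.

Lemma measurable_tcut2 k (r : R) : measurable_fun setT (fun z : X => tcut2 k r z.1).
Proof.
apply: (@measurable_time (tcut2 k r)).
have maff : measurable_fun setT (fun s : R => 2 / r * s - 1).
  by apply: measurable_funB => //; apply: measurable_funM.
have mc : measurable_fun setT (fun s : R => cutoff (2 / r * s - 1)).
  apply: measurableT_comp maff; apply: continuous_measurable_fun.
  exact: (Ck_continuous (Ck_cutoff 0)).
have mdc : measurable_fun setT (fun s : R => dcutoff (2 / r * s - 1)).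
  by apply: measurableT_comp maff; apply: continuous_measurable_fun; exact: continuous_dcutoff.
have mddc : measurable_fun setT (fun s : R => ddcutoff (2 / r * s - 1)).
  by apply: measurableT_comp maff; apply: continuous_measurable_fun; exact: continuous_ddcutoff.
apply: measurable_funM => //; apply: measurable_funD.
  apply: measurable_funM; last exact: measurable_funX.
  by apply: measurable_funM => //; exact: measurable_funX.
by apply: measurable_funM => //; apply: measurable_funM => //; exact: measurable_funX.
Qed.

Lemma measurable_conj_coef mu0 k (r nu : R) :
  measurable_fun setT (fun z : X => conj_coef mu0 k r nu z.1).
Proof.
apply: measurable_funD; first apply: measurable_funB.
- by apply: measurable_funM; [exact: measurable_tcut2|exact: measurable_tpow].
- by apply: measurable_funM; [apply: measurable_funM => //; exact: measurable_tcut1|exact: measurable_tpow].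
- by apply: measurable_funM; [apply: measurable_funM => //; exact: measurable_tcut|exact: measurable_tpow].
Qed.

Lemma cone_finite (r : R) : 0 <= r -> (m (cone r) < +oo)%E.
Proof.
move=> r0; pose Q := [set x : 'rV[R]_n | forall i : 'I_n,
  `[- (r + 2^-1), r + 2^-1]%classic (x ord0 i)].
have mQ : measurable Q.
  by apply: (@measurable_box R n (fun=> `[- (r + 2^-1), r + 2^-1]%classic)).
have l0 : 0 <= r + 2^-1 by lra.
have volQ : lebesgue_rV R n Q = ((2 * (r + 2^-1)) ^+ n)%:E := lebesgue_rV_cube l0.
apply: (@le_lt_trans _ _ (m (`[0, r]%classic `*` Q))).
  apply: le_measure; rewrite ?inE.
  - exact: measurable_cone.
  - by apply: measurableX.
  - move=> z [/= /andP[z0 zr] zx]; split => /=; first by rewrite in_itv/= z0.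
    move=> i /=; rewrite in_itv/= -ler_norml; apply: le_trans (coord_le_enorm _ i) _.
    by apply: le_trans zx _; rewrite lerD2r.
have E : m (`[0, r]%classic `*` Q) =
    (lebesgue_measure (`[0%R, r]%classic : set R) * lebesgue_rV R n Q)%E.
  exact: product_measure1E.
rewrite E volQ lebesgue_measure_itv/= lte_fin.
by case: ifP => _; rewrite ?mul0e// -EFinB -EFinM ltry.
Qed.

Lemma ae_integrable_transfer (h1 h2 : X -> R) : measurable_fun setT h1 ->
  {ae m, forall z, h1 z = h2 z} -> m.-integrable setT (EFin \o h2) ->
  m.-integrable setT (EFin \o h1) /\ \int[m]_z h1 z = \int[m]_z h2 z.
Proof.
move=> mh1 h12 ih2.
have mh2 : measurable_fun setT h2 by apply/measurable_EFinP; exact: measurable_int ih2.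
have mE1 : measurable_fun setT (EFin \o h1) by exact/measurable_EFinP.
have mE2 : measurable_fun setT (EFin \o h2) by exact/measurable_EFinP.
split; last first.
  congr fine; apply: ae_eq_integral => //.
  by move: h12; apply: filterS => z hz _; rewrite hz.
apply/integrableP; split => //.
case/integrableP: ih2 => _; apply: le_lt_trans.
rewrite le_eqVlt; apply/orP; left; apply/eqP; apply: ae_eq_integral => //.
- exact: measurableT_comp.
- exact: measurableT_comp.
- by move: h12; apply: filterS => z hz _; rewrite /= hz.
Qed.

End cone_restriction.

Section restricted_solution.
Context {R : realType} {n : nat}.
Local Notation X := (measurableTypeR R * 'rV[R]_n)%type.
Local Notation m := (@spacetime R n).
Variables (T : \bar R) (u : R -> 'rV[R]_n -> R) (p Rm : R).
Hypotheses (hLp : Lp_loc T p u)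
  (hsupp : ess_support T u `<=` [set z | enorm z.2 <= z.1 + 2^-1])
  (p1 : 1 < p) (Rm0 : 0 < Rm) (RmT : (Rm%:E < T)%E).

(** The solution restricted to the truncated cone that carries it; it agrees
    with u almost everywhere up to time Rm. *)
Definition vcone (z : X) : R := \1_(cone Rm) z * u z.1 z.2.

Let p0 : 0 < p. Proof. exact: lt_trans p1. Qed.

Let slice_slab : [set z | 0 <= z.1 <= Rm] `<=` (slab T : set X).
Proof.
by move=> z /= /andP[z0 zr]; split => //; apply: le_lt_trans RmT; rewrite lee_fin.
Qed.

Lemma measurable_vcone : measurable_fun setT vcone.
Proof.
apply: (@measurable_fun_cut _ _ _ (slab T) (fun z => u z.1 z.2)).
- exact: measurable_cone.
- exact: measurable_slab.
- by move=> z [h _]; exact: slice_slab.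
- by case: hLp.
Qed.

Lemma measurable_slice_fun (r : R) : r <= Rm ->
  measurable_fun setT (fun z : X => (0 <= z.1 <= r)%R%:R * u z.1 z.2).
Proof.
move=> rRm.
have -> : (fun z : X => (0 <= z.1 <= r)%R%:R * u z.1 z.2) =
   (fun z => \1_([set z : X | 0 <= z.1 <= r]) z * u z.1 z.2).
  apply/funext => z; rewrite indicE; congr ((nat_of_bool _)%:R * _).
  by apply/idP/idP; rewrite inE.
apply: (@measurable_fun_cut _ _ _ (slab T) (fun z => u z.1 z.2)).
- exact: measurable_slice.
- exact: measurable_slab.
- move=> z /= /andP[h1 h2]; apply: slice_slab => /=.
  by rewrite h1 (le_trans h2).
- by case: hLp.
Qed.

Lemma vcone_eq0 z : ~ cone Rm z -> vcone z = 0.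
Proof. by move=> h; rewrite /vcone indicE memNset// mul0r. Qed.

Lemma vcone_ae : {ae m, forall z, 0 <= z.1 <= Rm -> u z.1 z.2 = vcone z}.
Proof.
have := ess_support_negligible T u; apply: negligibleS => z /= h.
have [zr uv] : 0 <= z.1 <= Rm /\ u z.1 z.2 <> vcone z.
  by apply: contrapT => h'; apply: h => zr; apply: contrapT => uv; apply: h'.
split; first exact: slice_slab.
have nc : ~ cone Rm z.
  by move=> zc; apply: uv; rewrite /vcone indicE mem_set// mul1r.
split; first by move=> /hsupp zx; apply: nc; split.
by apply/eqP => u0; apply: uv; rewrite vcone_eq0.
Qed.

Lemma vcone_Lp : m.-integrable setT (EFin \o (fun z => `|vcone z| `^ p)).
Proof.
have mvp : measurable_fun setT (fun z => `|vcone z| `^ p).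
  apply: (@measurableT_comp _ _ _ _ _ _ (fun y : R => y `^ p)).
    exact: measurable_powR.
  by apply: measurableT_comp => //; exact: measurable_vcone.
apply/integrableP; split; first exact/measurable_EFinP.
pose K : set (R * 'rV[R]_n) := `[0, Rm]%classic `*` [set x | sqn x <= (Rm + 2^-1) ^+ 2].
have cK : compact K.
  by apply: compact_setX; [exact: segment_compact|exact: compact_sqn_le].
have KT : K `<=` slab T.
  by move=> z [/= h _]; apply: slice_slab => /=; rewrite in_itv in h.
have mK : measurable (K : set X).
  apply: measurableX => //; rewrite -[X in measurable X]setTI.
  by apply: (measurable_sqn measurableT (measurable_itv `]-oo, (Rm + 2^-1) ^+ 2])).
have [mu_ hK] := hLp; have := hK K cK KT; apply: le_lt_trans.
rewrite [leRHS]integral_mkcond; apply: ge0_le_integral => //.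
- by apply: measurableT_comp => //; exact/measurable_EFinP.
- apply/(measurable_restrictT _ mK); apply/measurable_EFinP.
  apply: (@measurableT_comp _ _ _ _ _ _ (fun y : R => y `^ p)).
    exact: measurable_powR.
  apply: measurableT_comp => //; apply: measurable_funS mu_; last exact: KT.
  exact: measurable_slab.
- move=> z _; rewrite patchE /= ger0_norm ?powR_ge0//.
  have [zc|zc] := pselect (cone Rm z); last first.
    rewrite vcone_eq0// normr0 powR0 ?gt_eqF//.
    by case: ifP => // _; rewrite lee_fin powR_ge0.
  have zK : z \in K.
    rewrite inE; case: zc => /andP[z0 zr] zx; split => /=.
      by rewrite in_itv/= z0.
    rewrite -enorm_sqr lerXn2r ?nnegrE ?enorm_ge0//.
      by rewrite addr_ge0// ltW.
    by apply: le_trans zx _; rewrite lerD2r.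
  by rewrite zK /vcone indicE mem_set// mul1r.
Qed.

Lemma cone_integrable : m.-integrable setT (EFin \o \1_(cone Rm)).
Proof.
apply/integrableP; split.
  by apply/measurable_EFinP; apply: measurable_indic; exact: measurable_cone.
under eq_integral do rewrite /= ger0_norm//.
rewrite integral_indic ?setIT//; last exact: measurable_cone.
exact: cone_finite (ltW Rm0).
Qed.

(** The right-hand side is integrable, since the cone has finite measure. *)
Lemma vcone_le z : `|vcone z| <= \1_(cone Rm) z + `|vcone z| `^ p.
Proof.
have [zc|zc] := pselect (cone Rm z); last first.
  by rewrite vcone_eq0// normr0 addr_ge0// powR_ge0.
rewrite indicE mem_set//=; have [h|h] := leP `|vcone z| 1.
  by rewrite (le_trans h)// lerDl powR_ge0.
apply: ler_wpDl => //; apply: le1r_powR; exact: ltW.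
Qed.

Lemma vcone_integrable : m.-integrable setT (EFin \o vcone).
Proof.
have i := integrableD measurableT cone_integrable vcone_Lp.
apply: le_integrable i => //.
  by apply/measurable_EFinP; exact: measurable_vcone.
move=> z _ /=; rewrite lee_fin; apply: le_trans (vcone_le z) _.
exact: ler_norm.
Qed.

Lemma integrable_bounded (w h : X -> R) (M : R) :
  m.-integrable setT (EFin \o w) -> measurable_fun setT h ->
  (forall z, ~ cone Rm z -> w z = 0) -> (forall z, cone Rm z -> `|h z| <= M) ->
  m.-integrable setT (EFin \o (fun z => w z * h z)).
Proof.
move=> iw mh w0 hM.
have i := integrableZl measurableT M iw; apply: le_integrable i => //.
  apply/measurable_EFinP; apply: measurable_funM => //.
  by apply/measurable_EFinP; exact: measurable_int iw.
move=> z _ /=; rewrite lee_fin; have [zc|/w0 ->] := pselect (cone Rm z).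
  rewrite !normrM mulrC; apply: ler_wpM2r => //.
  by rewrite (le_trans (hM z zc))// ler_norm.
by rewrite mul0r mulr0 normr0.
Qed.

End restricted_solution.

(** * The tested inequality for the truncated sum *)

Section truncated_inequality.
Context {R : realType} {n : nat}.
Local Notation X := (measurableTypeR R * 'rV[R]_n)%type.
Local Notation m := (@spacetime R n).
Let mu := lebesgue_rV R n.
Variables (T : \bar R) (u ut : R -> 'rV[R]_n -> R)
  (Du : R -> 'I_n -> 'rV[R]_n -> R) (mu0 p eps : R) (f g : 'rV[R]_n -> R).
Hypotheses (hH : forall t, time_interval T t -> in_H1 (u t) (Du t))
  (hC : C1_L2 T u ut) (hu0 : {ae mu, forall x, u 0 x = eps * f x})
  (hw : weak_form T mu0 p eps g u ut Du)
  (hLp : Lp_loc T p u)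
  (hsupp : ess_support T u `<=` [set z | enorm z.2 <= z.1 + 2^-1])
  (hf : f \in Lfun mu 2%:E) (hg : g \in Lfun mu 2%:E)
  (f0 : forall x, 0 <= f x) (g0 : forall x, 0 <= g x)
  (fsupp : forall x, f x != 0 -> enorm x < 2^-1)
  (gsupp : forall x, g x != 0 -> enorm x < 2^-1)
  (eps0 : 0 <= eps) (p1 : 1 < p).
Variables (Rm : R) (Rm0 : 0 < Rm) (RmT : (Rm%:E < T)%E).
Variables (be : R) (mm : nat).
Hypotheses (n0 : (0 < n)%N) (bem : 0 < be + mu0) (be1 : 0 < be + 1).
Variables (r : R) (r1 : 1 <= r) (rRm : r <= Rm).

Local Notation v := (vcone u Rm).
(* the spatial cutoffs beyond Y are inactive on the cone *)
Let Y : R := (Rm + 1) ^+ 2.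
Let r0 : 0 < r. Proof. exact: lt_le_trans r1. Qed.
Let rT : (r%:E < T)%E. Proof. by apply: le_lt_trans RmT; rewrite lee_fin. Qed.
Let ind (z : X) : R := (0 <= z.1 <= r)%R%:R.

Let cone_sqn (z : X) : cone Rm z -> sqn z.2 < Y.
Proof.
move=> [/andP[z0 zr] zx]; rewrite -enorm_sqr /Y.
have h := enorm_ge0 z.2; have hR := Rm0.
rewrite ltrXn2r ?nnegrE//; lra.
Qed.

Let measurable_ind : measurable_fun setT ind.
Proof.
have -> : ind = \1_([set z : X | 0 <= z.1 <= r]).
  apply/funext => z; rewrite indicE; congr ((nat_of_bool _)%:R).
  by apply/idP/idP; rewrite inE.
by apply: measurable_indic; exact: measurable_slice.
Qed.

Let measurable_sqn2 : measurable_fun setT (fun z : X => sqn z.2).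
Proof. exact: measurable_space measurable_sqn. Qed.

Lemma measurable_rad (h : R -> R) : continuous h ->
  measurable_fun setT (fun z : X => h (sqn z.2)).
Proof. by move=> ch; apply: measurableT_comp measurable_sqn2; exact: continuous_measurable_fun. Qed.

Lemma measurable_symbol k :
  measurable_fun setT (fun z : X => symbol n mu0 be mm r k z.1 (sqn z.2)).
Proof.
apply: measurable_funB.
  by apply: measurable_funM; [exact: measurable_conj_coef|exact: measurable_funX].
apply: measurable_funM; last by apply: measurable_funM => //; exact: measurable_funX.
by apply: measurable_funM; [exact: measurable_tcut|exact: measurable_tpow].
Qed.

Let continuous_tpow (nu s : R) : 0 <= s -> {for s, continuous (fun s : R => (1 + s) `^ nu)}.
Proof.
move=> s0; have sp : 0 < 1 + s by lra.
apply: (@continuous_comp _ _ _ (fun s : R => 1 + s) (fun y : R => y `^ nu)).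
  by apply: cvgD; [exact: cvg_cst|exact: cvg_id].
exact: is_derive_continuous (is_derive1_powR nu sp).
Qed.

Let bounded_time (h : R -> R) : (forall s, 0 <= s -> {for s, continuous h}) ->
  exists M, forall s, 0 <= s <= Rm -> `|h s| <= M.
Proof.
move=> ch; have cw : {within `[0, Rm], continuous (fun s => `|h s|)}.
  apply: continuous_in_subspaceT => s; rewrite inE/= in_itv/= => /andP[s0 _].
  by apply: (@continuous_comp _ _ _ h (fun y => `|y|)); [exact: ch|exact: norm_continuous].
have [c _ cP] := EVT_max (ltW Rm0) cw.
by exists `|h c| => s sR; apply: cP; rewrite in_itv.
Qed.

Lemma symbol_bounded k : exists M, forall z : X, cone Rm z ->
  `|symbol n mu0 be mm r k z.1 (sqn z.2)| <= M.
Proof.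
have cE j : forall s : R, {for s, continuous (tcut j r)}.
  by move=> s; exact: is_derive_continuous (is_derive_tcut j r s).
have cE1 j : forall s : R, {for s, continuous (tcut1 j r)}.
  by move=> s; exact: is_derive_continuous (is_derive_tcut1 j r s).
have cE2 j : forall s : R, {for s, continuous (tcut2 j r)}.
  move=> s; have -> : tcut2 j r = 'D_1 ('D_1 (tcut j r)).
    have -> : 'D_1 (tcut j r) = tcut1 j r.
      by apply/funext => x; have [_ ->] := is_derive_tcut j r x.
    by apply/funext => x; have [_ ->] := is_derive_tcut1 j r x.
  exact: (Ck_continuous (Ck_derive (1 : R) (Ck_derive (1 : R) (Ck_tcut 2 j r)))).
have [M1 M1P] : exists M, forall s, 0 <= s <= Rm -> `|conj_coef mu0 mm r (be + 2 * k%:R) s| <= M.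
  apply: bounded_time => s s0; apply: cvgD; first apply: cvgB.
  - by apply: cvgM; [exact: cE2|exact: continuous_tpow].
  - by apply: cvgM; [apply: cvgM; [exact: cvg_cst|exact: cE1]|exact: continuous_tpow].
  - by apply: cvgM; [apply: cvgM; [exact: cvg_cst|exact: cE]|exact: continuous_tpow].
have [M2 M2P] : exists M, forall s, 0 <= s <= Rm ->
    `|tcut mm r s * (1 + s) `^ (- (be + 2 * k%:R))| <= M.
  by apply: bounded_time => s s0; apply: cvgM; [exact: cE|exact: continuous_tpow].
exists (M1 * Y ^+ k + M2 * `|2 * k%:R * (2 * k.-1%:R + n%:R)| * Y ^+ k.-1) => z zc.
have zY := ltW (cone_sqn zc); have q0 := sqn_ge0 z.2.
have Y0 : 0 <= Y by rewrite sqr_ge0.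
case: zc => zr _.
apply: le_trans (ler_normB _ _) _; apply: lerD.
  rewrite normrM normrX (ger0_norm q0); apply: ler_pM => //; first by rewrite exprn_ge0.
    exact: M1P.
  by rewrite lerXn2r ?nnegrE.
rewrite normrM [X in _ * X <= _]normrM normrX (ger0_norm q0) mulrA.
apply: ler_pM => //; [by rewrite exprn_ge0| |by rewrite lerXn2r ?nnegrE].
by apply: ler_wpM2r => //; exact: M2P.
Qed.

Let measurable_iu : measurable_fun setT (fun z : X => ind z * u z.1 z.2).
Proof. exact: (measurable_slice_fun hLp RmT rRm). Qed.

Let vE := vcone_ae hsupp RmT.
Let iv := vcone_integrable hLp p1 Rm0 RmT.
Let ivp := vcone_Lp hLp p1 Rm0 RmT.

Let ind_Rm z : ind z != 0 -> 0 <= z.1 <= Rm.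
Proof.
rewrite /ind; case: (boolP (0 <= z.1 <= r)); last by rewrite eqxx.
by move=> /andP[-> /le_trans h] _; rewrite h.
Qed.

Lemma cone_symbol_integrable k : m.-integrable setT
  (EFin \o (fun z => v z * (ind z * symbol n mu0 be mm r k z.1 (sqn z.2)))).
Proof.
have [M MP] := symbol_bounded k.
apply: (@integrable_bounded _ _ Rm v _ M) => //.
- by apply: measurable_funM => //; exact: measurable_symbol.
- by move=> z; exact: vcone_eq0.
- move=> z zc; apply: le_trans (MP z zc); rewrite normrM ler_piMl//.
  by rewrite /ind; case: (_ && _); rewrite ?normr1 ?normr0.
Qed.

(** On the cone the spatial cutoff is inactive and off the cone the solution
    vanishes, so that the cutoff disappears. *)
Lemma mode_rhs k :
  \int[lebesgue_measure]_(s in `[0, r]) \int[mu]_x (u s x *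
     (conj_coef mu0 mm r (be + 2 * k%:R) s * radpow k Y (sqn x)
      - tcut mm r s * (1 + s) `^ (- (be + 2 * k%:R)) *
          (4 * sqn x * radpow2 k Y (sqn x) + 2 * n%:R * radpow1 k Y (sqn x))))
  = \int[m]_z (v z * (ind z * symbol n mu0 be mm r k z.1 (sqn z.2))).
Proof.
pose F s x := u s x *
     (conj_coef mu0 mm r (be + 2 * k%:R) s * radpow k Y (sqn x)
      - tcut mm r s * (1 + s) `^ (- (be + 2 * k%:R)) *
          (4 * sqn x * radpow2 k Y (sqn x) + 2 * n%:R * radpow1 k Y (sqn x))).
have mF : measurable_fun setT (fun z : X => ind z * F z.1 z.2).
  rewrite /F; under eq_fun do rewrite mulrA.
  apply: measurable_funM => //; apply: measurable_funB.
    apply: measurable_funM; first exact: measurable_conj_coef.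
    by apply: measurable_rad; exact: continuous_rad.
  apply: measurable_funM.
    by apply: measurable_funM; [exact: measurable_tcut|exact: measurable_tpow].
  apply: measurable_funD.
    apply: measurable_funM; last by apply: measurable_rad; exact: continuous_rad2.
    exact: measurable_funM.
  by apply: measurable_funM => //; apply: measurable_rad; exact: continuous_rad1.
have FE : {ae m, forall z, ind z * F z.1 z.2 =
    v z * (ind z * symbol n mu0 be mm r k z.1 (sqn z.2))}.
  apply: negligibleS vE => z; apply: contra_not => /= hz.
  have [i0|/ind_Rm/hz uv] := eqVneq (ind z) 0; first by rewrite i0 !mul0r mulr0.
  rewrite /F uv mulrCA; have [zc|zc] := pselect (cone Rm z); last first.
    by rewrite vcone_eq0// !mul0r.
  have qY := cone_sqn zc; congr (_ * (_ * _)).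
  by rewrite /symbol radE ?(ltW qY)// laplace_rad.
have [iF <-] := ae_integrable_transfer mF FE (cone_symbol_integrable k).
exact: (Rintegral_Fubini_slice (F := F)).
Qed.

Let weight_bounded : exists M, forall z : X, cone Rm z ->
  `|tcut mm r z.1 * (1 + z.1) `^ (- be)| <= M.
Proof.
have [M MP] : exists M, forall s, 0 <= s <= Rm -> `|tcut mm r s * (1 + s) `^ (- be)| <= M.
  apply: bounded_time => s s0; apply: cvgM; last exact: continuous_tpow.
  exact: is_derive_continuous (is_derive_tcut mm r s).
by exists M => z [zr _]; exact: MP.
Qed.

Lemma cone_weight_integrable : m.-integrable setT
  (EFin \o (fun z => `|v z| `^ p * (tcut mm r z.1 * (1 + z.1) `^ (- be)))).
Proof.
have [M MP] := weight_bounded.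
apply: (@integrable_bounded _ _ Rm (fun z => `|v z| `^ p) _ M) => //.
  by apply: measurable_funM; [exact: measurable_tcut|exact: measurable_tpow].
by move=> z zc; rewrite vcone_eq0// normr0 powR0// gt_eqF// (lt_trans _ p1).
Qed.

Lemma mode_lhs0 :
  \int[lebesgue_measure]_(s in `[0, r]) \int[mu]_x
     (`|u s x| `^ p * (tcut mm r s * (1 + s) `^ (- be) * radpow 0 Y (sqn x)))
  = \int[m]_z (`|v z| `^ p * (tcut mm r z.1 * (1 + z.1) `^ (- be))).
Proof.
have p0 : 0 < p by exact: lt_trans p1.
pose F s x := `|u s x| `^ p * (tcut mm r s * (1 + s) `^ (- be) * radpow 0 Y (sqn x)).
have mF : measurable_fun setT (fun z : X => ind z * F z.1 z.2).
  have -> : (fun z : X => ind z * F z.1 z.2) = (fun z : X => `|ind z * u z.1 z.2| `^ p *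
     (tcut mm r z.1 * (1 + z.1) `^ (- be) * radpow 0 Y (sqn z.2))).
    apply/funext => z; rewrite /F mulrA; congr (_ * _).
    rewrite /ind; case: (_ && _); first by rewrite !mul1r.
    by rewrite !mul0r normr0 powR0// gt_eqF.
  apply: measurable_funM.
    apply: (@measurableT_comp _ _ _ _ _ _ (fun y : R => y `^ p)).
      exact: measurable_powR.
    exact: measurableT_comp.
  apply: measurable_funM; last by apply: measurable_rad; exact: continuous_rad.
  by apply: measurable_funM; [exact: measurable_tcut|exact: measurable_tpow].
have FE : {ae m, forall z, ind z * F z.1 z.2 =
    `|v z| `^ p * (tcut mm r z.1 * (1 + z.1) `^ (- be))}.
  apply: negligibleS vE => z; apply: contra_not => /= hz.
  have [i0|i0] := eqVneq (ind z) 0.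
    rewrite i0 mul0r; have [[/andP[z0 _] _]|zc] := pselect (cone Rm z); last first.
      by rewrite vcone_eq0// normr0 powR0 ?mul0r// gt_eqF.
    have rz : r <= z.1.
      rewrite leNgt; apply/negP => zr; move/eqP: i0; rewrite /ind z0 (ltW zr)/=.
      by apply/negP; exact: oner_neq0.
    by rewrite tcut_0// mul0r mulr0.
  have uv := hz (ind_Rm i0).
  have -> : ind z = 1 by move: i0; rewrite /ind; case: (_ && _) => //; rewrite eqxx.
  rewrite mul1r /F uv; have [zc|zc] := pselect (cone Rm z); last first.
    by rewrite vcone_eq0// normr0 powR0 ?mul0r// gt_eqF.
  by rewrite radE ?(ltW (cone_sqn zc))// expr0 mulr1.
have [iF <-] := ae_integrable_transfer mF FE cone_weight_integrable.
exact: (Rintegral_Fubini_slice (F := F)).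
Qed.

Let rad0_data (h : 'rV[R]_n -> R) : (forall x, h x != 0 -> enorm x < 2^-1) ->
  \int[mu]_x (h x * radpow 0 Y (sqn x)) = \int[mu]_x h x.
Proof.
move=> hs; apply: eq_Rintegral => x _; have [->|hx] := eqVneq (h x) 0; first by rewrite mul0r.
rewrite radE ?expr0 ?mulr1// -enorm_sqr /Y.
have h1 := hs x hx; have h2 := enorm_ge0 x; have h3 := Rm0.
rewrite lerXn2r ?nnegrE//; lra.
Qed.

(** The modes are added with the positive coefficients wcoef. On the side of the
    nonlinearity and of the data every mode contributes a nonnegative amount, and
    the mode k = 0 alone is kept. *)
Lemma summed_identity K :
  \int[m]_z (`|v z| `^ p * (tcut mm r z.1 * (1 + z.1) `^ (- be)))
  + eps * (\int[mu]_x g x + (mu0 + be) * \int[mu]_x f x)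
  <= \int[m]_z (v z * (ind z *
       \sum_(k < K.+1) wcoef n mu0 be k * symbol n mu0 be mm r k z.1 (sqn z.2))).
Proof.
have wg k : 0 <= wcoef n mu0 be k by exact: ltW (wcoef_gt0 _ _ _ _).
have E k := @mode_identity R n T u ut Du mu0 p eps f g hH hC hu0 hw hf hg mm r Y
  (be + 2 * k%:R) k r0 rT.
have [_ ES] := @Rintegral_sum R _ X m setT _ (index_enum 'I_K.+1)
  (fun k z => wcoef n mu0 be k * (v z * (ind z * symbol n mu0 be mm r k z.1 (sqn z.2))))
  measurableT (fun k => ltac:(by have := integrableZl measurableT (wcoef n mu0 be k)
     (cone_symbol_integrable k); apply: eq_integrable)).
have -> : \int[m]_z (v z * (ind z *
       \sum_(k < K.+1) wcoef n mu0 be k * symbol n mu0 be mm r k z.1 (sqn z.2))) =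
   \sum_(k < K.+1) wcoef n mu0 be k *
     \int[m]_z (v z * (ind z * symbol n mu0 be mm r k z.1 (sqn z.2))).
  transitivity (\int[m]_z (\sum_(k < K.+1) wcoef n mu0 be k *
       (v z * (ind z * symbol n mu0 be mm r k z.1 (sqn z.2))))).
    by apply: eq_Rintegral => z _; rewrite !mulr_sumr; apply: eq_bigr => k _; ring.
  rewrite ES; apply: eq_bigr => k _; rewrite RintegralZl//.
  exact: cone_symbol_integrable.
under eq_bigr do rewrite -mode_rhs -E.
rewrite big_ord_recl [X in _ <= X + _]/= mulr0 !addr0 mode_lhs0 !rad0_data//.
rewrite mul1r -[leLHS]addr0; apply: lerD.
  by rewrite le_eqVlt; apply/orP; left; apply/eqP; ring.
apply: sumr_ge0 => k _; apply: mulr_ge0 => //.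
have rp j x : 0 <= radpow j Y (@sqn R n x) by rewrite rad_ge0// sqn_ge0.
apply: addr_ge0; first apply: addr_ge0.
- apply: Rintegral_ge0 => s _; apply: Rintegral_ge0 => x _.
  by apply: mulr_ge0; [exact: powR_ge0|rewrite mulr_ge0// mulr_ge0 ?tcut_ge0 ?powR_ge0].
- by apply: mulr_ge0 => //; apply: Rintegral_ge0 => x _; apply: mulr_ge0.
- apply: mulr_ge0; last by apply: Rintegral_ge0 => x _; apply: mulr_ge0.
  apply: mulr_ge0 => //; rewrite addrA addr_ge0 ?mulr_ge0//.
  by rewrite addrC ltW.
Qed.

End truncated_inequality.

(** * Hoelder estimate of the linear side *)

Lemma boolr_powR {R : realType} (b : bool) (s : R) : 0 < s -> b%:R `^ s = b%:R :> R.
Proof.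
move=> s0; case: b; first by rewrite [true%:R]/(1 : R) powR1.
by rewrite [false%:R]/(0 : R) powR0// gt_eqF.
Qed.

Section estimates.
Context {R : realType} {n : nat}.
Local Notation X := (measurableTypeR R * 'rV[R]_n)%type.
Local Notation m := (@spacetime R n).
Let mu := lebesgue_rV R n.
Variables (T : \bar R) (u : R -> 'rV[R]_n -> R) (p : R).
Hypotheses (hLp : Lp_loc T p u) (p1 : 1 < p).
Variables (Rm : R) (Rm0 : 0 < Rm) (RmT : (Rm%:E < T)%E).
Variables (mm : nat) (r : R) (r1 : 1 <= r).
Variables (e1 A C : R).
Hypotheses (A0 : 0 < A) (C0 : 0 < C).

Local Notation v := (vcone u Rm).
Let iv := vcone_integrable hLp p1 Rm0 RmT.
Let ivp := vcone_Lp hLp p1 Rm0 RmT.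
Let mv := measurable_vcone hLp RmT.

Definition late (z : X) : R := (r / 2 <= z.1)%R%:R.

Lemma measurable_late : measurable_fun setT late.
Proof.
have -> : late = \1_([set z : X | r / 2 <= z.1]).
  apply/funext => z; rewrite indicE; congr ((nat_of_bool _)%:R).
  by apply/idP/idP; rewrite inE.
apply: measurable_indic.
have mfst : measurable_fun setT (fst : X -> measurableTypeR R) by exact: measurable_fst.
rewrite (_ : [set _ | _] = fst @^-1` `[r / 2, +oo[%classic); last first.
  by apply/seteqP; split => z /=; rewrite in_itv/= andbT.
by rewrite -[X in measurable X]setTI; exact: mfst.
Qed.

Lemma late_ge0 z : 0 <= late z. Proof. exact: ler0n. Qed.

Lemma late_le1 z : late z <= 1.
Proof. by rewrite /late; case: (r / 2 <= z.1); rewrite ?lexx ?ler01. Qed.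

Lemma tpow_le (M nu s : R) : 0 <= s <= M -> (1 + s) `^ nu <= (1 + M) `^ `|nu|.
Proof.
move=> /andP[s0 sM]; apply: (@le_trans _ _ ((1 + s) `^ `|nu|)).
  by apply: ler_powR; [lra|exact: ler_norm].
by apply: ge0_ler_powR; rewrite ?nnegrE//; lra.
Qed.

(** The bound for the symbol that is left when the truncation order is infinite. *)
Definition weight (z : X) : R :=
  C / r * (tcut mm r z.1) `^ p^-1 * late z *
     (1 + z.1) `^ e1 * (1 + z.1 - enorm z.2) `^ (- A) * \1_(cone r) z.

Let p0 : 0 < p. Proof. exact: lt_trans p1. Qed.
Let r0 : 0 < r. Proof. exact: lt_le_trans r1. Qed.

Lemma cone_gap s (z : X) : cone s z -> 2^-1 <= 1 + z.1 - enorm z.2.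
Proof. by move=> [_ h]; lra. Qed.

Lemma gap_pow_le s (z : X) : cone s z -> (1 + z.1 - enorm z.2) `^ (- A) <= 2^-1 `^ (- A).
Proof.
move=> /cone_gap h; have h0 : 0 < 1 + z.1 - enorm z.2 by lra.
rewrite !powRN lef_pV2 ?posrE ?powR_gt0//.
by apply: ge0_ler_powR; rewrite ?nnegrE ?(ltW A0) ?(ltW h0).
Qed.

Lemma measurable_gap (nu : R) : measurable_fun setT (fun z : X => (1 + z.1 - enorm z.2) `^ nu).
Proof.
apply: (@measurableT_comp _ _ _ _ _ _ (fun y : R => y `^ nu)).
  exact: measurable_powR.
apply: measurable_funB; first by apply: measurable_funD.
by apply: measurableT_comp; [exact: measurable_enorm|exact: measurable_snd].
Qed.

Lemma measurable_tcutp : measurable_fun setT (fun z : X => (tcut mm r z.1) `^ p^-1).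
Proof.
apply: (@measurableT_comp _ _ _ _ _ _ (fun y : R => y `^ p^-1)).
  exact: measurable_powR.
exact: measurable_tcut.
Qed.

Lemma measurable_weight : measurable_fun setT weight.
Proof.
apply: measurable_funM; last by apply: measurable_indic; exact: measurable_cone.
apply: measurable_funM; last exact: measurable_gap.
apply: measurable_funM; last exact: measurable_tpow.
apply: measurable_funM; last exact: measurable_late.
by apply: measurable_funM => //; exact: measurable_tcutp.
Qed.

Lemma tcutp_le1 s : (tcut mm r s) `^ p^-1 <= 1.
Proof.
apply: (@le_trans _ _ (1 `^ p^-1)); last by rewrite powR1.
apply: ge0_ler_powR; rewrite ?nnegrE ?tcut_ge0 ?tcut_le1//.
by rewrite invr_ge0 ltW.
Qed.

Lemma weight_ge0 z : 0 <= weight z.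
Proof.
have Cr : 0 <= C / r by rewrite divr_ge0// ltW.
by do 5 (apply: mulr_ge0; rewrite ?powR_ge0 ?late_ge0//).
Qed.

Lemma weight_le z : cone Rm z -> `|weight z| <= C / r * (1 + Rm) `^ `|e1| * 2^-1 `^ (- A).
Proof.
move=> zc; rewrite ger0_norm ?weight_ge0//.
have Cr : 0 <= C / r by rewrite divr_ge0// ltW.
have B0 : 0 <= C / r * (1 + Rm) `^ `|e1| by rewrite mulr_ge0// powR_ge0.
rewrite /weight; apply: (@le_trans _ _ (C / r * (tcut mm r z.1) `^ p^-1 * late z *
     (1 + z.1) `^ e1 * (1 + z.1 - enorm z.2) `^ (- A) * 1)).
  apply: ler_wpM2l; last by rewrite indicE; case: (_ \in _).
  by do 4 (apply: mulr_ge0; rewrite ?powR_ge0 ?late_ge0//).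
rewrite mulr1; apply: ler_pM; rewrite ?powR_ge0//.
- by do 3 (apply: mulr_ge0; rewrite ?powR_ge0 ?late_ge0//).
- apply: ler_pM; rewrite ?powR_ge0//.
  + by do 2 (apply: mulr_ge0; rewrite ?powR_ge0 ?late_ge0//).
  + rewrite -mulrA ler_piMr// mulr_ile1 ?powR_ge0 ?late_ge0 ?tcutp_le1 ?late_le1//.
  + by case: zc => zr _; exact: tpow_le.
- exact: gap_pow_le zc.
Qed.

Lemma abs_vcone_integrable : m.-integrable setT (EFin \o (fun z => `|v z|)).
Proof. by have := integrable_abse iv; apply: eq_integrable. Qed.

Lemma vcone_weight_integrable : m.-integrable setT (EFin \o (fun z => `|v z| * weight z)).
Proof.
apply: (integrable_bounded (Rm := Rm) abs_vcone_integrable measurable_weight).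
- by move=> z zc; rewrite vcone_eq0// normr0.
- by move=> z zc; exact: weight_le.
Qed.

Section Hoelder.
Variables (be0 q B : R) (Phi : R -> R).
Hypotheses (q0 : 0 < q) (pq : p^-1 + q^-1 = 1) (BE : B = A * q)
  (dPhi : forall y : R, 0 < y -> is_derive y 1 Phi (y `^ (- B))).
Let e0 : R := e1 + be0 / p.

(** The part of the weighted integral of |u|^p that belongs to the time window
    where the cutoff varies. *)
Definition window : R :=
  \int[m]_z (`|v z| `^ p * (tcut mm r z.1 * (1 + z.1) `^ (- be0) * late z)).

Let F1 z := `|v z| * ((tcut mm r z.1) `^ p^-1 * (1 + z.1) `^ (- be0 / p) * late z).
Let F2 (z : X) := \1_(cone r) z * (1 + z.1 - enorm z.2) `^ (- A).

Let F1_ge0 z : 0 <= F1 z.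
Proof. by rewrite !mulr_ge0 ?powR_ge0 ?late_ge0. Qed.

Let F2_ge0 z : 0 <= F2 z.
Proof. by rewrite mulr_ge0// powR_ge0. Qed.

Let F12_ge0 z : 0 <= F1 z * F2 z.
Proof. exact: mulr_ge0 (F1_ge0 z) (F2_ge0 z). Qed.

Let mF1 : measurable_fun setT F1.
Proof.
apply: measurable_funM; first exact: measurableT_comp.
apply: measurable_funM; last exact: measurable_late.
by apply: measurable_funM; [exact: measurable_tcutp|exact: measurable_tpow].
Qed.

Let mF2 : measurable_fun setT F2.
Proof.
apply: measurable_funM; last exact: measurable_gap.
by apply: measurable_indic; exact: measurable_cone.
Qed.

Lemma window_weight_ge0 z : 0 <= tcut mm r z.1 * (1 + z.1) `^ (- be0) * late z.
Proof. exact: (mulr_ge0 (mulr_ge0 (tcut_ge0 _ _ _) (powR_ge0 _ _)) (late_ge0 _)). Qed.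

Lemma window_integrable : m.-integrable setT
  (EFin \o (fun z => `|v z| `^ p * (tcut mm r z.1 * (1 + z.1) `^ (- be0) * late z))).
Proof.
apply: (@integrable_bounded _ _ Rm _ _ ((1 + Rm) `^ `|- be0|) ivp).
- apply: measurable_funM; last exact: measurable_late.
  by apply: measurable_funM; [exact: measurable_tcut|exact: measurable_tpow].
- by move=> z zc; rewrite vcone_eq0// normr0 powR0// gt_eqF.
- move=> z [zr _]; rewrite ger0_norm ?window_weight_ge0//.
  rewrite mulrAC -[leRHS]mul1r; apply: ler_pM; rewrite ?powR_ge0//.
  + exact: mulr_ge0 (tcut_ge0 _ _ _) (late_ge0 _).
  + by apply: mulr_ile1; [exact: tcut_ge0|exact: late_ge0|exact: tcut_le1|exact: late_le1].
  + exact: tpow_le.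
Qed.

Lemma window_ge0 : 0 <= window.
Proof.
by apply: Rintegral_ge0 => z _; apply: mulr_ge0; [exact: powR_ge0|exact: window_weight_ge0].
Qed.

Let F1p z : `|F1 z| `^ p = `|v z| `^ p * (tcut mm r z.1 * (1 + z.1) `^ (- be0) * late z).
Proof.
rewrite ger0_norm// /F1; set a := _ `^ p^-1; set b := _ `^ (- be0 / p).
have a0 : 0 <= a by exact: powR_ge0.
have b0 : 0 <= b by exact: powR_ge0.
have ab0 : 0 <= a * b by exact: mulr_ge0.
have -> : (`|v z| * (a * b * late z)) `^ p = `|v z| `^ p * (a `^ p * b `^ p * late z `^ p).
  rewrite powRM//; last exact: mulr_ge0 ab0 (late_ge0 z).
  by rewrite (powRM _ ab0 (late_ge0 z)) (powRM _ a0 b0).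
rewrite /a /b -!powRrM mulVf ?gt_eqF// powRr1 ?tcut_ge0// divfK ?gt_eqF//.
by rewrite [late z `^ p]boolr_powR.
Qed.

Let F2q z : `|F2 z| `^ q = \1_(cone r) z * (1 + z.1 - enorm z.2) `^ (- B).
Proof.
rewrite ger0_norm// /F2 powRM ?powR_ge0// -powRrM mulNr -BE; congr (_ * _).
by rewrite indicE boolr_powR.
Qed.

Let V : R := (2 * r + 1) ^+ n * (Phi (r + 1) - Phi 2^-1).

Let V0 : 0 <= V.
Proof.
have := @cone_weight_integral R n B r Phi r0 dPhi; rewrite -lee_fin; apply: le_trans.
by apply: integral_ge0 => z _; rewrite lee_fin mulr_ge0// powR_ge0.
Qed.

Let hoelder12 : (\int[m]_z (F1 z * F2 z)%:E <= (window `^ p^-1 * V `^ q^-1)%:E)%E.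
Proof.
have := @hoelder _ _ _ m F1 F2 p q mF1 mF2 p0 q0 pq.
rewrite Lnorm1.
under eq_integral do rewrite /= (ger0_norm (F12_ge0 _)).
move=> h; apply: (le_trans h); rewrite EFinM; apply: lee_pmul; rewrite ?Lnorm_ge0//.
  rewrite unlock /= -poweR_EFin; apply: gt0_ler_poweR.
  - by rewrite invr_ge0 ltW.
  - by rewrite in_itv/= leey andbT integral_ge0// => z _; exact: poweR_ge0.
  - by rewrite in_itv/= leey andbT lee_fin window_ge0.
  - under eq_integral do rewrite /= F1p.
    rewrite /window /Rintegral fineK//.
    exact: integrable_fin_num window_integrable.
rewrite unlock /= -poweR_EFin; apply: gt0_ler_poweR.
- by rewrite invr_ge0 ltW.
- by rewrite in_itv/= leey andbT integral_ge0// => z _; exact: poweR_ge0.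
- by rewrite in_itv/= leey andbT lee_fin.
- under eq_integral do rewrite /= F2q.
  exact: cone_weight_integral.
Qed.

Let F12_integrable : m.-integrable setT (EFin \o (fun z => F1 z * F2 z)).
Proof.
apply/integrableP; split; first by apply/measurable_EFinP; exact: measurable_funM.
under eq_integral do rewrite /= (ger0_norm (F12_ge0 _)).
by apply: le_lt_trans hoelder12 _; rewrite ltry.
Qed.

Let window_pow (s : R) : r / 2 <= s -> s <= r -> (1 + s) `^ e0 <= 2 `^ `|e0| * r `^ e0.
Proof.
move=> h1 h2; have r1' := r1; have r0' := r0; have sp : 0 < 1 + s by lra.
have [e00|e00] := leP 0 e0.
  rewrite ger0_norm// -powRM ?(ltW r0')//; apply: ge0_ler_powR; rewrite ?nnegrE//; lra.
rewrite ltr0_norm// -[X in _ `^ X <= _]opprK -[X in _ * r `^ X]opprK.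
have ne : 0 <= - e0 by lra.
rewrite [(1 + s) `^ _]powRN [r `^ _]powRN -ler_pdivrMl ?powR_gt0//.
rewrite -invfM lef_pV2 ?posrE ?mulr_gt0 ?powR_gt0// -powRM ?(ltW sp)//.
by apply: ge0_ler_powR; rewrite ?nnegrE//; lra.
Qed.

(** The root of the cutoff that bounds its derivatives recovers the cutoff itself
    when it is raised to the power p together with |v|; the other factor is the
    singular weight on the cone. On the window 1 + s is comparable with r, which
    trades the powers of 1 + s for powers of r. *)
Lemma hoelder_estimate :
  \int[m]_z (`|v z| * weight z) <=
  C * 2 `^ `|e0| * r `^ (e0 - 1) * (window `^ p^-1 * V `^ q^-1).
Proof.
set K0 := C * 2 `^ `|e0| * r `^ (e0 - 1).
have K00 : 0 <= K0 by rewrite !mulr_ge0 ?powR_ge0// ltW.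
have iK : m.-integrable setT (EFin \o (fun z => K0 * (F1 z * F2 z))).
  by have := integrableZl measurableT K0 F12_integrable; apply: eq_integrable.
apply: (@le_trans _ _ (\int[m]_z (K0 * (F1 z * F2 z)))).
  apply: le_Rintegral => //; first exact: vcone_weight_integrable.
  move=> z _; have [zc|zc] := pselect (cone r z); last first.
    by rewrite /weight /F2 indicE memNset// !(mulr0,mul0r).
  rewrite /weight /F2 /F1 indicE mem_set// mulr1 mul1r.
  have [hz|hz] := leP (r / 2) z.1; last first.
    have -> : late z = 0 by rewrite /late [(r / 2 <= z.1)%R]leNgt hz.
    by rewrite !(mulr0,mul0r).
  case: zc => /andP[z0 zr] zx; have tp : 0 < 1 + z.1 by lra.
  have -> : e1 = e0 + (- be0 / p) by rewrite /e0 mulNr addrK.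
  rewrite powRD_gt0// /late hz !mulr1.
  set E := tcut mm r z.1 `^ p^-1; set P := (1 + z.1) `^ (- be0 / p).
  set G := (1 + z.1 - enorm z.2) `^ (- A); set P0 := (1 + z.1) `^ e0.
  have h := window_pow hz zr; rewrite -/P0 in h.
  have -> : `|v z| * (C / r * E * (P0 * P) * G) = (C / r * (`|v z| * E * P * G)) * P0 by ring.
  have -> : K0 * (`|v z| * (E * P) * G) =
     (C / r * (`|v z| * E * P * G)) * (2 `^ `|e0| * r `^ e0).
    by rewrite /K0 powRD_gt0// powRN powRr1 ?(ltW r0)//; ring.
  by apply: ler_wpM2l => //; rewrite !mulr_ge0 ?powR_ge0 ?invr_ge0// ltW.
rewrite RintegralZl//; apply: ler_wpM2l => //.
rewrite -lee_fin /Rintegral fineK//.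
exact: integrable_fin_num F12_integrable.
Qed.

End Hoelder.
End estimates.

(** * The estimate at one time scale *)

Section test_estimate.
Context {R : realType} {n : nat}.
Local Notation X := (measurableTypeR R * 'rV[R]_n)%type.
Local Notation m := (@spacetime R n).
Let mu := lebesgue_rV R n.
Variables (T : \bar R) (u ut : R -> 'rV[R]_n -> R)
  (Du : R -> 'I_n -> 'rV[R]_n -> R) (mu0 p eps : R) (f g : 'rV[R]_n -> R).
Hypotheses (hH : forall t, time_interval T t -> in_H1 (u t) (Du t))
  (hC : C1_L2 T u ut) (hu0 : {ae mu, forall x, u 0 x = eps * f x})
  (hw : weak_form T mu0 p eps g u ut Du)
  (hLp : Lp_loc T p u)
  (hsupp : ess_support T u `<=` [set z | enorm z.2 <= z.1 + 2^-1])
  (hf : f \in Lfun mu 2%:E) (hg : g \in Lfun mu 2%:E)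
  (f0 : forall x, 0 <= f x) (g0 : forall x, 0 <= g x)
  (fsupp : forall x, f x != 0 -> enorm x < 2^-1)
  (gsupp : forall x, g x != 0 -> enorm x < 2^-1)
  (eps0 : 0 <= eps) (p1 : 1 < p).
Variables (Rm : R) (Rm0 : 0 < Rm) (RmT : (Rm%:E < T)%E).
Variables (be : R) (mm : nat).
Hypotheses (n0 : (0 < n)%N) (bem : 0 < be + mu0) (be1 : 0 < be + 1).
Variables (r : R) (r1 : 1 <= r) (rRm : r <= Rm).
Variables (A C : R) (A0 : 0 < A) (C0 : 0 < C).
Hypothesis symb : exists2 C', 0 <= C' &
  forall K s q, 0 <= s -> s <= r -> 0 <= q -> Num.sqrt q <= s + 2^-1 ->
    `|\sum_(k < K.+1) wcoef n mu0 be k * symbol n mu0 be mm r k s q|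
    <= C / r * (tcut mm r s) `^ p^-1 * (r / 2 <= s)%R%:R *
         (1 + s) `^ (- be - 1 + A) * (1 + s - Num.sqrt q) `^ (- A) + C' / K.+1%:R.

Local Notation v := (vcone u Rm).
Local Notation wt := (weight p mm r (- be - 1 + A) A C).
Let lhs : R := \int[m]_z (`|v z| `^ p * (tcut mm r z.1 * (1 + z.1) `^ (- be)))
  + eps * (\int[mu]_x g x + (mu0 + be) * \int[mu]_x f x).
Let iv := vcone_integrable hLp p1 Rm0 RmT.

(** As v is integrable, the remainder of the truncated symbol contributes nothing
    when the truncation order tends to infinity. *)
Lemma linear_estimate : lhs <= \int[m]_z (`|v z| * wt z).
Proof.
have [C' C'0 hsym] := symb.
have iav := abs_vcone_integrable hLp p1 Rm0 RmT.
have iw := vcone_weight_integrable hLp p1 Rm0 RmT mm r1 (- be - 1 + A) A0 C0.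
pose I := \int[m]_z `|v z|.
have I0 : 0 <= I by apply: Rintegral_ge0.
have wt0 (z : X) : 0 <= wt z by exact: weight_ge0.
have step K : lhs <= \int[m]_z (`|v z| * wt z) + C' / K.+1%:R * I.
  have h := @summed_identity R n T u ut Du mu0 p eps f g hH hC hu0 hw hLp hsupp hf hg
    f0 g0 fsupp gsupp eps0 p1 Rm Rm0 RmT be mm n0 bem be1 r r1 rRm K.
  apply: (le_trans h) => {h}.
  have c0 : 0 <= C' / K.+1%:R by exact: divr_ge0.
  have iz : m.-integrable setT (EFin \o (fun z => C' / K.+1%:R * `|v z|)).
    by have := integrableZl measurableT (C' / K.+1%:R) iav; apply: eq_integrable.
  have [isum _] := @Rintegral_sum R _ X m setT _ (index_enum 'I_K.+1)
    (fun k z => wcoef n mu0 be k *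
       (v z * ((0 <= z.1 <= r)%R%:R * symbol n mu0 be mm r k z.1 (sqn z.2))))
    measurableT (fun k => ltac:(by have := integrableZl measurableT (wcoef n mu0 be k)
       (cone_symbol_integrable mu0 hLp p1 Rm0 RmT be mm r k); apply: eq_integrable)).
  have -> : C' / K.+1%:R * I = \int[m]_z (C' / K.+1%:R * `|v z|) by rewrite RintegralZl.
  rewrite -RintegralD//; apply: le_Rintegral => //.
  - move: isum; apply: eq_integrable => // z _ /=; congr (_%:E).
    by rewrite !mulr_sumr; apply: eq_bigr => k _; ring.
  - by have := integrableD measurableT iw iz; apply: eq_integrable.
  - move=> z _; have [[/andP[z0 zR] zx]|zc] := pselect (cone Rm z); last first.
      by rewrite vcone_eq0// normr0 !(mul0r, mulr0) addr0.
    have -> : `|v z| * wt z + C' / K.+1%:R * `|v z| = `|v z| * (wt z + C' / K.+1%:R) by ring.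
    rewrite z0 /=; case: (boolP (z.1 <= r)) => [zr|_]; last first.
      rewrite mul0r mulr0; apply: mulr_ge0 => //.
      by apply: addr_ge0; [exact: wt0|].
    rewrite mul1r; apply: (le_trans (ler_norm _)); rewrite normrM.
    apply: ler_wpM2l => //; apply: (le_trans (hsym K _ _ z0 zr (sqn_ge0 _) zx)).
    rewrite /weight /late indicE mem_set ?mulr1//.
    by split => //; apply/andP.
apply/ler_addgt0Pr => e e_gt0.
have CI : 0 < C' * I + 1 by rewrite ltr_wpDl ?mulr_ge0.
have [K hK] : exists K : nat, 0 + K.+1%:R^-1 < e / (C' * I + 1).
  by apply: ltr_add_invr; rewrite divr_gt0.
apply: (le_trans (step K)); rewrite lerD2l.
move: hK; rewrite add0r ltr_pdivlMr// => /ltW; apply: le_trans.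
by rewrite -mulrA [_^-1 * I]mulrC mulrA [leRHS]mulrC ler_wpM2r ?invr_ge0// lerDl.
Qed.

(** The condition on the exponents says that the powers of r cancel, the volume
    of the cone contributing r^{n/q}. *)
Lemma scale_estimate (be0 q B : R) (Phi : R -> R) : 0 < q -> p^-1 + q^-1 = 1 ->
  B = A * q -> (forall y : R, 0 < y -> is_derive y 1 Phi (y `^ (- B))) ->
  - be - 1 + A + be0 / p - 1 + n%:R / q = 0 ->
  lhs <= C * 2 `^ `|- be - 1 + A + be0 / p| * 3 `^ (n%:R / q) *
    (window u p Rm mm r be0 `^ p^-1 * (Phi (r + 1) - Phi 2^-1) `^ q^-1).
Proof.
move=> q0 pq BE dPhi eE; apply: (le_trans linear_estimate).
have r0 : 0 < r by exact: lt_le_trans r1.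
apply: (le_trans (hoelder_estimate hLp p1 Rm0 RmT mm r1 _ A0 C0 be0 q0 pq BE dPhi)).
set e0 := _ + be0 / p; set W := window _ _ _ _ _ _ `^ _; set D := Phi _ - _.
have b0 : 0 < (2 * r + 1) ^+ n by rewrite exprn_gt0// addr_gt0// mulr_gt0.
have D0 : 0 <= D.
  rewrite -(pmulr_rge0 _ b0).
  have := @cone_weight_integral R n B r Phi r0 dPhi; rewrite -lee_fin; apply: le_trans.
  by apply: integral_ge0 => z _; rewrite lee_fin mulr_ge0// powR_ge0.
rewrite (powRM _ (ltW b0) D0).
rewrite -!mulrA; apply: ler_wpM2l; first exact: ltW.
apply: ler_wpM2l; first exact: powR_ge0.
have W0 : 0 <= W * D `^ q^-1 by rewrite mulr_ge0 ?powR_ge0.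
have -> : r `^ (e0 - 1) * (W * (((2 * r + 1) ^+ n) `^ q^-1 * D `^ q^-1)) =
  (r `^ (e0 - 1) * ((2 * r + 1) ^+ n) `^ q^-1) * (W * D `^ q^-1) by ring.
apply: ler_wpM2r => //.
have -> : e0 - 1 = - (n%:R / q) by apply/eqP; rewrite -addr_eq0; apply/eqP.
rewrite powRN ler_pdivrMl ?powR_gt0// -powRM ?(ltW r0)//.
rewrite -powR_mulrn ?addr_ge0 ?mulr_ge0 ?(ltW r0)// -powRrM.
apply: ge0_ler_powR; rewrite ?nnegrE.
- by rewrite divr_ge0// ltW.
- by have h := r0; lra.
- by have h := r0; lra.
- by have h := r1; lra.
Qed.

End test_estimate.

(** * Dyadic time scales *)

Lemma powR_inv_le {R : realType} (p K y D : R) : 0 < p -> 0 < K -> 0 <= y -> 0 <= D ->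
  y <= K * D `^ p^-1 -> K `^ (- p) * y `^ p <= D.
Proof.
move=> p0 K0 y0 D0 h; rewrite powRN ler_pdivrMl ?powR_gt0//.
have -> : K `^ p * D = (K * D `^ p^-1) `^ p.
  by rewrite powRM ?powR_ge0 ?(ltW K0)// -powRrM mulVf ?gt_eqF// powRr1.
apply: ge0_ler_powR; rewrite ?nnegrE//; first exact: ltW.
by rewrite mulr_ge0 ?powR_ge0// ltW.
Qed.

Section dyadic.
Context {R : realType} {n : nat}.
Local Notation X := (measurableTypeR R * 'rV[R]_n)%type.
Local Notation m := (@spacetime R n).
Let mu := lebesgue_rV R n.

Definition bulk (u : R -> 'rV[R]_n -> R) (p Rm : R) (mm : nat) (be r : R) : R :=
  \int[m]_z (`|vcone u Rm z| `^ p * (tcut mm r z.1 * (1 + z.1) `^ (- be))).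

Lemma bulk_ge0 u p Rm mm be r : 0 <= bulk u p Rm mm be r.
Proof.
apply: Rintegral_ge0 => z _; apply: mulr_ge0; first exact: powR_ge0.
exact: mulr_ge0 (tcut_ge0 _ _ _) (powR_ge0 _ _).
Qed.

(** The cutoff at scale r / 2 vanishes before the window at scale r begins. *)
Lemma bulk_window (T : \bar R) (u : R -> 'rV[R]_n -> R) (p Rm : R) (mm : nat) (be r : R) :
  Lp_loc T p u -> 1 < p -> 0 < Rm -> (Rm%:E < T)%E -> 0 < r ->
  bulk u p Rm mm be (r / 2) + window u p Rm mm r be <= bulk u p Rm mm be r.
Proof.
move=> hLp p1 Rm0 RmT r0.
have i1 := cone_weight_integrable hLp p1 Rm0 RmT be mm (r / 2).
have i2 := window_integrable hLp p1 Rm0 RmT mm r be.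
have i3 := cone_weight_integrable hLp p1 Rm0 RmT be mm r.
rewrite /bulk /window; have ES := RintegralD measurableT i1 i2.
rewrite -ES; apply: le_Rintegral => //.
  by have := integrableD measurableT i1 i2; apply: eq_integrable.
move=> z _; rewrite -mulrDr; apply: ler_wpM2l; first exact: powR_ge0.
rewrite /late; have [hz|hz] := leP (r / 2) z.1.
  by rewrite [tcut _ (r / 2) _]tcut_0 ?divr_gt0// mul0r add0r [true%:R]/(1 : R) mulr1.
rewrite [false%:R]/(0 : R) mulr0 addr0 (tcut_1 mm r0 (ltW hz)) mul1r.
by apply: ler_piMl; [exact: powR_ge0|exact: tcut_le1].
Qed.

Variables (mu0 p be : R) (mm : nat).
Hypotheses (n0 : (0 < n)%N) (mu0_ge0 : 0 <= mu0) (p1 : 1 < p)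
  (bem : 0 < be + mu0) (be1 : 0 < be + 1) (mmp : mm.+2%:R / p <= mm%:R)
  (beE : be = (n%:R - 1 - mu0) / 2 - p^-1)
  (crit : - be * (1 - p^-1) - p^-1 - 1 + n%:R * (1 - p^-1) = 0).

(** The scale estimate is used for two decay exponents. For be the singular weight
    has exponent 1 and integrates to a logarithm of r, which is of order j for
    r = 2^j: this is the second bound. For be + 1 the integral of the weight is
    bounded, and the contribution of the data alone gives the first bound. *)
Lemma dyadic_estimate : exists2 c : R, 0 < c &
  forall (eps : R) (f g : 'rV[R]_n -> R) (T : \bar R) (u : R -> 'rV[R]_n -> R),
  0 <= eps ->
  f \in Lfun mu 2%:E -> g \in Lfun mu 2%:E ->
  (forall x, 0 <= f x) -> (forall x, 0 <= g x) ->
  (forall x, f x != 0 -> enorm x < 2^-1) ->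
  (forall x, g x != 0 -> enorm x < 2^-1) ->
  supported_solution mu0 p eps f g T u ->
  forall Rm, (Rm%:E < T)%E -> forall j, 2 ^+ j.+1 <= Rm ->
  let b i := bulk u p Rm mm be (2 ^+ i) in
  c * (eps * (\int[mu]_x g x + (mu0 + be) * \int[mu]_x f x)) `^ p <= b j.+1 - b j /\
  c * b j.+1 `^ p * j.+1%:R `^ (1 - p) <= b j.+1 - b j.
Proof.
have p0 : 0 < p by exact: lt_trans p1.
have ip1 : p^-1 < 1 by rewrite invf_lt1.
pose q := (1 - p^-1)^-1.
have q0 : 0 < q by rewrite invr_gt0 subr_gt0.
have pq : p^-1 + q^-1 = 1 by rewrite invrK addrC subrK.
have A0E : (be + mu0) / 2 + (be + 1) / 2 - n%:R / 2 + 1 = 1 - p^-1 by rewrite beE; field; rewrite gt_eqF.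
have A1E : (be + 1 + mu0) / 2 + (be + 1 + 1) / 2 - n%:R / 2 + 1 = 2 - p^-1.
  by rewrite beE; field; rewrite gt_eqF.
have A0p : 0 < 1 - p^-1 by rewrite subr_gt0.
have A1p : 0 < 2 - p^-1 by lra.
have hbe1 := be1; have hbem := bem.
have bem' : 0 < be + 1 + mu0 by lra.
have be1' : 0 < be + 1 + 1 by lra.
have [C0 C0p sym0] := symbol_bound n0 mu0_ge0 bem be1 (ltac:(by rewrite A0E)) p1 mmp.
have [C1 C1p sym1] := symbol_bound n0 mu0_ge0 bem' be1' (ltac:(by rewrite A1E)) p1 mmp.
rewrite A0E in sym0; rewrite A1E in sym1.
pose e0 (de : R) := - (be + de) - 1 + (1 + de - p^-1) + be / p.
pose M0 := C0 * 2 `^ `|- be - 1 + (1 - p^-1) + be / p| * 3 `^ (n%:R / q).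
pose M1 := C1 * 2 `^ `|- (be + 1) - 1 + (2 - p^-1) + be / p| * 3 `^ (n%:R / q).
have M0p : 0 < M0 by rewrite !mulr_gt0 ?powR_gt0.
have M1p : 0 < M1 by rewrite !mulr_gt0 ?powR_gt0.
pose c0 := M0 `^ (- p) * 3 `^ (1 - p).
pose c1 := (M1 * (2 `^ q / q) `^ q^-1) `^ (- p).
have c0p : 0 < c0 by rewrite mulr_gt0 ?powR_gt0.
have c1p : 0 < c1 by rewrite powR_gt0// mulr_gt0 ?powR_gt0// divr_gt0 ?powR_gt0.
exists (Num.min c0 c1); first by rewrite lt_min c0p.
move=> eps f g T u eps0 hf hg f0 g0 fs gs [[ut [Du [[hH _] hC hLp [hu0 _] hw]]] hsupp].
move=> Rm RmT j jRm b.
have r0 : (0 : R) < 2 ^+ j.+1 by exact: exprn_gt0.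
have r1 : (1 : R) <= 2 ^+ j.+1 by apply: exprn_ege1; rewrite ler1n.
have Rm0 : 0 < Rm by exact: lt_le_trans jRm.
set D := window u p Rm mm (2 ^+ j.+1) be.
have D0 : 0 <= D by exact: window_ge0.
have bD : D <= b j.+1 - b j.
  rewrite lerBrDl; have := bulk_window mm be hLp p1 Rm0 RmT r0.
  by rewrite {1}exprSr mulfK// pnatr_eq0.
have If : 0 <= \int[mu]_x f x by exact: Rintegral_ge0.
have Ig : 0 <= \int[mu]_x g x by exact: Rintegral_ge0.
split; apply: le_trans bD.
  have P1 : forall y : R, 0 < y -> is_derive y 1 (fun y : R => - q^-1 * y `^ (- q)) (y `^ (- (1 + q))).
    move=> y y0; have h := is_derive1_powR (- q) y0.
    have h2 := @is_deriveZ R R R (fun y : R => y `^ (- q)) (- q^-1) y 1 _ h.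
    apply: is_derive_eq h2 _; rewrite /GRing.scale/= mulrA mulrNN mulVf ?gt_eqF// mul1r.
    by congr (_ `^ _); ring.
  have BE : 1 + q = (2 - p^-1) * q.
    have h : (1 - p^-1) * q = 1 by rewrite mulrC mulVf// gt_eqF.
    by rewrite -{1}h; ring.
  have cr : - (be + 1) - 1 + (2 - p^-1) + be / p - 1 + n%:R / q = 0.
    by rewrite -crit /q invrK; ring.
  have [C' C'0 hs] := sym1 _ r1.
  have h := @scale_estimate R n T u ut Du mu0 p eps f g hH hC hu0 hw hLp hsupp hf hg
    f0 g0 fs gs eps0 p1 Rm Rm0 RmT (be + 1) mm n0 bem' be1' _ r1 jRm
    (2 - p^-1) C1 A1p C1p (ex_intro2 _ _ C' C'0 hs) be q (1 + q) _ q0 pq BE P1 cr.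
  rewrite -/D -/M1 in h; set lhs1 := (X in X <= _) in h.
  apply: (@le_trans _ _ (c1 * (eps * (\int[mu]_x g x + (mu0 + be) * \int[mu]_x f x)) `^ p)).
    by apply: ler_wpM2r; rewrite ?powR_ge0// ge_min lexx orbT.
  have mub : 0 <= mu0 + be by lra.
  apply: powR_inv_le => //.
  - by rewrite mulr_gt0 ?powR_gt0// divr_gt0 ?powR_gt0.
  - by rewrite mulr_ge0// addr_ge0// mulr_ge0.
  - rewrite -mulrA [_ * D `^ _]mulrC; apply: le_trans (_ : _ <= lhs1) _.
      rewrite /lhs1 -[leLHS]add0r; apply: lerD; first exact: bulk_ge0.
      apply: ler_wpM2l => //; rewrite lerD2l; apply: ler_wpM2r => //; lra.
    apply: (le_trans h); apply: ler_wpM2l; first exact: ltW.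
    apply: ler_wpM2l; first exact: powR_ge0.
    have two : 2^-1 `^ (- q) = 2 `^ q :> R.
      by rewrite -(@powR_inv1 _ 2)// -powRrM mulNr mul1r opprK.
    have x0 : 0 < (2 ^+ j.+1 + 1 : R) `^ (- q) by rewrite powR_gt0// addr_gt0.
    have x1 : (2 ^+ j.+1 + 1 : R) `^ (- q) <= 1.
      rewrite powRN invf_le1 ?powR_gt0 ?addr_gt0//.
      have a1 : 1 <= 2 ^+ j.+1 + 1 :> R by rewrite lerDr ltW.
      by have := ler_powR a1 (ltW q0); rewrite powRr0.
    have y1 : 1 <= 2 `^ q :> R.
      have a1 : 1 <= 2 :> R by rewrite ler1n.
      by have := ler_powR a1 (ltW q0); rewrite powRr0.
    have -> : - q^-1 * (2 ^+ j.+1 + 1) `^ (- q) - - q^-1 * 2^-1 `^ (- q) =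
      (2 `^ q - (2 ^+ j.+1 + 1) `^ (- q)) / q by rewrite two; ring.
    apply: ge0_ler_powR; rewrite ?nnegrE.
    + by rewrite invr_ge0 ltW.
    + by apply: divr_ge0; [lra|exact: ltW].
    + by apply: divr_ge0; [lra|exact: ltW].
    + by apply: ler_wpM2r; [rewrite invr_ge0 ltW|lra].
have P0 : forall y : R, 0 < y -> is_derive y 1 (@ln R) (y `^ (- 1)).
  by move=> y y0; rewrite powR_inv1 ?(ltW y0)//; exact: is_derive1_ln.
have BE : 1 = (1 - p^-1) * q by rewrite mulfV// gt_eqF.
have cr : - be - 1 + (1 - p^-1) + be / p - 1 + n%:R / q = 0.
  by rewrite -crit /q invrK; ring.
have [C' C'0 hs] := sym0 _ r1.
have h := @scale_estimate R n T u ut Du mu0 p eps f g hH hC hu0 hw hLp hsupp hf hg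
    f0 g0 fs gs eps0 p1 Rm Rm0 RmT be mm n0 bem be1 _ r1 jRm
    (1 - p^-1) C0 A0p C0p (ex_intro2 _ _ C' C'0 hs) be q 1 _ q0 pq BE P0 cr.
rewrite -/D -/M0 in h; set lhs0 := (X in X <= _) in h.
have hb : b j.+1 <= lhs0 by rewrite lerDl mulr_ge0// addr_ge0// mulr_ge0// addrC ltW.
have j0 : 0 < j.+1%:R :> R by [].
have lE : ln (2 ^+ j.+1 + 1) - ln 2^-1 = ln ((2 ^+ j.+1 + 1) * 2) :> R.
  by rewrite lnM ?posrE ?addr_gt0// lnV ?posrE// opprK.
have l0 : 0 <= ln (2 ^+ j.+1 + 1) - ln 2^-1 :> R.
  by rewrite lE; apply: ln_ge0; lra.
have hl : ln (2 ^+ j.+1 + 1) - ln 2^-1 <= 3 * j.+1%:R :> R.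
  rewrite lE; apply: (@le_trans _ _ (ln (2 ^+ (j + 3)))).
    rewrite ler_ln ?posrE ?exprn_gt0 ?mulr_gt0 ?addr_gt0//.
    have -> : 2 ^+ (j + 3) = 2 ^+ j.+1 * 4 :> R by rewrite exprD (exprSr _ j); ring.
    by lra.
  rewrite lnXn//; have l2 : ln 2 <= 1 :> R by have := @le_ln1Dx R 1; rewrite -natr1 => ->//; lra.
  rewrite -[leLHS]mulr_natl; apply: (@le_trans _ _ ((j + 3)%:R * 1)); first exact: ler_wpM2l.
  by rewrite mulr1 -natrM ler_nat mulnS addnC leq_add2l -{1}[j]mul1n leq_mul2r orbT.
have hK : b j.+1 <= M0 * (3 * j.+1%:R) `^ q^-1 * D `^ p^-1.
  apply: (le_trans hb); apply: (le_trans h); rewrite -mulrA; apply: ler_wpM2l; first exact: ltW.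
  rewrite mulrC; apply: ler_wpM2r; first exact: powR_ge0.
  by apply: ge0_ler_powR; rewrite ?nnegrE ?mulr_ge0// invr_ge0 ltW.
have K0 : 0 < M0 * (3 * j.+1%:R) `^ q^-1 by rewrite mulr_gt0 ?powR_gt0// mulr_gt0.
apply: le_trans (powR_inv_le p0 K0 (bulk_ge0 _ _ _ _ _ _) D0 hK).
have -> : (M0 * (3 * j.+1%:R) `^ q^-1) `^ (- p) = c0 * j.+1%:R `^ (1 - p).
  rewrite (powRM _ (ltW M0p) (powR_ge0 _ _)) -powRrM.
  have -> : q^-1 * - p = 1 - p by rewrite invrK; field; rewrite gt_eqF.
  by rewrite (powRM _ _ (ltW j0))// /c0 mulrA.
rewrite mulrAC; apply: ler_wpM2r; first exact: powR_ge0.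
by apply: ler_wpM2r; [exact: powR_ge0|rewrite ge_min lexx].
Qed.

End dyadic.

(** * Positive data and the Strauss exponent *)

Section positivity.
Context {R : realType} {n : nat}.
Let mu := lebesgue_rV R n.

Lemma lebesgue_rV_ball (c : 'rV[R]_n) (e : R) : 0 < e ->
  mu (ball c e) = ((e *+ 2) ^+ n)%:E.
Proof.
move=> e0; rewrite rV_ball_box//.
rewrite (@lebesgue_rV_box R n (fun i => ball (c ord0 i) e)); last first.
  by move=> i; exact: measurable_ball.
under eq_bigr do rewrite lebesgue_measure_ball ?(ltW e0)//.
by rewrite prodEFin prodr_const card_ord.
Qed.

Lemma Rintegral_gt0 (h : 'rV[R]_n -> R) (x0 : 'rV[R]_n) : continuous h ->
  mu.-integrable setT (EFin \o h) -> (forall x, 0 <= h x) -> h x0 != 0 ->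
  0 < \int[mu]_x h x.
Proof.
move=> ch ih h0 hx; have hx0 : 0 < h x0 by rewrite lt_def hx h0.
have c0 : 0 < h x0 / 2 by rewrite divr_gt0.
have : nbhs x0 [set x | h x0 / 2 < h x].
  apply: (ch x0 [set y | h x0 / 2 < y]); apply: lt_nbhsr; lra.
move=> /nbhs_ballP[e /= e0 eP].
have mB := measurable_rV_ball x0 e0.
have mBE := lebesgue_rV_ball x0 e0.
have iB : mu.-integrable setT (EFin \o \1_(ball x0 e)).
  apply/integrableP; split; first by apply/measurable_EFinP; exact: measurable_indic.
  under eq_integral do rewrite /= ger0_norm//.
  by rewrite integral_indic ?setIT//= mBE ltry.
have IB : \int[mu]_x \1_(ball x0 e) x = (e *+ 2) ^+ n.
  by rewrite /Rintegral integral_indic// setIT [X in fine X]mBE.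
apply: (@lt_le_trans _ _ (\int[mu]_x (h x0 / 2 * \1_(ball x0 e) x))).
  by rewrite RintegralZl// IB mulr_gt0// exprn_gt0// mulrn_wgt0.
apply: le_Rintegral => //.
  by have := integrableZl measurableT (h x0 / 2) iB; apply: eq_integrable.
move=> x _; rewrite indicE; case: (boolP (x \in _)) => [|_]; last by rewrite mulr0.
by rewrite inE => /eP /= /ltW; rewrite mulr1.
Qed.

Lemma integrable_compact_support (h : 'rV[R]_n -> R) (Y : R) : continuous h ->
  (forall x, Y < sqn x -> h x = 0) -> mu.-integrable setT (EFin \o h).
Proof.
move=> ch h0; have mY : measurable [set x : 'rV[R]_n | sqn x <= Y].
  rewrite -[X in measurable X]setTI.
  by apply: (measurable_sqn measurableT (measurable_itv `]-oo, Y])).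
have i1 : (\1_[set x : 'rV[R]_n | sqn x <= Y] : 'rV[R]_n -> R) \in Lfun mu 2%:E.
  apply: (@Lfun2_bounded R n _ 1 Y); first exact: measurable_indic.
  - by move=> x; rewrite indicE; case: (_ \in _); rewrite ?normr1 ?normr0.
  - by move=> x xY; rewrite indicE memNset// => /=; apply/negP; rewrite -ltNge.
have := dot_integrable (Lfun2_compact_support ch h0) i1.
apply: eq_integrable => // x _ /=; congr (_%:E).
rewrite indicE; case: (boolP (x \in _)) => [_|]; first by rewrite mulr1.
by rewrite notin_setE/= => /negP; rewrite -ltNge => /h0 ->; rewrite mul0r.
Qed.

End positivity.

Section strauss.
Context {R : realType}.
Variables (n : nat) (mu p : R).
Hypotheses (hn : (2 <= n)%N) (mu_gt0 : 0 < mu)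
  (hmu : mu < (n%:R ^+ 2 + n%:R + 2) / (n%:R + 2))
  (hp : p = strauss_exponent (n%:R + mu)).
Let N : R := n%:R + mu.

Let nge2 : 2 <= n%:R :> R. Proof. by rewrite ler_nat. Qed.
Let N2 : 2 < N. Proof. by rewrite /N; have := nge2; have := mu_gt0; lra. Qed.
Let s : R := Num.sqrt (N ^+ 2 + 10 * N - 7).
Let ss : s ^+ 2 = N ^+ 2 + 10 * N - 7.
Proof. by rewrite sqr_sqrtr//; have := N2; nra. Qed.
Let s0 : 0 <= s. Proof. exact: sqrtr_ge0. Qed.
Let pE : 2 * (N - 1) * p = N + 1 + s.
Proof.
have h := N2; rewrite hp /strauss_exponent -/N -/s mulrC divfK//.
by rewrite mulf_neq0// gt_eqF// subr_gt0; lra.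
Qed.

Lemma strauss_root : 2 + (N + 1) * p - (N - 1) * p ^+ 2 = 0.
Proof.
have h2 := N2; have h := pE; have hs := ss.
have N1 : 4 * (N - 1) != 0 by rewrite mulf_neq0// gt_eqF// subr_gt0; lra.
apply/eqP; rewrite -(inj_eq (mulfI N1)) mulr0; apply/eqP.
have hs' : s = 2 * (N - 1) * p - N - 1 by lra.
rewrite hs' in hs; nra.
Qed.

Lemma strauss_gt1 : 1 < p.
Proof.
have h2 := N2; have h := pE; have hs := ss; have h0 := s0.
rewrite ltNge; apply/negP => p1.
have h3 : s <= N - 3 by nra.
nra.
Qed.

Lemma strauss_energy_gt0 : 0 < (N - 1) / 2 - p^-1.
Proof.
have h2 := N2; have h := pE; have hs := ss; have h0 := s0; have p1 := strauss_gt1.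
have s1 : 1 < s by rewrite ltNge; apply/negP => s1; nra.
have p0 : 0 < p by lra.
by rewrite subr_gt0 invf_plt ?posrE; [|lra|lra]; rewrite invf_div ltr_pdivrMr; lra.
Qed.

Let be : R := (n%:R - 1 - mu) / 2 - p^-1.

(** The equation of the Strauss exponent, in the form in which it makes the powers
    of r cancel in the scale estimate. *)
Lemma strauss_crit : - be * (1 - p^-1) - p^-1 - 1 + n%:R * (1 - p^-1) = 0.
Proof.
have p1 := strauss_gt1; have p0 : p != 0 by rewrite gt_eqF//; lra.
have h := strauss_root; rewrite /N in h.
apply/eqP; rewrite -(inj_eq (mulfI (expf_neq0 2 p0))) mulr0; apply/eqP.
have -> : p ^+ 2 * (- be * (1 - p^-1) - p^-1 - 1 + n%:R * (1 - p^-1)) =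
  - 2^-1 * (2 + (n%:R + mu + 1) * p - (n%:R + mu - 1) * p ^+ 2).
  by rewrite /be; field.
by rewrite h mulr0.
Qed.

(** Otherwise p <= 2 / M with M = n + 1 - mu. But the quadratic that vanishes at p
    is positive from 0 to 2 / M: it is concave, it is positive at 0, and its value
    at 2 / M is positive exactly by the upper bound on the damping. *)
Lemma strauss_beta_gt : 0 < be + 1.
Proof.
have p1 := strauss_gt1; have h := strauss_root; have n2 := nge2; have m0 := mu_gt0.
have p0 : 0 < p by lra.
have hm : mu * (n%:R + 2) < n%:R ^+ 2 + n%:R + 2.
  by rewrite -ltr_pdivlMr// ltr_wpDr.
pose M : R := n%:R + 1 - mu.
have M0 : 0 < M by rewrite /M; nra.
have key : 0 < 2 * M ^+ 2 + 2 * (N + 1) * M - 4 * (N - 1) by rewrite /M /N; nra.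
have be1E : be + 1 = (M * p - 2) / (2 * p) by rewrite /be /M; field; rewrite gt_eqF.
rewrite be1E divr_gt0 ?mulr_gt0// subr_gt0 ltNge; apply/negP => y2.
pose y := M * p; have y0 : 0 < y by rewrite mulr_gt0.
have E : 2 * M ^+ 2 * (1 - y / 2) + (y / 2) * (2 * M ^+ 2 + 2 * (N + 1) * M - 4 * (N - 1))
  + (N - 1) * y * (2 - y) = 0.
  have -> : 0 = M ^+ 2 * (2 + (N + 1) * p - (N - 1) * p ^+ 2) by rewrite h mulr0.
  by rewrite /y; field.
have t1 : 0 <= 2 * M ^+ 2 * (1 - y / 2).
  have y2' : 0 <= 1 - y / 2 by rewrite /y; lra.
  by apply: mulr_ge0 => //; apply: mulr_ge0 => //; exact: sqr_ge0.
have t2 : 0 < (y / 2) * (2 * M ^+ 2 + 2 * (N + 1) * M - 4 * (N - 1)).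
  by rewrite mulr_gt0// divr_gt0.
have t3 : 0 <= (N - 1) * y * (2 - y).
  have h2 := N2; apply: mulr_ge0; last by rewrite /y; lra.
  by apply: mulr_ge0; [lra|exact: ltW].
lra.
Qed.

End strauss.

(** * Blow-up and the lifespan *)

Lemma power2_le_expR {R : realType} (k : nat) : 2 ^+ k <= expR k%:R :> R.
Proof.
rewrite -[k%:R]mulr1 expRM_natl; apply: lerXn2r; rewrite ?nnegrE ?expR_ge0//.
by have := @expR_ge1Dx R 1; lra.
Qed.

Unset Implicit Arguments.

Theorem theorem1p1 (R : realType) (n : nat) (hn : (2 <= n)%N)
    (mu : R) (hmu0 : 0 < mu) (hmu : mu < (n%:R ^+ 2 + n%:R + 2) / (n%:R + 2))
    (p : R) (hp : p = strauss_exponent (n%:R + mu))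
    (f g : 'rV[R]_n -> R)
    (hf : test_function [set: 'rV[R]_n] f)
    (hg : test_function [set: 'rV[R]_n] g)
    (hf0 : forall x, 0 <= f x) (hg0 : forall x, 0 <= g x)
    (hfg : ~ ((forall x, f x = 0) /\ (forall x, g x = 0)))
    (hfsupp : closure [set x | f x != 0] `<=` [set x | enorm x < 2^-1])
    (hgsupp : closure [set x | g x != 0] `<=` [set x | enorm x < 2^-1]) :
  exists eps0 C : R, 0 < eps0 /\ 0 < C /\
    forall eps : R, 0 < eps -> eps <= eps0 ->
      (forall (T : \bar R) (u : R -> 'rV[R]_n -> R), (0 < T)%E ->
         supported_solution mu p eps f g T u ->
         (T < +oo)%E /\ (T <= (expR (C * eps `^ (- (p * (p - 1)))))%:E)%E) /\
      (lifespan mu p eps f g < +oo)%E /\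
      (lifespan mu p eps f g <= (expR (C * eps `^ (- (p * (p - 1)))))%:E)%E.
Proof.
have p1 : 1 < p := strauss_gt1 hn hmu0 hp.
have p0 : 0 < p by lra.
pose be : R := (n%:R - 1 - mu) / 2 - p^-1.
have be1 : 0 < be + 1 := strauss_beta_gt hn hmu0 hmu hp.
have bem : 0 < be + mu.
  by have h := strauss_energy_gt0 hn hmu0 hp; rewrite /be; lra.
have crit := strauss_crit hn hmu0 hp.
have [mm mmp] : exists mm : nat, mm.+2%:R / p <= mm%:R.
  have h : 0 < (p - 1) / 2 by lra.
  have [k hk] := @ltr_add_invr R 0 _ h.
  exists k.+1; rewrite ler_pdivrMr//; move: hk; rewrite add0r invf_plt ?posrE//.
  rewrite invf_div ltr_pdivrMr; last by lra.
  by rewrite -!natr1; lra.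
have supp0 (h : 'rV[R]_n -> R) :
    closure [set x | h x != 0] `<=` [set x | enorm x < 2^-1] ->
    forall x, h x != 0 -> enorm x < 2^-1.
  by move=> hs x hx; apply: hs; exact: subset_closure.
have fs := supp0 f hfsupp; have gs := supp0 g hgsupp.
have supp1 (h : 'rV[R]_n -> R) : (forall x, h x != 0 -> enorm x < 2^-1) ->
    forall x, 1 < sqn x -> h x = 0.
  move=> hs x hx; apply/eqP; apply: contraTT hx => /hs hx.
  by rewrite -leNgt -enorm_sqr; have := enorm_ge0 x; nra.
have [cf cg] : continuous f /\ continuous g.
  by case: hf hg => [sf _ _] [sg _ _]; split; [exact: (sf 0%N)|exact: (sg 0%N)].
have Lf := Lfun2_compact_support cf (supp1 f fs).
have Lg := Lfun2_compact_support cg (supp1 g gs).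
pose I0 := \int[lebesgue_rV R n]_x g x + (mu + be) * \int[lebesgue_rV R n]_x f x.
have I0p : 0 < I0.
  have If : 0 <= \int[lebesgue_rV R n]_x f x by exact: Rintegral_ge0.
  have Ig : 0 <= \int[lebesgue_rV R n]_x g x by exact: Rintegral_ge0.
  have mub : 0 < mu + be by lra.
  have [[x gx]|g0] := pselect (exists x, g x != 0).
    rewrite ltr_wpDr ?mulr_ge0 ?(ltW mub)//.
    exact: Rintegral_gt0 cg (integrable_compact_support cg (supp1 g gs)) hg0 gx.
  have [[x fx]|f0] := pselect (exists x, f x != 0).
    rewrite ltr_wpDl// mulr_gt0//.
    exact: Rintegral_gt0 cf (integrable_compact_support cf (supp1 f fs)) hf0 fx.
  exfalso; apply: hfg; split => x; apply/eqP/negPn/negP => hx.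
    by apply: f0; exists x.
  by apply: g0; exists x.
have n0 : (0 < n)%N by exact: leq_trans hn.
have [c c0 hc] := dyadic_estimate n0 (ltW hmu0) p1 bem be1 mmp erefl crit.
have pm1 : 0 < p - 1 by lra.
pose K1 := 2 `^ (p - 1) / ((p - 1) * c) * (c * I0 `^ p) `^ (1 - p).
have K1p : 0 < K1.
  by rewrite mulr_gt0 ?powR_gt0 ?divr_gt0 ?powR_gt0 ?mulr_gt0 ?powR_gt0.
exists 1, (2 * (K1 + 1)); split => //; split; first by lra.
move=> eps eps0 eps1; set E := eps `^ _.
have E1 : 1 <= E.
  rewrite /E powRN invf_ge1 ?powR_gt0//.
  apply: (@le_trans _ _ (1 `^ (p * (p - 1)))); last by rewrite powR1.
  apply: ge0_ler_powR; rewrite ?nnegrE ?(ltW eps0)//.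
  by apply: mulr_ge0; exact: ltW.
have main (T : \bar R) u : supported_solution mu p eps f g T u ->
    (T <= (expR (2 * (K1 + 1) * E))%:E)%E.
  move=> hu; rewrite leNgt; apply/negP => hT.
  have K1E : 0 <= K1 * E by apply: mulr_ge0; lra.
  (* J is too large for the discrete inequality, while 2 J dyadic scales fit below
     the claimed bound *)
  pose J := (Num.truncn (K1 * E)).+1.
  have /andP[J1 J2] := truncn_itv K1E.
  have hJ : J%:R <= (K1 + 1) * E by rewrite /J -natr1; lra.
  pose Rm : R := 2 ^+ (2 * J).
  have RmT : (Rm%:E < T)%E.
    apply: le_lt_trans hT; rewrite lee_fin; apply: (le_trans (power2_le_expR _)).
    by rewrite ler_expR natrM -mulrA ler_wpM2l.
  have step := hc eps f g T u (ltW eps0) Lf Lg hf0 hg0 fs gs hu Rm RmT.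
  have dy j : (j < 2 * J)%N -> 2 ^+ j.+1 <= Rm.
    by move=> jJ; rewrite /Rm ler_eXn2l// ltr1n.
  have kap0 : 0 < c * (eps * I0) `^ p by rewrite mulr_gt0 ?powR_gt0 ?mulr_gt0.
  have := @discrete_blowup R p c (c * (eps * I0) `^ p)
    (fun i => bulk u p Rm mm be (2 ^+ i)) J p1 c0 kap0 (ltn0Sn _) (bulk_ge0 _ _ _ _ _ _)
    (fun j jJ => (step j (dy j jJ)).1) (fun j jJ => (step j (dy j jJ)).2).
  have -> : (c * (eps * I0) `^ p) `^ (1 - p) = (c * I0 `^ p) `^ (1 - p) * E.
    have cI : 0 <= c * I0 `^ p by apply: mulr_ge0; [exact: ltW|exact: powR_ge0].
    rewrite (powRM _ (ltW eps0) (ltW I0p)) mulrCA.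
    rewrite (powRM _ (powR_ge0 _ _) cI) -powRrM [LHS]mulrC; congr (_ * _ `^ _).
    by ring.
  by rewrite mulrA -/K1 leNgt J2.
have fin (x : \bar R) : (x <= (expR (2 * (K1 + 1) * E))%:E)%E -> (x < +oo)%E.
  by move=> /le_lt_trans; apply; exact: ltry.
have lif : (lifespan mu p eps f g <= (expR (2 * (K1 + 1) * E))%:E)%E.
  by apply: ge_ereal_sup => T [_ [u hu]]; exact: main hu.
split; first by move=> T u _ hu; have hT := main T u hu; split => //; exact: fin.
by split => //; exact: fin.
Qed.
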